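(* Let $h \geq 1$, let $G$ be a connected graph that excludes $K_h$ as a topological subgraph, and let $t \geq t(h) = 144 a_{\mathsf{deg}}^2 h^5$. Then there is a color $c_0 \in \{\mathrm{WL}_3^G(v,v,v) \mid v \in V(G)\}$ such that, for the pair-coloring $\chi(v,w) := \mathrm{WL}_3^G(v,w,w)$ ($v,w \in V(G)$) and $X := \{v \in V(G) \mid \mathrm{WL}_3^G(v,v,v) = c_0\}$, it holds that $X \subseteq \mathrm{cl}_t^{(G,\chi)}(v)$ for all $v \in X$.
   Context: Graphs are finite, simple, undirected. $H$ is a topological subgraph of $G$ if a subdivision of $H$ is a subgraph of $G$. $a_{\mathsf{deg}}$ is an absolute constant with $a_{\mathsf{deg}} \ge 2$ such that for every $h\ge 1$ every graph excluding $K_h$ as a topological subgraph has average degree at most $a_{\mathsf{deg}} h^2$ (such a constant exists by a known result). 3-dimensional Weisfeiler–Leman: the initial coloring $\mathrm{WL}_3^{G,0}$ of $V(G)^3$ gives $(v_1,v_2,v_3)$ and $(v_1',v_2',v_3')$ the same color iff for all $i,j$: $v_i=v_j \Leftrightarrow v_i'=v_j'$ and $v_iv_j\in E(G)\Leftrightarrow v_i'v_j'\in E(G)$. Refinement: $\mathrm{WL}_3^{G,i+1}(\bar v) = (\mathrm{WL}_3^{G,i}(\bar v), \{\!\{(\mathrm{WL}_3^{G,i}(\bar v[w/1]),\mathrm{WL}_3^{G,i}(\bar v[w/2]),\mathrm{WL}_3^{G,i}(\bar v[w/3])) \mid w \in V(G)\}\!\})$, where $\bar v[w/j]$ replaces the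 $j$-th entry by $w$. $\mathrm{WL}_3^G$ is the coloring at the first round $i$ at which the partition of $V(G)^3$ into color classes no longer changes. Color Refinement on a vertex- and arc-colored graph $(G,\chi_V,\chi_E)$ ($\chi_E$ colors ordered pairs $(v,w)$ with $vw\in E(G)$): $\chi^0=\chi_V$, $\chi^{i+1}(v)=(\chi^i(v),\{\!\{(\chi^i(w),\chi_E(v,w),\chi_E(w,v))\mid w\in N_G(v)\}\!\})$, stopped when the partition stabilizes; the result is denoted $\mathrm{CR}(G,\chi_V,\chi_E)$. The $t$-CR-stable coloring: $\chi_0=\chi_V$, $\chi_{2i+1}=\mathrm{CR}(G,\chi_{2i},\chi_E)$, $\chi_{2i+2}(v)=(v,1)$ if the $\chi_{2i+1}$-color class of $v$ has size at most $t$ and $\chi_{2i+2}(v)=(\chi_{2i+1}(v),0)$ otherwise; it is $\chi_{i_\infty}$ for the least $i_\infty$ with $\chi_{i_\infty}$ and $\chi_{i_\infty+1}$ inducing the same partition. For $X\subseteq V(G)$, the $t$-closure $\mathrm{cl}_t(X)$ is the set of vertices forming singleton color classes in the $t$-CR-stable coloring of the graph obtained by additionally individualizing every vertex of $X$ (giving each vertex of $X$ its own unique color). For a pair-colored graph $(G,\chi)$ with $\chi\colon V(G)^2\to C$ on $n$ vertices, $\mathrm{cl}_t^{(G,\chi)}(X)$ is the $t$-closure of $X$ in the complete graph $K_n$ on $V(G)$ with vertex colors $\chi(v,v)$ and arc colors $(1,\chi(v,w))$ if $vw\in E(G)$ and $(0,\chi(v,w))$ otherwise. $\mathrm{cl}_t^{(G,\chi)}(v)$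 abbreviates $\mathrm{cl}_t^{(G,\chi)}(\{v\})$.
   Formalization: The t-CR-stable coloring is taken at the least i where χ_i, χ_{i+1} and χ_{i+2} induce the same partition; comparing only χ_i and χ_{i+1} can stop at i = 0 before small classes are split, making the claim false (e.g. G = K_3, h = 4). *)

(* Defs.v *)
From mathcomp Require Import all_boot all_algebra.
From mathcomp Require Import finmap multiset reals.

Set Implicit Arguments.
Unset Strict Implicit.
Unset Printing Implicit Defensive.

Import GRing.Theory Num.Theory.

Record sgraph := SGraph {
  vertex :> finType;
  edge : rel vertex;
  edge_sym : symmetric edge;
  edge_irrefl : irreflexive edge }.

Definition connected (G : sgraph) : Prop :=
  0 < #|G| /\ forall x y : G, connect (@edge G) x y.

Fact complete_sym (T : finType) : symmetric [rel x y : T | x != y].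
Proof. by move=> x y /=; rewrite eq_sym. Qed.

Fact complete_irrefl (T : finType) : irreflexive [rel x y : T | x != y].
Proof. by move=> x /=; rewrite eqxx. Qed.

Definition complete_graph (T : finType) : sgraph :=
  SGraph (@complete_sym T) (@complete_irrefl T).

(* Up to isomorphism: [H] is isomorphic to a subgraph of [G]. *)
Definition subgraph (H G : sgraph) : Prop :=
  exists f : H -> G, injective f /\ forall x y, edge x y -> edge (f x) (f y).

(* Subdividing the edge [uv] once: [uv] is replaced by the path
   [u - None - v] through the new vertex [None]. *)
Definition subdivide_rel (G : sgraph) (u v : G) : rel (option G) :=
  fun a b => match a, b with
  | Some x, Some y =>
      edge x y && ~~ ((x == u) && (y == v) || (x == v) && (y == u))
  | Some x, None | None, Some x => (x == u) || (x == v)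
  | None, None => false
  end.

Fact subdivide_sym (G : sgraph) (u v : G) : symmetric (subdivide_rel u v).
Proof.
move=> [x|] [y|] //=; rewrite (edge_sym x y); congr (_ && ~~ _).
by rewrite orbC (andbC (x == v)) (andbC (x == u)).
Qed.

Fact subdivide_irrefl (G : sgraph) (u v : G) : irreflexive (subdivide_rel u v).
Proof. by case=> [x|] //=; rewrite edge_irrefl. Qed.

Definition subdivide (G : sgraph) (u v : G) : sgraph :=
  SGraph (subdivide_sym u v) (subdivide_irrefl u v).

Inductive subdivision (H : sgraph) : sgraph -> Prop :=
| subdivision_refl : subdivision H H
| subdivision_step (S : sgraph) (u v : S) :
    subdivision H S -> edge u v -> subdivision H (subdivide u v).

Definition topological_subgraph (H G : sgraph) : Prop :=
  exists S : sgraph, subdivision H S /\ subgraph S G.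

Section AverageDegree.
Local Open Scope ring_scope.

(* 0 for the graph without vertices. *)
Definition average_degree (R : realType) (G : sgraph) : R :=
  (\sum_(v : G) #|edge v|)%:R / #|G|%:R.

Definition is_adeg (R : realType) (a : R) : Prop :=
  2 <= a /\
  forall (h : nat) (G : sgraph), (1 <= h)%N ->
    ~ topological_subgraph (complete_graph 'I_h) G ->
    average_degree R G <= a * h%:R ^+ 2.

End AverageDegree.

(* The refinement procedures below enlarge the set of colors in each round, so
   a coloring carries its own type of colors. *)
Record coloring (V : finType) := Coloring {
  color : choiceType;
  color_of :> V -> color }.

Definition same_partition (V : finType) (c d : coloring V) : bool :=
  [forall x, forall y, (c x == c y) == (d x == d y)].

Definition refines (V : finType) (d c : coloring V) : Prop :=
  forall x y, d x = d y -> c x = c y.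

Lemma same_partitionP (V : finType) (c d : coloring V) :
  refines d c -> refines c d -> same_partition c d.
Proof.
move=> dc cd; apply/forallP => x; apply/forallP => y; apply/eqP.
by apply/eqP/eqP => [/cd|/dc].
Qed.

Lemma refines_trans (V : finType) (c d e : coloring V) :
  refines e d -> refines d c -> refines e c.
Proof. by move=> ed dc x y /ed/dc. Qed.

Lemma refining_stabilizes (V : finType) (F : nat -> coloring V) :
  (forall i, refines (F i.+1) (F i)) ->
  exists i, same_partition (F i) (F i.+1).
Proof.
move=> Fref; pose P i := [set p : V * V | F i p.1 == F i p.2].
have sub i : P i.+1 \subset P i.
  by apply/subsetP => -[x y]; rewrite !inE => /eqP/Fref->.
have stable i : #|P i| <= #|P i.+1| -> same_partition (F i) (F i.+1).
  move=> leP; apply: same_partitionP => // x y Exy.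
  have /eqP EP : P i.+1 == P i by rewrite eqEcard sub.
  have : (x, y) \in P i by rewrite inE Exy /=.
  by rewrite -EP inE => /eqP.
suff H n : forall i, #|P i| <= n -> exists i, same_partition (F i) (F i.+1).
  exact: (H _ 0 (leqnn _)).
elim: n => [|n IH] i le_n; have [/stable|Plt] := leqP #|P i| #|P i.+1|;
  [by exists i | by have := leq_trans Plt le_n | by exists i |].
by apply: (IH i.+1); rewrite -ltnS (leq_trans Plt).
Qed.

Definition stable_coloring (V : finType) (F : nat -> coloring V)
    (Fref : forall i, refines (F i.+1) (F i)) : coloring V :=
  F (ex_minn (refining_stabilizes Fref)).

Section WeisfeilerLeman.
Variable G : sgraph.
Implicit Types (v : 3.-tuple G).

Definition wl3_init : coloring (3.-tuple G) :=
  Coloring (fun v => [ffun ij : 'I_3 * 'I_3 =>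
    (tnth v ij.1 == tnth v ij.2, edge (tnth v ij.1) (tnth v ij.2))]).

Definition subst_entry v (w : G) (j : 'I_3) : 3.-tuple G :=
  [tuple if i == j then w else tnth v i | i < 3].

Definition wl3_step (c : coloring (3.-tuple G)) : coloring (3.-tuple G) :=
  Coloring (fun v =>
    (c v, seq_mset [seq (c (subst_entry v w (inord 0)),
                         c (subst_entry v w (inord 1)),
                         c (subst_entry v w (inord 2))) | w <- enum G])).

Definition wl3_round (i : nat) : coloring (3.-tuple G) :=
  iter i wl3_step wl3_init.

Lemma wl3_round_refines i : refines (wl3_round i.+1) (wl3_round i).
Proof. by move=> x y [/=]. Qed.

Definition wl3 : coloring (3.-tuple G) := stable_coloring wl3_round_refines.

End WeisfeilerLeman.

Section ColorRefinement.
(* Only the values of [chiE] on the arcs of [G] matter. *)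
Variables (G : sgraph) (D : choiceType) (chiE : G -> G -> D).
Implicit Types (c : coloring G).

Definition cr_step c : coloring G :=
  Coloring (fun v =>
    (c v, seq_mset [seq (c w, chiE v w, chiE w v) | w <- enum (edge v)])).

Definition cr_round (chiV : coloring G) (i : nat) : coloring G :=
  iter i cr_step chiV.

Lemma cr_round_refines chiV i : refines (cr_round chiV i.+1) (cr_round chiV i).
Proof. by move=> x y [/=]. Qed.

Definition cr (chiV : coloring G) : coloring G :=
  stable_coloring (@cr_round_refines chiV).

Lemma cr_refines chiV : refines (cr chiV) chiV.
Proof.
rewrite /cr /stable_coloring; move: (ex_minn _) => n.
by elim: n => [|n IH] // x y /cr_round_refines/IH.
Qed.

Definition color_class (c : coloring G) (v : G) : {set G} :=
  [set w | c w == c v].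

(* [inl v] is the color (v,1) and [inr a] is the color (a,0). *)
Definition split_small (t : nat) (c : coloring G) : coloring G :=
  Coloring (fun v =>
    if #|color_class c v| <= t then inl v else inr (c v) : (G + color c)%type).

Lemma split_small_refines t c : refines (split_small t c) c.
Proof. by move=> x y /=; case: ifP => _; case: ifP => _ // [->]. Qed.

Fixpoint tcr_round (t : nat) (chiV : coloring G) (i : nat) : coloring G :=
  if i is j.+1 then
    if odd j then split_small t (tcr_round t chiV j)
    else cr (tcr_round t chiV j)
  else chiV.

Lemma tcr_round_refines t chiV i :
  refines (tcr_round t chiV i.+1) (tcr_round t chiV i).
Proof.
rewrite /=; case: odd; [exact: split_small_refines | exact: cr_refines].
Qed.

(* Stability means that neither Color Refinement nor splitting small classes
   changes the partition, so two consecutive rounds are compared.  Comparing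
   rounds [i] and [i.+1] only gives the same partition, except that it would
   stop at [i = 0], before any class is split, whenever [chiV] happens to be
   stable under Color Refinement. *)
Definition tcr_is_stable t chiV : pred nat := fun i =>
  same_partition (tcr_round t chiV i) (tcr_round t chiV i.+1) &&
  same_partition (tcr_round t chiV i.+1) (tcr_round t chiV i.+2).

Lemma tcr_stabilizes t chiV : exists i, tcr_is_stable t chiV i.
Proof.
pose F i := tcr_round t chiV i.*2.
have Fref i : refines (F i.+1) (F i).
  by apply: refines_trans; [exact: tcr_round_refines|exact: tcr_round_refines].
have [i /forallP Ei] := refining_stabilizes Fref.
have EF : refines (F i) (F i.+1).
  by move=> x y /eqP; have /forallP/(_ y)/eqP-> := Ei x => /eqP.
have r1 : refines (tcr_round t chiV i.*2.+1) (tcr_round t chiV i.*2).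
  exact: tcr_round_refines.
have r2 : refines (tcr_round t chiV i.*2.+2) (tcr_round t chiV i.*2.+1).
  exact: tcr_round_refines.
exists i.*2; apply/andP; split; apply: same_partitionP => //.
- exact: refines_trans EF r2.
- exact: refines_trans r1 EF.
Qed.

Definition tcr (t : nat) (chiV : coloring G) : coloring G :=
  tcr_round t chiV (ex_minn (tcr_stabilizes t chiV)).

Definition individualize (X : {set G}) (c : coloring G) : coloring G :=
  Coloring (fun v => if v \in X then inl v else inr (c v) : (G + color c)%type).

Definition t_closure (t : nat) (chiV : coloring G) (X : {set G}) : {set G} :=
  [set v | #|color_class (tcr t (individualize X chiV)) v| == 1].

End ColorRefinement.

Definition pair_closure (G : sgraph) (C : choiceType) (chi : G -> G -> C)
    (t : nat) (X : {set G}) : {set G} :=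
  @t_closure (complete_graph G) (bool * C)%type
    (fun v w : G => (@edge G v w, chi v w)) t
    (@Coloring (complete_graph G) C (fun v : G => chi v v)) X.

(* Main.v *)
Require Import Defs.
From mathcomp Require Import all_boot all_algebra.
From mathcomp Require Import finmap multiset reals.
From mathcomp Require Import all_order zify ring lra.

(* For [u] whose closure [cl u] is smallest, the sets [cl u] partition the set
   [T] of such vertices into blocks, and [T] is a union of color classes.  If
   there is one block, any color class inside [T] works.  Otherwise some path
   with no inner vertex in [T] joins two blocks; start a breadth-first search
   outside [T] from the color class [S] of its end with the larger class.
   Until labels from two blocks meet, each vertex at positive depth carries
   fewer than [h] labels (starting points of descending paths), since a larger
   number of attachments of a connected set to a closure yields a topological
   [K_h].  On the other hand a pair outside a closure has valency more than
   [t], so color classes of vertices and of triples are large and the bipartite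
   graphs between them are biregular.  At the first place where two blocks
   meet, or where the search meets [T] again, Rado's theorem applied along the
   levels extracts from a color class of triples too many disjoint paths
   joining distinct pairs in [S] (or between [S] and one further class of
   comparable size), against the density bound for graphs without a
   topological [K_h]. *)

Set Implicit Arguments.
Unset Strict Implicit.
Unset Printing Implicit Defensive.
Import Order.TTheory GRing.Theory Num.Theory.

(** * Rank functions and independent transversals *)

(** The paths are chosen one at a time, and nothing bounds the sizes of the levels, so blocked
    choices cannot be counted as vertices. Instead a matroid rank measures the family chosen so far,
    and every estimate bounds the share of a color class that a set of given rank can occupy;
    regularity of the coloring carries shares from level to level. Dimension three enters because a
    closure class is a ternary relation: the individualized vertex and two members of the class. Put
    [A = a * h ^ 2] for the density bound and [n = #|S|]; the hypothesis on [t] reads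
    [144 * A ^ 2 * h <= t]. Routing [k] paths exhausts tokens that carry a share of order
    [h * k / (n * t)] of the triples. If the class of the meeting vertex has at most [2 * A * n]
    elements, it joins the vertex set of the auxiliary graph and [k] may reach
    [A * (1 + 2 * A) * n]: hence the square of [a] and the fifth power of [h]. If it is larger, its
    elements serve as inner vertices, each on one path, and with [k <= A * n] this blocks at most
    half of the triples. The factor 144 leaves slack in both cases. *)

Lemma set_induction (T : finType) (P : {set T} -> Prop) :
  P set0 -> (forall x (X : {set T}), x \notin X -> P X -> P (x |: X)) ->
  forall X, P X.
Proof.
move=> P0 PU X; have [n] := ubnP #|X|; elim: n X => // n IH X.
have [->//|[x xX]] := set_0Vmem X; rewrite (cardsD1 x) xX ltnS => lt.
by rewrite -(setD1K xX); apply: PU; [rewrite !inE eqxx | exact: IH].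
Qed.

Section RankFunctions.
Variable W : finType.
Implicit Types (X Y A B : {set W}) (c : {set W} -> nat) (N : W -> {set W}).

(** The axioms of a matroid rank function; independence of [X] is written [c X = #|X|]
    throughout. *)
Record rank_function c : Prop := RankFunction {
  rank0 : c set0 = 0;
  rankU1 : forall x X, c (x |: X) <= (c X).+1;
  rankS : forall X Y, X \subset Y -> c X <= c Y;
  rankUI : forall X Y, c (X :|: Y) + c (X :&: Y) <= c X + c Y }.

Lemma card_rank : rank_function (fun X => #|X|).
Proof.
split; first by rewrite cards0.
- by move=> x X; rewrite cardsU1; case: (x \in X); lia.
- by move=> X Y; exact: subset_leq_card.
- by move=> X Y; rewrite cardsUI.
Qed.

Lemma rank_leU c : rank_function c ->
  forall X Y, c (X :|: Y) <= c X + #|Y|.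
Proof.
move=> rc X Y; elim/set_induction: Y => [|y Y yNY IH].
  by rewrite setU0 cards0 addn0.
rewrite setUCA cardsU1 yNY.
have := rankU1 rc y (X :|: Y); lia.
Qed.

Lemma rank_le_card c : rank_function c -> forall X, c X <= #|X|.
Proof. by move=> rc X; have := rank_leU rc set0 X; rewrite set0U (rank0 rc). Qed.

Lemma rank_independentS c : rank_function c ->
  forall X Y, c X = #|X| -> Y \subset X -> c Y = #|Y|.
Proof.
move=> rc X Y cX YX; apply/eqP; rewrite eqn_leq rank_le_card //=.
have := rank_leU rc Y (X :\: Y); rewrite setDE setUIr setUCr setIT (setUidPr YX).
have := cardsID Y X; rewrite (setIidPr YX) cX setDE; lia.
Qed.

(** Submodularity adds the elements of [B] one by one without raising the rank. All greedy choices
    below rest on this: the elements that cannot be added form a set whose rank stays that of the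
    current family. *)
Lemma rank_span c : rank_function c ->
  forall A B k, c A = k -> (forall x, x \in B -> c (x |: A) <= k) ->
  c (A :|: B) = k.
Proof.
move=> rc A B k cA; elim/set_induction: B => [|x B xNB IH] H; first by rewrite setU0.
have cB : c (A :|: B) = k by apply: IH => y yB; apply: H; rewrite !inE yB orbT.
have cx : c (x |: A) <= k by apply: H; rewrite !inE eqxx.
have := rankUI rc (A :|: B) (x |: A).
have -> : A :|: B :|: (x |: A) = A :|: (x |: B).
  by apply/setP => z; rewrite !inE; do !case: (_ \in _); do ?case: (_ == _).
have : c A <= c ((A :|: B) :&: (x |: A)).
  by apply: (rankS rc); apply/subsetP => z; rewrite !inE => ->; rewrite orbT.
have : c A <= c (A :|: (x |: B)) by apply: (rankS rc); exact: subsetUl.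
lia.
Qed.

Definition nbrs N X := \bigcup_(x in X) N x.

Lemma nbrsU N X Y : nbrs N (X :|: Y) = nbrs N X :|: nbrs N Y.
Proof. exact: bigcup_setU. Qed.

Lemma nbrsS N X Y : X \subset Y -> nbrs N X \subset nbrs N Y.
Proof. by move=> /setUidPr <-; rewrite nbrsU subsetUl. Qed.

Lemma nbrsP N X y : reflect (exists2 x, x \in X & y \in N x) (y \in nbrs N X).
Proof. exact: bigcupP. Qed.

(* By induction on the total size of the sets [N x]: a set with at least two
   elements can lose one of them. *)
Lemma rado c : rank_function c ->
  forall N A, (forall Y, Y \subset A -> #|Y| <= c (nbrs N Y)) ->
  exists f : W -> W, [/\ {in A &, injective f}, {in A, forall x, f x \in N x}
    & c (f @: A) = #|A|].
Proof.
move=> rc N A; have [m] := ubnP (\sum_(x in A) #|N x|).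
elim: m N => // m IH N; rewrite ltnS => le_m hall.
have [/existsP[a /andP[aA]]|] := boolP [exists a in A, 1 < #|N a|]; last first.
  rewrite negb_exists => /forallP sm.
  have {}sm a : a \in A -> exists b, N a = [set b].
    move=> aA; apply/cards1P; have := sm a; rewrite aA /= -leqNgt => le1.
    have := hall [set a]; rewrite sub1set aA cards1 /nbrs big_set1 => /(_ isT) ge1.
    by rewrite eqn_leq le1 (leq_trans ge1) ?rank_le_card.
  pose f a := odflt a [pick b in N a].
  have Nf a : a \in A -> N a = [set f a].
    move=> /sm[b Nb]; rewrite /f; case: pickP => [x|/(_ b)]; rewrite Nb !inE ?eqxx //.
    by move=> /eqP->.
  have nf Y : Y \subset A -> nbrs N Y = f @: Y.
    move=> YA; apply/setP => y; apply/nbrsP/imsetP => -[x xY].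
      by rewrite Nf ?(subsetP YA) // inE => /eqP; exists x.
    by move=> ->; exists x => //; rewrite Nf ?(subsetP YA) // inE.
  have cf : c (f @: A) = #|A|.
    apply/eqP; rewrite eqn_leq -{2}nf // hall // andbT.
    exact: leq_trans (rank_le_card rc _) (leq_imset_card _ _).
  exists f; split=> // [|a aA]; last by rewrite Nf // inE.
  apply/imset_injP; rewrite eqn_leq leq_imset_card -{1}cf; exact: rank_le_card.
case/card_gt1P => b1 [b2 [b1N b2N b12]].
pose N' b x := if x == a then N a :\ b else N x.
have bad b : b \in N a ->
    (forall Y, Y \subset A -> #|Y| <= c (nbrs (N' b) Y)) ->
    exists f : W -> W, [/\ {in A &, injective f}, {in A, forall x, f x \in N x}
      & c (f @: A) = #|A|].
  move=> bN h'; have [||f [fI fN fc]] := IH (N' b) => //.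
    rewrite (leq_trans _ le_m) // [leqRHS](bigD1 a) //= (bigD1 a) //= -addSn leq_add //.
      by rewrite /N' eqxx [leqRHS](cardsD1 b) bN.
    by apply: leq_sum => x /andP[_ /negPf xa]; rewrite /N' xa.
  exists f; split=> // x /fN; rewrite /N'; case: eqP => // ->.
  by rewrite !inE => /andP[].
have viol b : b \in N a ->
    (exists f : W -> W, [/\ {in A &, injective f}, {in A, forall x, f x \in N x}
      & c (f @: A) = #|A|]) \/
    exists Y, [/\ Y \subset A, a \notin Y & c (nbrs N Y :|: (N a :\ b)) <= #|Y|].
  move=> bN; have [/forallP H|] := boolP [forall Y : {set W},
      (Y \subset A) ==> (#|Y| <= c (nbrs (N' b) Y))].
    by left; apply: (bad b) => // Y YA; apply: (implyP (H Y)).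
  rewrite negb_forall => /existsP[Y]; rewrite negb_imply -ltnNge => /andP[YA lt].
  have nb (Z : {set W}) : a \notin Z -> nbrs (N' b) Z = nbrs N Z.
    move=> aZ; apply: eq_bigr => x xZ; rewrite /N'; case: eqP => // xa.
    by rewrite -xa xZ in aZ.
  have aY : a \in Y.
    by apply: contraLR lt => aY; rewrite -leqNgt nb // hall.
  right; exists (Y :\ a); split.
  - by rewrite subDset (subset_trans YA) ?subsetUr.
  - by rewrite !inE eqxx.
  - move: lt; rewrite (cardsD1 a) aY ltnS; apply: leq_trans.
    apply: (rankS rc); rewrite -{2}(setD1K aY) nbrsU [nbrs _ [set a]]big_set1.
    by rewrite {1}/N' eqxx nb ?inE ?eqxx // setUC.
case: (viol _ b1N) => // -[Y1 [Y1A aY1 c1]].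
case: (viol _ b2N) => // -[Y2 [Y2A aY2 c2]].
(* Neither deletion is possible. Since [b1 != b2], the two deficient sets together see all of [N a],
   so by submodularity the hypothesis fails for [a |: (Y1 :|: Y2)] or for [Y1 :&: Y2]. *)
have := rankUI rc (nbrs N Y1 :|: (N a :\ b1)) (nbrs N Y2 :|: (N a :\ b2)).
have -> : nbrs N Y1 :|: N a :\ b1 :|: (nbrs N Y2 :|: N a :\ b2) =
    nbrs N (a |: (Y1 :|: Y2)).
  rewrite !nbrsU /nbrs big_set1; apply/setP => z; rewrite !inE.
  case: (z =P b1) => [->|_]; first by rewrite b12 b1N /= !orbT.
  by case: (z \in nbrs N Y1); case: (z \in nbrs N Y2); case: (z \in N a); rewrite ?orbT ?andbT ?andbF ?orbF ?orbT.

have le1 : c (nbrs N (Y1 :&: Y2)) <=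
    c ((nbrs N Y1 :|: N a :\ b1) :&: (nbrs N Y2 :|: N a :\ b2)).
  apply: (rankS rc); rewrite subsetI !subsetU ?nbrsS //; by
    rewrite ?subsetIl ?subsetIr.
have := hall (a |: (Y1 :|: Y2)); have := hall (Y1 :&: Y2).
rewrite cardsU1 !inE negb_or aY1 aY2 /= add1n.
have := cardsUI Y1 Y2.
rewrite (subset_trans (subsetIl _ _) Y1A) !subUset sub1set aA Y1A Y2A.
move=> e /(_ isT) h1 /(_ isT) h2; lia.
Qed.

(** The rank of the matroid induced from [c] through the bipartite graph [N]: a set is independent
    when it can be matched into a [c]-independent set. The formula is the deficiency form of Rado's
    theorem. *)
Definition induced c N X :=
  let Y := [arg min_(Y < (set0 : {set W}) | Y \subset X)
    (c (nbrs N Y) + #|X :\: Y|)] in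
  c (nbrs N Y) + #|X :\: Y|.

Lemma induced_le c N X Y :
  Y \subset X -> induced c N X <= c (nbrs N Y) + #|X :\: Y|.
Proof. by move=> YX; rewrite /induced; case: arg_minnP => [|Z _]; [exact: sub0set|exact]. Qed.

Lemma induced_ex c N X :
  exists2 Y : {set W}, Y \subset X & induced c N X = c (nbrs N Y) + #|X :\: Y|.
Proof. by rewrite /induced; case: arg_minnP => [|Z ZX _]; [exact: sub0set|exists Z]. Qed.

Lemma induced_rank c N : rank_function c -> rank_function (induced c N).
Proof.
move=> rc; split.
- apply/eqP; rewrite -leqn0; apply: leq_trans (induced_le c N (sub0set _)) _.
  by rewrite /nbrs big_set0 (rank0 rc) setD0 cards0.
- move=> x X; have [Y YX ->] := induced_ex c N X.
  apply: leq_trans (induced_le c N (subset_trans YX (subsetUr _ _))) _.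
  rewrite -addnS leq_add2l setDUl; apply: leq_trans (leq_card_setU _ _) _.
  rewrite -add1n leq_add2r; apply: leq_trans (subset_leq_card (subsetDl _ _)) _.
  by rewrite cards1.
- move=> X X' XX'; have [Y YX ->] := induced_ex c N X'.
  apply: leq_trans (induced_le c N (subsetIr Y X)) _.
  apply: leq_add; first by apply: (rankS rc); apply: nbrsS; exact: subsetIl.
  apply: subset_leq_card; apply/subsetP => z; rewrite !inE => /andP[zY zX].
  by rewrite (subsetP XX') // andbT; apply: contra zY => ->.
- move=> X1 X2; have [Y1 YX1 ->] := induced_ex c N X1.
  have [Y2 YX2 ->] := induced_ex c N X2.
  have := induced_le c N (setUSS YX1 YX2); have := induced_le c N (setISS YX1 YX2).
  have := rankUI rc (nbrs N Y1) (nbrs N Y2); rewrite -nbrsU.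
  have : c (nbrs N (Y1 :&: Y2)) <= c (nbrs N Y1 :&: nbrs N Y2).
    by apply: (rankS rc); rewrite subsetI !nbrsS ?subsetIl ?subsetIr.
  have := cardsUI X1 X2; have := cardsUI Y1 Y2.
  have D (X Y : {set W}) : Y \subset X -> #|X :\: Y| + #|Y| = #|X|.
    by move=> YX; rewrite -[in RHS](cardsID Y X) (setIidPr YX) addnC.
  have := D _ _ YX1; have := D _ _ YX2; have := D _ _ (setUSS YX1 YX2).
  have := D _ _ (setISS YX1 YX2); lia.
Qed.

(** When the minimum equals [#|X|], comparing it with the value at each [Y] gives exactly the
    hypothesis of [rado]. *)
Lemma induced_transversal c N X : rank_function c ->
  induced c N X = #|X| ->
  exists f : W -> W, [/\ {in X &, injective f}, {in X, forall x, f x \in N x}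
    & c (f @: X) = #|X|].
Proof.
move=> rc iX; apply: rado => // Y YX; have := induced_le c N YX.
rewrite iX -[in leqLHS](cardsID Y X) (setIidPr YX); lia.
Qed.

Lemma transversal_induced c N X (f : W -> W) : rank_function c ->
  {in X &, injective f} -> {in X, forall x, f x \in N x} ->
  c (f @: X) = #|X| -> induced c N X = #|X|.
Proof.
move=> rc fI fN cf; apply/eqP; rewrite eqn_leq (rank_le_card (induced_rank N rc)) /=.
have [Y YX ->] := induced_ex c N X.
rewrite -[leqLHS](cardsID Y X) (setIidPr YX) leq_add2r.
have fIY : {in Y &, injective f}.
  by move=> x y xY yY; apply: fI; exact: (subsetP YX).
rewrite -(card_in_imset fIY).
have cfX : c (f @: X) = #|f @: X| by rewrite cf card_in_imset.
rewrite -(rank_independentS rc cfX (imsetS f YX)).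
apply: (rankS rc); apply/subsetP => _ /imsetP[x xY ->]; apply/nbrsP; exists x => //.
by apply: fN; exact: (subsetP YX).
Qed.

End RankFunctions.

(** * Disjoint paths and topological subgraphs *)

Definition linked (G : sgraph) (B : {set G}) (x y : G) : Prop :=
  exists2 p, path (@edge G) x (rcons p y) & {subset p <= B}.

Lemma linked_sym (G : sgraph) (B : {set G}) x y : linked B x y -> linked B y x.
Proof.
case=> p pe pB; exists (rev p); last by move=> z; rewrite mem_rev => /pB.
have := pe; rewrite -rev_path last_rcons belast_rcons rev_cons.
by rewrite (eq_path (e' := @edge G)) // => a b /=; rewrite edge_sym.
Qed.

(** [subdivision] is generated one edge at a time, so the induction runs on the number of inner
    vertices of the paths: the first inner vertex of a nonempty path becomes the image of a new
    subdivision vertex, and once all paths are empty [f] itself is an embedding. *)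
Lemma topological_of_paths (H S G : sgraph) (f : S -> G) (P : S -> S -> seq G) :
  subdivision H S -> injective f ->
  (forall x y, edge x y ->
     [/\ path (@edge G) (f x) (rcons (P x y) (f y)), uniq (P x y),
         P y x = rev (P x y) & forall z, f z \notin P x y]) ->
  (forall x y x' y' z, edge x y -> edge x' y' -> z \in P x y -> z \in P x' y' ->
     (x' == x) && (y' == y) || (x' == y) && (y' == x)) ->
  topological_subgraph H G.
Proof.
pose I (S' : sgraph) (P' : S' -> S' -> seq G) :=
  [set z | [exists x, exists y, edge x y && (z \in P' x y)]].
have [n] := ubnP #|I S P|; elim: n S f P => // n IH S f P le_n HS f_inj Ppath Pdisj.
have [/existsP[u /existsP[v /andP[uv Puv]]]|none] :=
    boolP [exists u, exists v, edge u v && (P u v != [::])]; last first.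
  exists S; split => //; exists f; split => // x y xy.
  have [+ _ _ _] := Ppath x y xy.
  suff -> : P x y = [::] by rewrite /= andbT.
  apply/eqP; apply: contraNT none => Pxy.
  by apply/existsP; exists x; apply/existsP; exists y; rewrite xy.
case Em: (P u v) Puv => [//|m q] _.
have [Muv Uuv Ruv Auv] := Ppath u v uv.
have u_v : u != v by apply: contraTneq uv => ->; rewrite edge_irrefl.
move: Muv Uuv Ruv Auv; rewrite Em /= => /andP[fum pq] /andP[mq uq] Ruv Auv.
pose f' (a : option S) := if a is Some x then f x else m.
(* The new vertex sits at [m], next to [f u]: its edge to [u] gets the empty path and its edge to
   [v] gets the remainder [q]. *)
pose P' (a b : option S) := match a, b with
  | Some x, Some y => P x y
  | Some x, None => if x == u then [::] else rev q
  | None, Some x => if x == u then [::] else q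
  | None, None => [::] end.
have mI x y : edge x y -> ~~ ((x == u) && (y == v) || (x == v) && (y == u)) ->
    forall z, z \in m :: q -> z \notin P x y.
  move=> xy nuv z zm; apply: contra nuv => zP.
  by apply: (Pdisj u v x y z) => //; rewrite Em.
apply: (IH (subdivide u v) f' P').
- rewrite ltnS in le_n; apply: leq_trans _ le_n.
  have mIP : m \in I S P.
    by rewrite inE; apply/existsP; exists u; apply/existsP; exists v; rewrite uv Em mem_head.
  rewrite (cardsD1 m (I S P)) mIP add1n ltnS; apply: subset_leq_card; apply/subsetP => z.
  have qI : z \in q -> z \in I S P :\ m.
    move=> zq; rewrite !inE (memPn mq) //=; apply/existsP; exists u; apply/existsP.
    by exists v; rewrite uv Em inE zq orbT.
  rewrite inE => /existsP[[x|] /existsP[[y|]]] //=.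
  + case/andP=> /andP[xy nuv] zP; rewrite !inE; apply/andP; split.
      by apply: contraTneq zP => ->; apply: mI; rewrite ?mem_head.
    by apply/existsP; exists x; apply/existsP; exists y; rewrite xy.
  + by case: ifP => // _ /andP[_]; rewrite mem_rev => /qI.
  + by case: ifP => // _ /andP[_ /qI].
- exact: subdivision_step.
- move=> [x|] [y|] //=; first by move/f_inj->.
  + by move=> E; have := Auv x; rewrite E mem_head.
  + by move=> E; have := Auv y; rewrite -E mem_head.
- have symG x y : edge x y = edge y x :> bool by exact: edge_sym.
  have pqr : path (@edge G) (f v) (rcons (rev q) m).
    have := pq; rewrite -rev_path last_rcons belast_rcons rev_cons.
    by rewrite (eq_path (e' := @edge G)) // => a b /=; rewrite edge_sym.
  have Aq z : f z \notin q by have := Auv z; rewrite inE negb_or => /andP[].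
  have fm z : f z != m by have := Auv z; rewrite inE negb_or => /andP[].
  have vu : (v == u) = false by rewrite eq_sym (negPf u_v).
  move=> [x|] [y|] //=.
  + case/andP=> xy nuv; have [? ? ? A] := Ppath x y xy; split => //.
    case=> [z|] /=; [exact: A | by apply: mI; rewrite ?mem_head].
  + case/orP => /eqP->; rewrite ?eqxx ?vu /=.
      by rewrite fum; split.
    rewrite rev_uniq revK; split => //; case=> [z|] /=; rewrite mem_rev //.
  + case/orP => /eqP->; rewrite ?eqxx ?vu /=.
      by rewrite edge_sym fum; split.
    split => //; case=> [z|] //=.
- have qP x y z : edge x y ->
      ~~ ((x == u) && (y == v) || (x == v) && (y == u)) -> z \in q -> z \in P x y -> False.
    by move=> xy nuv zq zP; have := mI _ _ xy nuv z; rewrite inE zq orbT zP => /(_ isT).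
  move=> [x|] [y|] [x'|] [y'|] z //=.
  + by move=> /andP[xy _] /andP[xy' _] zP zP'; apply: (Pdisj x y x' y' z).
  + by move=> /andP[xy nuv] _ zP; case: ifP => // _; rewrite mem_rev => /qP; case/(_ _ _ xy nuv).
  + by move=> /andP[xy nuv] _ zP; case: ifP => // _ /qP; case/(_ _ _ xy nuv).
  + move=> _ /andP[xy nuv]; case: ifP => // _; rewrite mem_rev => zq zP.
    by case: (qP _ _ _ xy nuv zq zP).
  + move=> /orP[]/eqP-> /orP[]/eqP->; rewrite ?eqxx ?(negPf u_v) //=; by case: ifP => //= _; rewrite ?orbT.
  + move=> /orP[]/eqP-> /orP[]/eqP->; rewrite ?eqxx ?(negPf u_v) //=; by case: ifP => //= _; rewrite ?orbT.
  + move=> _ /andP[xy nuv]; case: ifP => // _ zq zP.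
    by case: (qP _ _ _ xy nuv zq zP).
  + move=> /orP[]/eqP-> /orP[]/eqP->; rewrite ?eqxx ?(negPf u_v) //=; by case: ifP => //= _; rewrite ?orbT.
  + move=> /orP[]/eqP-> /orP[]/eqP->; rewrite ?eqxx ?(negPf u_v) //=; by case: ifP => //= _; rewrite ?orbT.
Qed.

Lemma linked_uniq (G : sgraph) (B : {set G}) x y : x != y -> linked B x y ->
  exists p, [/\ path (@edge G) x (rcons p y), uniq p & {subset p <= B}].
Proof.
move=> xy [p pe pB]; case/shortenP: pe (last_rcons x p y) => p' pe' up' sub.
case/lastP: p' pe' up' sub => [|q z] pe' up' sub; first by move/eqP; rewrite (negPf xy).
rewrite last_rcons => zy; subst z; exists q; split => //.
  by move: up' => /= /andP[_]; rewrite rcons_uniq => /andP[].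
move=> z zq; have := sub z; rewrite !mem_rcons !inE zq orbT => /(_ isT).
case/orP => [/eqP zy|/pB //]; move: up' => /= /andP[_].
by rewrite rcons_uniq -zy zq.
Qed.

Lemma topological_of_linked (H S G : sgraph) (f : S -> G)
    (B : S -> S -> {set G}) :
  subdivision H S -> injective f ->
  (forall x y, edge x y ->
     [/\ linked (B x y) (f x) (f y), B y x = B x y & forall z, f z \notin B x y]) ->
  (forall x y x' y' z, edge x y -> edge x' y' -> z \in B x y -> z \in B x' y' ->
     (x' == x) && (y' == y) || (x' == y) && (y' == x)) ->
  topological_subgraph H G.
Proof.
move=> HS f_inj Blink Bdisj.
have ex (xy : S * S) : exists p, edge xy.1 xy.2 ->
    [/\ path (@edge G) (f xy.1) (rcons p (f xy.2)), uniq p & {subset p <= B xy.1 xy.2}].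
  have [xy_e|_] := boolP (edge xy.1 xy.2); last by exists [::].
  have [Lxy _ _] := Blink _ _ xy_e.
  have [|p pP] := linked_uniq _ Lxy; last by exists p.
  by rewrite (inj_eq f_inj); apply: contraTneq xy_e => ->; rewrite edge_irrefl.
have [p1 p1P] := fin_all_exists ex.
pose p0 x y := p1 (x, y).
have p0P x y : edge x y -> [/\ path (@edge G) (f x) (rcons (p0 x y) (f y)),
    uniq (p0 x y) & {subset p0 x y <= B x y}] by exact: (p1P (x, y)).
(* One of the two chosen paths serves both orientations of an edge, so that reversing the ends
   reverses the path. *)
pose P x y := if enum_rank x < enum_rank y then p0 x y else rev (p0 y x).
have PB x y : edge x y -> {subset P x y <= B x y}.
  rewrite /P => xy; have yx : edge y x by rewrite edge_sym.
  case: ifP => _; first by have [] := p0P _ _ xy.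
  have [_ _ sub] := p0P _ _ yx; have [_ <- _] := Blink _ _ xy.
  by move=> z; rewrite mem_rev => /sub.
apply: (topological_of_paths (P := P) HS f_inj) => [x y xy|]; last first.
  move=> x y x' y' z xy xy' /(PB _ _ xy) zB /(PB _ _ xy') zB'.
  exact: (Bdisj _ _ _ _ z).
have yx : edge y x by rewrite edge_sym.
have neq : enum_rank x != enum_rank y.
  by rewrite (inj_eq enum_rank_inj); apply: contraTneq xy => ->; rewrite edge_irrefl.
have [_ _ A] := Blink _ _ xy.
split=> [|||z]; last by apply: contra (A z); exact: PB.
- rewrite /P; case: ifP => _; first by have [] := p0P _ _ xy.
  have [pe _ _] := p0P _ _ yx.
  have := pe; rewrite -rev_path last_rcons belast_rcons rev_cons.
  by rewrite (eq_path (e' := @edge G)) // => a b /=; rewrite edge_sym.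
- rewrite /P; case: ifP => _; first by have [] := p0P _ _ xy.
  by rewrite rev_uniq; have [] := p0P _ _ yx.
- rewrite /P; case: ltngtP => // [_|E]; first by rewrite revK.
  by case/eqP: neq; apply: val_inj.
Qed.

(** * Density of the auxiliary graph of linked pairs *)

Section Density.
Variables (R : realType) (a : R) (a_adeg : is_adeg a) (h : nat) (h_gt0 : 0 < h).
Variables (G : sgraph).
Hypothesis G_excl : ~ topological_subgraph (complete_graph 'I_h) G.

(* Otherwise the auxiliary graph of linked pairs, which is a topological
   subgraph of [G], is too dense. *)
Lemma linked_pairs_le (L : {set G}) (Q : {set G * G}) (B : G -> G -> {set G}) :
  L != set0 ->
  (forall x y, (x, y) \in Q ->
     [/\ x \in L, y \in L, x != y, linked (B x y) x y & [disjoint B x y & L]]) ->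
  (forall x y x' y' z, (x, y) \in Q -> (x', y') \in Q ->
     z \in B x y -> z \in B x' y' -> (x', y') = (x, y)) ->
  (#|Q|%:R <= a * h%:R ^+ 2 * #|L|%:R :> R)%R.
Proof.
move=> L0 QP Qdisj.
pose T := {x : G | x \in L}.
pose e (x y : T) := ((val x, val y) \in Q) || ((val y, val x) \in Q).
have e_sym : symmetric e by move=> x y; rewrite /e orbC.
have e_irr : irreflexive e.
  by move=> x; rewrite /e orbb; apply/negP => /QP[_ _]; rewrite eqxx.
pose H := SGraph e_sym e_irr.
have cT : #|H| = #|L| by rewrite /= card_sig.
have H_excl : ~ topological_subgraph (complete_graph 'I_h) H.
  case=> S [sub [g [g_inj g_e]]]; apply: G_excl.
  (* [Q] may contain both orientations of a pair, each with its own set. One of them is selected, by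
     [enum_rank] if both are present, so that an edge of [H] is routed through a single set. *)
  pose first (x y : G) := ((x, y) \in Q) &&
    (((y, x) \notin Q) || (enum_rank x < enum_rank y)).
  pose C x y := if first x y then B x y else B y x.
  have firstE (x y : H) : edge x y -> first (val x) (val y) = ~~ first (val y) (val x).
    move=> xy; have x_y : x != y by apply: contraTneq xy => ->; rewrite edge_irrefl.
    move: xy; rewrite /first /= /e.
    case: (boolP ((val x, val y) \in Q)); case: (boolP ((val y, val x) \in Q)) => //= _ _ _.
    rewrite ltnNge leq_eqVlt negb_or -[in RHS]leqNgt.
    case: ltngtP => //=; rewrite ?andbF ?andbT //.
    by move/val_inj/enum_rank_inj/val_inj => E; rewrite E eqxx in x_y.
  have Cfirst (x y : H) : edge x y -> exists u v : H,
      [/\ (u = x /\ v = y) \/ (u = y /\ v = x), (val u, val v) \in Q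
        & C (val x) (val y) = B (val u) (val v)].
    move=> xy; rewrite /C; case: ifP => [/andP[xyQ _]|]; first by exists x, y; split; [left| |].
    rewrite firstE // => /negbFE/andP[yxQ _]; exists y, x; split => //; by right.
  apply: (topological_of_linked (f := fun x => val (g x))
     (B := fun x y => C (val (g x)) (val (g y))) sub).
  - by move=> x y /val_inj/g_inj.
  - move=> x y /g_e xy; split.
    + have [u [v [uv uvQ ->]]] := Cfirst _ _ xy.
      have [_ _ _ luv _] := QP _ _ uvQ.
      by case: uv => -[<- <-] //; apply: linked_sym.
    + rewrite /C (firstE _ _ xy); have yx : edge (g y) (g x) by rewrite edge_sym.
      by case: (first (val (g y)) _).
    + move=> z; have [u [v [_ uvQ ->]]] := Cfirst _ _ xy.
      have [_ _ _ _ /disjointFr D] := QP _ _ uvQ.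
      by apply/negP => /D; rewrite (valP (g z)).
  - move=> x y x' y' z /g_e xy /g_e xy'.
    have [u [v [uv uvQ ->]]] := Cfirst _ _ xy.
    have [u' [v' [uv' uvQ' ->]]] := Cfirst _ _ xy'.
    move=> zB zB'; have [E1 E2] := Qdisj _ _ _ _ z uvQ uvQ' zB zB'.
    move/val_inj: E1 => E1; move/val_inj: E2 => E2; subst u' v'.
    by case: uv => -[? ?]; case: uv' => -[E1 E2]; subst u v;
      rewrite ?(g_inj _ _ E1) ?(g_inj _ _ E2) -?(inj_eq g_inj) ?E1 ?E2 ?eqxx ?orbT //;
      move/g_inj: E1 => ->; move/g_inj: E2 => ->; rewrite !eqxx ?orbT.
have [_ /(_ h H h_gt0 H_excl)] := a_adeg.
have L_gt0 : (0 < #|L|%:R :> R)%R by rewrite ltr0n card_gt0.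
rewrite /average_degree cT ler_pdivrMr //; apply: le_trans; rewrite ler_nat.
(* The degree sum of [H] counts arcs, and every ordered pair of [Q] is an arc; this is why the bound
   has no factor 2. *)
pose Q' := [set xy : H * H | edge xy.1 xy.2].
have -> : \sum_(v : H) #|edge v| = #|Q'|.
  rewrite -sum1dep_card (partition_big fst predT) //=; apply: eq_bigr => v _.
  rewrite -sum1_card (reindex_onto (fun y => (v, y)) snd) /=; last first.
    by move=> [x y] /andP[_ /eqP/= <-].
  by apply: eq_bigl => y; rewrite !eqxx andbT /= unfold_in /= andbT.
pose m (xy : H * H) := (val xy.1, val xy.2).
apply: leq_trans (leq_imset_card m _); apply: subset_leq_card.
apply/subsetP => -[x y] xyQ; have [xL yL _ _ _] := QP _ _ xyQ.
apply/imsetP; exists (exist _ x xL, exist _ y yL) => //.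
by rewrite inE /= /e /= xyQ.
Qed.

End Density.

(** * Connected sets attached to classes of a partition *)

Lemma connect_invariant (T : finType) (e : rel T) (P : T -> Prop) x y :
  P x -> (forall u v, P u -> e u v -> P v) -> connect e x y -> P y.
Proof.
move=> Px Pe /connectP[p + ->]; elim: p x Px => //= z p IH x Px /andP[xz].
by apply: IH; exact: Pe xz.
Qed.

Lemma sum_card_rel (W W' : finType) (A : {set W}) (B : {set W'}) (r : W -> W' -> bool) :
  \sum_(x in A) #|[set y in B | r x y]| = \sum_(y in B) #|[set x in A | r x y]|.
Proof.
under eq_bigr do rewrite -sum1dep_card big_mkcondr /=.
rewrite exchange_big; apply: eq_bigr => y _.
by rewrite -sum1dep_card big_mkcondr.
Qed.

(** Double counting: the whole graph gives [#|A| * d = #|B| * d'], and a neighbor of [X] absorbs at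
    most [d'] of the [#|X| * d] edges at [X]. So the neighborhood has at least the share in [B] that
    [X] has in [A]. *)
Lemma biregular_expansion (W W' : finType) (A : {set W}) (B : {set W'})
    (r : W -> W' -> bool) d d' :
  (forall x, x \in A -> #|[set y in B | r x y]| = d) ->
  (forall y, y \in B -> #|[set x in A | r x y]| = d') -> 0 < d ->
  forall X : {set W}, X \subset A ->
  #|X| * #|B| <= #|[set y in B | [exists x in X, r x y]]| * #|A|.
Proof.
move=> dA dB d_gt0 X XA; set N := [set y in B | _].
have e1 : #|A| * d = #|B| * d'.
  by rewrite -!sum_nat_const -(eq_bigr _ dA) sum_card_rel -(eq_bigr _ dB).
have e2 : #|X| * d <= #|N| * d'.
  have <- : \sum_(x in X) #|[set y in N | r x y]| = #|X| * d.
    rewrite -sum_nat_const; apply: eq_bigr => x xX.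
    rewrite -(dA x) ?(subsetP XA) //; apply: eq_card => y; rewrite !inE -andbA.
    case: (y \in B) => //=; case rxy: (r x y); rewrite ?andbF // andbT.
    by apply/existsP; exists x; rewrite xX.
  rewrite sum_card_rel -sum_nat_const; apply: leq_sum => y; rewrite inE => /andP[yB _].
  rewrite -(dB y yB); apply: subset_leq_card; apply/subsetP => x.
  by rewrite !inE => /andP[/(subsetP XA)-> ->].
case: (posnP d') => [d0|d'_gt0].
  have A0 : #|A| = 0 by move: e1; rewrite d0; lia.
  have := subset_leq_card XA; rewrite A0; lia.
rewrite -(leq_pmul2r d'_gt0) -mulnA -e1 [leqLHS]mulnA mulnAC [leqRHS]mulnAC.
by rewrite leq_mul2r e2 orbT.
Qed.

Definition inside (G : sgraph) (C : {set G}) (x y : G) : bool :=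
  [&& x \in C, y \in C & edge x y].
Arguments inside G C x y /.

(** * Disjoint connected sets routed through the classes *)

Section TreeSystems.
Variables (G : sgraph) (cls : G -> {set G}) (t : nat) (O0 : {set G}).
Hypothesis cls_refl : forall x, x \in cls x.
Hypothesis cls_eq : forall x y, y \in cls x -> cls y = cls x.
Hypothesis cls_big : forall x, x \in O0 -> t <= #|cls x|.
Hypothesis cls_regular : forall x x' y, x' \in cls x ->
  #|[set z in cls y | edge x z]| = #|[set z in cls y | edge x' z]|.
Implicit Types (S A B X L O : {set G}) (valid : {set G} -> Prop).

(* The sets [C a] are disjoint connected subgraphs rooted at the tokens [a]. *)
Definition touching S A A' L := exists C : G -> {set G},
  (forall a, a \in A' -> [/\ a \in C a, C a \subset S, C a :&: A \subset [set a],
     forall x, x \in C a -> connect (inside (C a)) a x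
     & forall w, w \in L -> exists2 x, x \in C a & edge w x]) /\
  (forall a b, a \in A' -> b \in A' -> a != b -> [disjoint C a & C b]).

(* Adding one token is governed by a rank function under which every set of
   rank at most [#|A'|] occupies a small fraction of the class [A]. *)
Definition extendable valid A A' (g : nat) := exists c : {set G} -> nat,
  [/\ rank_function c, c A' = #|A'|,
    forall A'', A'' \subset A -> c A'' = #|A''| -> #|A''| = #|A'|.+1 -> valid A''
    & forall X, X \subset A -> c (X :|: A') <= #|A'| ->
      t * #|X| <= (g * #|A'| + c X) * #|A|].

(** Validity is only required to be a matroid locally, around each valid set: joining two branches
    at the root intersects two matroids, which is no matroid. The number [g] records the loss caused
    by these joins. *)
Definition token_system S A L (g : nat) := A \subset S /\ exists valid,
  [/\ valid set0, forall A', valid A' -> A' \subset A,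
    forall A', valid A' -> touching S A A' L
    & forall A', valid A' -> extendable valid A A' g].

Lemma token_system_leaf x L : x \in O0 ->
  (forall w a, w \in L -> a \in cls x -> edge w a) ->
  token_system (cls x) (cls x) L 0.
Proof.
move=> xO adj; split=> //; exists (fun A' => A' \subset cls x); split=> [|//||].
- exact: sub0set.
- move=> A' sub; exists (fun a => [set a]); split=> [a /(subsetP sub) aA|a b _ _ ab].
    split; rewrite ?inE ?sub1set ?subsetIl //; last first.
      by move=> w wL; exists a; rewrite ?inE //; exact: adj.
    by move=> y; rewrite inE => /eqP->; exact: connect0.
  by rewrite disjoints1 inE.
- move=> A' sub; exists (fun X => #|X|); split=> //; first exact: card_rank.
  move=> X _ _; rewrite mul0n add0n mulnC leq_mul2l cls_big ?orbT //.
Qed.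

Lemma expansion x y : edge x y -> forall X, X \subset cls x ->
  #|X| * #|cls y| <= #|nbrs (fun a => [set b in cls y | edge a b]) X| * #|cls x|.
Proof.
move=> xy X XA; pose d := #|[set z in cls y | edge x z]|.
pose d' := #|[set z in cls x | edge z y]|.
have dx x' : x' \in cls x -> #|[set z in cls y | edge x' z]| = d.
  by move=> x'x; rewrite /d -(cls_regular y x'x).
have dy y' : y' \in cls y -> #|[set z in cls x | edge z y']| = d'.
  move=> y'y; rewrite /d'; transitivity #|[set z in cls x | edge y' z]|.
    by apply: eq_card => z; rewrite !inE edge_sym.
  by rewrite -(cls_regular x y'y); apply: eq_card => z; rewrite !inE edge_sym.
have d_gt0 : 0 < d by apply/card_gt0P; exists y; rewrite inE cls_refl.
suff <- : [set b in cls y | [exists a in X, edge a b]] =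
     nbrs (fun a => [set b in cls y | edge a b]) X.
  exact: biregular_expansion dx dy d_gt0 _ XA.
apply/setP => z; rewrite inE; apply/andP/nbrsP.
  by move=> [zy /existsP[a /andP[aX az]]]; exists a => //; rewrite inE zy.
by case=> a aX; rewrite inE => /andP[-> az]; split=> //; apply/existsP; exists a; rewrite aX.
Qed.

(** Each token of [cls x] is matched to an adjacent token of [cls y], so the rank function is the
    induced one. By expansion a set in [cls x] has no larger share than its neighborhood in [cls y],
    and what is left unmatched is paid for by [t <= #|cls x|]; hence [g] does not grow. *)
Lemma token_system_chain S x y L g : x \in O0 -> edge x y ->
  [disjoint cls x & S] -> token_system S (cls y) L g ->
  token_system (cls x :|: S) (cls x) L g.
Proof.
move=> xO xy dis [BS [valid [v0 vS vT vE]]]; split; first exact: subsetUl.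
set A := cls x; set B := cls y in BS vS vT vE.
pose N a := [set b in B | edge a b].
exists (fun A' => A' \subset A /\ exists f : G -> G, [/\ {in A' &, injective f},
  {in A', forall a, f a \in N a} & valid (f @: A')]); split.
- by split; [exact: sub0set|exists id; split=> [??|?|]; rewrite ?inE ?imset0].
- by move=> A' [].
- move=> A' [A'A [f [fI fN vf]]]; have [C [CP Cdis]] := vT _ vf.
  have fA a : a \in A' -> f a \in f @: A' by exact: imset_f.
  exists (fun a => a |: C (f a)); split=> [a aA'|a b aA' bA' ab].
    have [fC CS _ Ccon Cadj] := CP _ (fA _ aA').
    have aA := subsetP A'A _ aA'.
    split; rewrite ?inE ?eqxx //.
    + by rewrite subUset sub1set inE aA (subset_trans CS (subsetUr _ _)).
    + apply/subsetP => z; rewrite !inE => /andP[/orP[//|zC] zA].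
      by have := disjointFr dis zA; rewrite (subsetP CS _ zC).
    + have fa : connect (inside (a |: C (f a))) a (f a).
        apply: connect1; rewrite /= !inE eqxx fC orbT /=.
        by have := fN _ aA'; rewrite inE => /andP[].
      move=> z; rewrite !inE => /orP[/eqP->|/Ccon fz]; first exact: connect0.
      apply: connect_trans fa (connect_sub _ fz) => u v /and3P[uC vC uv].
      by apply: connect1; rewrite /= !inE uC vC uv !orbT.
    + by move=> w /Cadj[z zC wz]; exists z; rewrite // !inE zC orbT.
  have [_ CS _ _ _] := CP _ (fA _ aA'); have [_ CS' _ _ _] := CP _ (fA _ bA').
  have aA := subsetP A'A _ aA'; have bA := subsetP A'A _ bA'.
  have fab : f a != f b by apply: contraNneq ab => /fI ->.
  have dC := Cdis _ _ (fA _ aA') (fA _ bA') fab.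
  rewrite -setI_eq0; apply/eqP/setP => z; rewrite !inE.
  apply/negP => /andP[/orP[/eqP->|zC] /orP[/eqP|zC']].
  + by move/eqP; rewrite (negPf ab).
  + by have := disjointFr dis aA; rewrite (subsetP CS' _ zC').
  + by move=> zb; have := disjointFr dis bA; rewrite -zb (subsetP CS _ zC).
  + by have := disjointFr dC zC; rewrite zC'.
- move=> A' [A'A [f [fI fN vf]]]; have [c [rc cf cE cX]] := vE _ vf.
  have cardf := card_in_imset fI; rewrite cardf in cf cE cX.
  exists (induced c N); split.
  + exact: induced_rank.
  + exact: (transversal_induced rc fI fN cf).
  + move=> A'' A''A iA'' cA''; have [f' [fI' fN' cf']] := induced_transversal rc iA''.
    split=> //; exists f'; split=> //; apply: cE; rewrite ?card_in_imset //.
    by apply/subsetP => _ /imsetP[a /fN' + ->]; rewrite inE => /andP[].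
  + move=> X XA le_k; have [Y YX cY] := induced_ex c N X.
    have YA := subset_trans YX XA.
    have NB : nbrs N Y \subset B.
      by apply/subsetP => z /nbrsP[a _]; rewrite inE => /andP[].
    have [Z ZXA cZ] := induced_ex c N (X :|: A').
    pose Z' := Y :|: Z.
    (* Uncrossing: [Y] is optimal for [X] and [Z] for [X :|: A'], so by submodularity their union
       also witnesses rank at most [#|A'|]. *)
    have cZ' : c (nbrs N Z') + #|(X :|: A') :\: Z'| <= #|A'|.
      have := induced_le c N (subset_trans (subsetIl Y Z) YX); rewrite cY.
      have := rankUI rc (nbrs N Y) (nbrs N Z); rewrite -nbrsU -/Z'.
      have : c (nbrs N (Y :&: Z)) <= c (nbrs N Y :&: nbrs N Z).
        by apply: (rankS rc); rewrite subsetI !nbrsS ?subsetIl ?subsetIr.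
      have D (P Q : {set G}) : Q \subset P -> #|P :\: Q| + #|Q| = #|P|.
        by move=> QP; rewrite -[in RHS](cardsID Q P) (setIidPr QP) addnC.
      have Z'XA : Z' \subset X :|: A'.
        by rewrite subUset ZXA (subset_trans YX (subsetUl _ _)).
      have := D _ _ YX; have := D _ _ ZXA; have := D _ _ Z'XA.
      have := D _ _ (subset_trans (subsetIl Y Z) YX).
      have := cardsUI Y Z; rewrite -/Z'; rewrite cZ in le_k; move: le_k.
      by clear; lia.
    have le2 : c (nbrs N Y :|: f @: A') <= #|A'|.
      apply: leq_trans cZ'.
      have sub : nbrs N Y :|: f @: A' \subset nbrs N Z' :|: (f @: (A' :\: Z')).
        rewrite subUset (subset_trans (nbrsS N (subsetUl Y Z)) (subsetUl _ _)).
        apply/subsetP => _ /imsetP[a aA' ->]; rewrite inE.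
        have [aZ|aZ] := boolP (a \in Z').
          by apply/orP; left; apply/nbrsP; exists a => //; exact: fN.
        by apply/orP; right; apply: imset_f; rewrite inE aZ.
      apply: leq_trans (rankS rc sub) _; apply: leq_trans (rank_leU rc _ _) _.
      rewrite leq_add2l; apply: leq_trans (leq_imset_card _ _) _.
      by apply: subset_leq_card; apply: setSD; exact: subsetUr.
    have tB := cX _ NB le2.
    have B_gt0 : 0 < #|B| by apply/card_gt0P; exists y; exact: cls_refl.
    have tY : t * #|Y| <= (g * #|A'| + c (nbrs N Y)) * #|A|.
      rewrite -(leq_pmul2r B_gt0) -mulnA.
      apply: leq_trans (leq_mul (leqnn t) (expansion xy YA)) _.
      by rewrite mulnA [leqRHS]mulnAC leq_mul2r tB orbT.
    have tXY : t * #|X :\: Y| <= #|X :\: Y| * #|A|.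
      by rewrite mulnC leq_mul2l cls_big ?orbT.
    rewrite cY addnA [leqRHS]mulnDl.
    have -> : #|X| = #|Y| + #|X :\: Y|.
      by rewrite -[in LHS](cardsID Y X) (setIidPr YX).
    by rewrite mulnDr leq_add.
Qed.

(** Around a fixed [A'] it suffices to forbid every element spanned by [A'] in either matroid. Each
    forbidden set has rank at most [k], hence mass at most [g1 * k + k], respectively [g2 * k + k];
    the two extra terms [k] are the increase of the loss by 2. *)
Lemma token_system_merge S1 S2 A L1 L2 g1 g2 :
  S1 :&: S2 \subset A -> token_system S1 A L1 g1 -> token_system S2 A L2 g2 ->
  token_system (S1 :|: S2) A (L1 :|: L2) (g1 + g2).+2.
Proof.
move=> dis [AS1 [v1 [v10 v1S v1T v1E]]] [AS2 [v2 [v20 v2S v2T v2E]]].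
split; first by rewrite (subset_trans AS1) // subsetUl.
exists (fun A' => v1 A' /\ v2 A'); split=> [//|A' [/v1S //]||].
- move=> A' [V1 V2]; have [C1 [CP1 D1]] := v1T _ V1; have [C2 [CP2 D2]] := v2T _ V2.
  exists (fun a => C1 a :|: C2 a); split=> [a aA'|a b aA' bA' ab].
    have [a1 S1a A1 con1 adj1] := CP1 _ aA'; have [a2 S2a A2 con2 adj2] := CP2 _ aA'.
    split.
    + by rewrite inE a1.
    + exact: setUSS.
    + by rewrite setIUl subUset A1 A2.
    + move=> x; rewrite inE => /orP[/con1|/con2]; apply: connect_sub => u v /and3P[uC vC uv];
        by apply: connect1; rewrite /= !inE uC vC uv ?orbT.
    + by move=> w; rewrite inE => /orP[/adj1|/adj2] [x xC wx]; exists x => //;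
        rewrite inE xC ?orbT.
  have [a1 S1a A1 _ _] := CP1 _ aA'; have [a2 S2a A2 _ _] := CP2 _ aA'.
  have [b1 S1b B1 _ _] := CP1 _ bA'; have [b2 S2b B2 _ _] := CP2 _ bA'.
  have cross (C C' : {set G}) : C \subset S1 -> C' \subset S2 -> forall p q,
      C :&: A \subset [set p] -> C' :&: A \subset [set q] -> p != q ->
      forall z, z \in C -> z \in C' -> False.
    move=> CS1 CS2 p q Cp Cq pq z zC zC'.
    have zA : z \in A by apply: (subsetP dis); rewrite inE (subsetP CS1) // (subsetP CS2).
    have := subsetP Cp z; rewrite !inE zC zA => /(_ isT)/eqP zp.
    have := subsetP Cq z; rewrite !inE zC' zA => /(_ isT)/eqP zq.
    by rewrite -zp -zq eqxx in pq.
  rewrite -setI_eq0; apply/eqP/setP => z; rewrite !inE.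
  apply/negP => /andP[/orP[] zC /orP[] zC'].
  + by have := disjointFr (D1 _ _ aA' bA' ab) zC; rewrite zC'.
  + exact: (cross _ _ S1a S2b a b A1 B2 ab z).
  + by apply: (cross _ _ S1b S2a b a B1 A2 _ z) => //; rewrite eq_sym.
  + by have := disjointFr (D2 _ _ aA' bA' ab) zC; rewrite zC'.
- move=> A' [V1 V2]; have [c1 [rc1 c1A ext1 mass1]] := v1E _ V1.
  have [c2 [rc2 c2A ext2 mass2]] := v2E _ V2; set k := #|A'| in c1A c2A ext1 ext2 mass1 mass2 *.
  pose bad c := [set a in A | c (a |: A') <= k] : {set G}.
  pose good := A :\: (bad c1 :|: bad c2).
  have massbad c g : rank_function c -> c A' = k ->
      (forall X, X \subset A -> c (X :|: A') <= k -> t * #|X| <= (g * k + c X) * #|A|) ->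
      t * #|bad c| <= (g * k + k) * #|A|.
    move=> rc cA mass; have badA : bad c \subset A by apply/subsetP => z; rewrite inE => /andP[].
    have cbad : c (A' :|: bad c) = k.
      by apply: rank_span => // z; rewrite inE => /andP[].
    apply: leq_trans (mass _ badA _) _; first by rewrite setUC cbad.
    rewrite leq_mul2r leq_add2l -[leqRHS]cbad (rankS rc) ?orbT //; exact: subsetUr.
  have A'A := v1S _ V1.
  have ngood a : a \in A' -> a \notin good.
    move=> aA'; rewrite !inE negb_and negbK (subsetP A'A) //=.
    by rewrite (setUidPr _) ?sub1set // c1A leqnn.
  (* In this matroid the elements of [A'] are free, those of [good] are parallel to each other, and
     all others are loops. *)
  exists (fun Y => #|Y :&: A'| + ~~ [disjoint Y & good]); split.
  + split.
    * by rewrite set0I cards0 -setI_eq0 set0I eqxx.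
    * move=> x X; rewrite setIUl.
      have [xA'|xA'] := boolP (x \in A').
        have -> : [disjoint x |: X & good] = [disjoint X & good].
          by rewrite -!setI_eq0 setIUl (_ : [set x] :&: good = set0) ?set0U //;
            apply/eqP; rewrite setI_eq0 disjoints1 ngood.
        have := leq_card_setU ([set x] :&: A') (X :&: A').
        have : #|[set x] :&: A'| <= 1.
          by rewrite -(cards1 x); apply: subset_leq_card; exact: subsetIl.
        by move=> le1 [le2 _]; move: le1 le2; clear; lia.
      have -> : [set x] :&: A' = set0 by apply/eqP; rewrite setI_eq0 disjoints1.
      by rewrite set0U -addnS leq_add2l; case: (~~ _).
    * move=> X Y XY; apply: leq_add; first by apply: subset_leq_card; exact: setSI.
      have := @disjointWl _ (mem X) (mem Y) (mem good) XY.
      by case: ([disjoint Y & good]) => [->//|_]; case: (~~ _).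
    * move=> X Y; have := cardsUI (X :&: A') (Y :&: A').
      rewrite -setIUl; have -> : X :&: A' :&: (Y :&: A') = X :&: Y :&: A'.
        by apply/setP => z; rewrite !inE; case: (z \in X); case: (z \in Y); case: (z \in A').
      have dU : [disjoint X :|: Y & good] = [disjoint X & good] && [disjoint Y & good].
        by rewrite -!setI_eq0 setIUl setU_eq0.
      have dI1 := @disjointWl _ (mem (X :&: Y)) (mem X) (mem good) (subsetIl X Y).
      have dI2 := @disjointWl _ (mem (X :&: Y)) (mem Y) (mem good) (subsetIr X Y).
      have : ~~ [disjoint X :|: Y & good] + ~~ [disjoint X :&: Y & good] <=
          ~~ [disjoint X & good] + ~~ [disjoint Y & good].
        rewrite dU; move: dI1 dI2; case: [disjoint X :&: Y & good].
          by case: [disjoint X & good]; case: [disjoint Y & good].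
        case: [disjoint X & good] => [/(_ isT)//|_].
        by case: [disjoint Y & good] => [/(_ isT)//|_].
      by clear; lia.
  + have -> : [disjoint A' & good] = true.
      by rewrite disjoint_subset; apply/subsetP => z /ngood.
    by rewrite setIid addn0.
  + move=> A'' A''A; have [dg|] := boolP [disjoint A'' & good].
      move=> /= + E; rewrite E addn0 => E2.
      have := subset_leq_card (subsetIr A'' A'); rewrite E2 -/k; lia.
    case/pred0Pn => a /= /andP[aA'' ag] /= + E; rewrite E addn1 => -[E2].
    have A'A'' : A' \subset A''.
      by apply/setIidPr/eqP; rewrite eqEcard subsetIr E2 leqnn.
    have aA' : a \notin A' by apply: contraL ag; exact: ngood.
    have EA : A'' = a |: A'.
      apply/eqP; rewrite eq_sym eqEcard subUset sub1set aA'' A'A'' cardsU1 aA' E.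
      by rewrite add1n leqnn.
    have sub : a |: A' \subset A by rewrite -EA.
    have ca : #|a |: A'| = k.+1 by rewrite cardsU1 aA'.
    move: ag; rewrite !inE !negb_or !negb_and -!ltnNge => /andP[/andP[b1 b2] aA].
    rewrite aA /= in b1 b2; rewrite EA; split; [apply: ext1 | apply: ext2] => //;
      apply/eqP; rewrite eqn_leq rank_le_card ?ca //.
  + move=> X XA; rewrite setIUl setIid.
    have -> : X :&: A' :|: A' = A' by apply/setUidPr; exact: subsetIr.
    rewrite -/k -[leqRHS]addn0 leq_add2l leqn0 eqb0 negbK => dis'.
    have Xbad : X \subset bad c1 :|: bad c2.
      apply/subsetP => z zX; have zA := subsetP XA z zX; apply: contraTT zX => zb.
      have zg : z \in good by rewrite inE zb zA.
      by have := disjointFl dis' zg; rewrite inE => /negbT/norP[].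
    apply: leq_trans (leq_mul (leqnn t) (subset_leq_card Xbad)) _.
    apply: leq_trans (leq_mul (leqnn t) (leq_card_setU _ _)) _.
    rewrite mulnDr; have := massbad _ _ rc1 c1A mass1; have := massbad _ _ rc2 c2A mass2.
    move: #|X :&: A'| (nat_of_bool _) => p q; move: (#|bad c1|) (#|bad c2|) (#|A|) => b1 b2 cA.
    have -> : ((g1 + g2).+2 * k + (p + q)) * cA =
      (g1 * k + k) * cA + (g2 * k + k) * cA + (p + q) * cA by ring.
    by lia.
Qed.

(** Moves inside a class are free: connectivity is only needed in the quotient by the classes. *)
Let joined (O : {set G}) :=
  [rel x y : G | [&& x \in O, y \in O & edge x y || (cls x == cls y)]].

(** If some [w0] of [L] misses the root class, it sees a component [K] of the rest of [O]. The
    vertices of [L] that see [K] are served inside [K], prolonged to the root by the edge [ab]; the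
    others are served in [O :\: K], and the two systems meet in the root class only. A single leaf
    system has loss 0, and each merge splits [L] into two nonempty parts, so the bound
    [g.+2 <= #|L|.*2] is additive. *)
Lemma exists_token_system O r L : O \subset O0 ->
  (forall x, x \in O -> cls x \subset O) -> r \in O -> L != set0 ->
  (forall w x y, w \in L -> edge w x -> y \in cls x -> edge w y) ->
  (forall w, w \in L -> exists z, [/\ z \in O, edge w z & connect (joined O) r z]) ->
  exists S g, [/\ S \subset O, token_system S (cls r) L g & g.+2 <= #|L|.*2].
Proof.
have [n] := ubnP #|O|; elim: n O r L => // n IH O r L le_n OO clsO rO L0 full reach.
set A := cls r; have AO : A \subset O by exact: clsO.
have [/forallP allA|] := boolP [forall w in L, [exists z in A, edge w z]].
  exists A, 0; split=> //; last by move: L0; rewrite -card_gt0; case: #|L|.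
  apply: token_system_leaf; first exact: (subsetP OO).
  move=> w a wL aA; have := allA w; rewrite wL => /existsP[z /andP[zA wz]].
  by apply: (full _ z) => //; rewrite (cls_eq zA).
rewrite negb_forall => /existsP[w0]; rewrite negb_imply => /andP[w0L w0A].
have [z0 [z0O wz0 rz0]] := reach _ w0L.
have z0A : z0 \notin A by apply: contra w0A => z0A; apply/existsP; exists z0; rewrite z0A.
have clsA x y : cls x = cls y -> (x \in A) = (y \in A).
  move=> E; apply/idP/idP => /cls_eq EA; rewrite /A -EA ?E //.
  by rewrite -E.
pose leaves z := z \in A \/ exists a b,
    [/\ a \in A, b \in O, b \notin A, edge a b & connect (joined (O :\: A)) b z].
have [|[a [b [aA bO bA ab bz0]]]] : leaves z0.
- apply: (connect_invariant (P := leaves) _ _ rz0); first by left; exact: cls_refl.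
  move=> u v uP /and3P[uO vO uv]; have [vA|vA] := boolP (v \in A); first by left.
  right; have [uA|uA] := boolP (u \in A).
    exists u, v; split=> //; case/orP: uv => // /eqP/clsA.
    by rewrite uA (negPf vA).
  case: uP => [|[a [b [? ? ? ? bu]]]]; first by rewrite (negPf uA).
  exists a, b; split=> //; apply: connect_trans bu (connect1 _).
  by rewrite /= !inE uA uO vA vO.
- by rewrite (negPf z0A).
pose K := [set y in O :\: A | connect (joined (O :\: A)) b y].
have KO : K \subset O by apply/subsetP => z; rewrite !inE => /andP[/andP[]].
have bK : b \in K by rewrite !inE bO bA connect0.
have KA x : x \in K -> x \notin A by rewrite !inE => /andP[/andP[]].
have Kstep x y : x \in K -> y \in O -> y \notin A -> edge x y || (cls x == cls y) -> y \in K.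
  rewrite !inE => /andP[/andP[xA xO] bx] yO yA xy; rewrite yA yO /=.
  by apply: connect_trans bx (connect1 _); rewrite /= !inE xA xO yA yO.
have clsK x : x \in K -> cls x \subset K.
  move=> xK; apply/subsetP => y yx; apply: (Kstep x) => //.
  - by apply: (subsetP (clsO x _)) => //; exact: (subsetP KO).
  - by rewrite (clsA _ _ (cls_eq yx)) KA.
  - by rewrite (cls_eq yx) eqxx orbT.
have rK : r \notin K by apply/negP => /KA; rewrite cls_refl.
pose L1 := [set w in L | [exists z in K, edge w z]].
have L1L : L1 \subset L by apply/subsetP => w; rewrite inE => /andP[].
have w0L1 : w0 \in L1.
  by rewrite inE w0L; apply/existsP; exists z0; rewrite !inE z0A z0O bz0.
have [|||||||S1 [g1 [S1K sys1 g1L]]] := IH K b L1.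
- apply: leq_trans _ (le_n : #|O| <= n); apply: proper_card; apply/properP; split=> //.
  by exists r.
- exact: subset_trans OO.
- exact: clsK.
- exact: bK.
- by apply/set0Pn; exists w0.
- by move=> w x y wL1; apply: full; exact: (subsetP L1L).
- move=> w; rewrite inE => /andP[_ /existsP[z /andP[zK wz]]]; exists z; split=> //.
  move: (zK); rewrite inE => /andP[_ bz].
  have [] : z \in K /\ connect (joined K) b z => //.
  pose P y := y \in K /\ connect (joined K) b y.
  apply: (connect_invariant (P := P) _ _ bz) => [|u v [uK bu] /and3P[_ vOA uv]].
    by split=> //; exact: connect0.
  have vK : v \in K by move: vOA; rewrite inE => /andP[? ?]; exact: Kstep uv.
  by split=> //; apply: connect_trans bu (connect1 _); rewrite /= uK vK.
have disAS : [disjoint A & S1].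
  rewrite disjoint_sym disjoint_subset; apply/subsetP => z zS; rewrite inE.
  exact: KA (subsetP S1K z zS).
have Eab : cls a = A by exact: cls_eq.
have aO : a \in O0 by apply: (subsetP OO); exact: (subsetP AO).
have sys1A : token_system (A :|: S1) A L1 g1.
  by rewrite -Eab; apply: token_system_chain ab _ sys1; rewrite // Eab.
have AS1O : A :|: S1 \subset O by rewrite subUset AO (subset_trans S1K).
have [E2|L2n0] := eqVneq (L :\: L1) set0.
  have EL : L1 = L by apply/eqP; rewrite eqEsubset L1L -finset.setD_eq0 E2 eqxx.
  by exists (A :|: S1), g1; rewrite -EL.
have [|||||||S2 [g2 [S2O sys2 g2L]]] := IH (O :\: K) r (L :\: L1).
- apply: leq_trans _ (le_n : #|O| <= n); apply: proper_card; apply/properP.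
  by split; [exact: subsetDl|exists b; rewrite ?(subsetP KO) // inE bK].
- by apply: subset_trans OO; exact: subsetDl.
- move=> x; rewrite inE => /andP[xK xO]; apply/subsetP => y yx; rewrite inE.
  rewrite (subsetP (clsO x xO)) // andbT; apply: contra xK => yK.
  by apply: (subsetP (clsK y yK)); rewrite (cls_eq yx) cls_refl.
- by rewrite inE rK rO.
- exact: L2n0.
- by move=> w x y; rewrite inE => /andP[_ wL]; exact: full.
- move=> w; rewrite inE => /andP[wL1 wL]; have [z [zO wz rz]] := reach _ wL.
  have zK : z \notin K.
    by apply: contra wL1 => zK; rewrite inE wL; apply/existsP; exists z; rewrite zK.
  exists z; split=> //; first by rewrite inE zK zO.
  pose P y := y \in K \/ connect (joined (O :\: K)) r y.
  have [] : P z; rewrite ?(negPf zK) //.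
  apply: (connect_invariant (P := P) _ _ rz) => [|u v uP /and3P[uO vO uv]]; first by right; exact: connect0.
  have [vK|vK] := boolP (v \in K); [by left|right].
  case: uP => [uK|ru].
    have vA : v \in A by apply: contraR vK => vA; exact: Kstep uv.
    by apply: connect1; rewrite /= !in_setD rK rO vK vO (cls_eq vA) eqxx orbT.
  have [uK|uK] := boolP (u \in K).
    have vA : v \in A by apply: contraR vK => vA; exact: Kstep uv.
    by apply: connect1; rewrite /= !in_setD rK rO vK vO (cls_eq vA) eqxx orbT.
  by apply: connect_trans ru (connect1 _); rewrite /= !in_setD uK uO vK vO.
exists ((A :|: S1) :|: S2), (g1 + g2).+2; split.
- by rewrite subUset AS1O (subset_trans S2O) ?subsetDl.
- have -> : L = L1 :|: (L :\: L1) by rewrite setDE setUIr setUCr setIT (setUidPr L1L).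
  apply: token_system_merge => //; rewrite setIUl subUset subsetIl /=.
  apply/subsetP => z; rewrite inE => /andP[/(subsetP S1K) zK /(subsetP S2O)].
  by rewrite inE zK.
- have := cardsID L1 L; rewrite (setIidPr L1L) => <-.
  by move: g1L g2L; clear; lia.
Qed.

(** Greedy choice: with [k] tokens placed, the elements of the root class that cannot be added have
    rank at most [k], hence share at most [(g + 1) * k / t], which is less than 1 while [k < m]. *)
Lemma token_system_tokens S r L g m : token_system S (cls r) L g ->
  g.+1 * m <= t -> 0 < t ->
  exists2 A' : {set G}, #|A'| = m & touching S (cls r) A' L.
Proof.
move=> [AS [valid [v0 vS vT vE]]] le_t t_gt0.
suff [A' vA' cA'] : exists2 A' : {set G}, valid A' & #|A'| = m.
  by exists A' => //; exact: vT.
elim: m le_t => [|k IH] le_t; first by exists set0; rewrite ?cards0.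
have [|A' vA' cA'] := IH; first by apply: leq_trans le_t; rewrite leq_mul2l leqnSn orbT.
have [c [rc cA ext mass]] := vE _ vA'; rewrite cA' in cA ext mass.
pose bad := [set a in cls r | c (a |: A') <= k].
have badA : bad \subset cls r by apply/subsetP => z; rewrite inE => /andP[].
have cbad : c (A' :|: bad) = k.
  by apply: rank_span => // z; rewrite inE => /andP[].
have := mass bad badA; rewrite setUC cbad leqnn => /(_ isT) massb.
have [/subset_leq_card le|] := boolP (cls r \subset bad).
  have cb : c bad <= k by rewrite -[leqRHS]cbad (rankS rc) // subsetUr.
  have r_gt0 : 0 < #|cls r| by apply/card_gt0P; exists r.
  have : t * #|cls r| <= (g * k + k) * #|cls r|.
    apply: leq_trans (leq_mul (leqnn t) le) (leq_trans massb _).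
    by rewrite leq_mul2r leq_add2l cb orbT.
  rewrite leq_pmul2r // => le2; move: le_t le2 t_gt0; clear; nia.
case/subsetPn => a aA; rewrite inE aA /= -ltnNge => ca.
have aA' : a \notin A'.
  by apply: contraL ca => aA'; rewrite (setUidPr _) ?sub1set // cA ltnn.
have card_a : #|a |: A'| = k.+1 by rewrite cardsU1 aA' cA'.
exists (a |: A') => //; apply: ext => //.
  by rewrite subUset sub1set aA vS.
by apply/eqP; rewrite card_a eqn_leq ca andbT -card_a rank_le_card.
Qed.

Lemma disjoint_touching_sets O r L m : O \subset O0 ->
  (forall x, x \in O -> cls x \subset O) -> r \in O -> L != set0 ->
  (forall w x y, w \in L -> edge w x -> y \in cls x -> edge w y) ->
  (forall w, w \in L -> exists z, [/\ z \in O, edge w z & connect (inside O) r z]) ->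
  #|L|.*2 * m <= t ->
  exists2 A' : {set G}, #|A'| = m & exists C : G -> {set G},
  (forall a, a \in A' -> [/\ a \in C a, C a \subset O,
     forall x, x \in C a -> connect (inside (C a)) a x
     & forall w, w \in L -> exists2 x, x \in C a & edge w x]) /\
  (forall a b, a \in A' -> b \in A' -> a != b -> [disjoint C a & C b]).
Proof.
move=> OO clsO rO L0 full reach le_t.
have [|S [g [SO sys gL]]] := exists_token_system OO clsO rO L0 full.
  move=> w /reach[z [zO wz rz]]; exists z; split=> //.
  apply: connect_sub rz => u v /and3P[uO vO uv]; apply: connect1.
  by rewrite /= uO vO uv.
case: m le_t => [|m] le_t.
  by exists set0; rewrite ?cards0 //; exists (fun=> set0); split=> ?; rewrite inE.
have [||A' cA' [C [CP Cdis]]] := token_system_tokens (m := m.+1) sys.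
- apply: leq_trans le_t; rewrite leq_mul2r; apply/orP; right.
  by move: gL; clear; lia.
- by apply: leq_trans le_t; move: L0; rewrite -card_gt0; clear; lia.
exists A' => //; exists C; split=> // a /CP[aC CS _ con adj]; split=> //.
exact: subset_trans SO.
Qed.

End TreeSystems.

Lemma inside_sym (G : sgraph) (C : {set G}) : symmetric (inside C).
Proof. by move=> x y; rewrite /= andbCA edge_sym. Qed.

Lemma linked_inside (G : sgraph) (C : {set G}) u v x y :
  connect (inside C) x y -> x \in C -> edge u x -> edge v y -> linked C u v.
Proof.
case/connectP => p; elim: p u x => [|z p IH] u x /=.
  move=> _ -> xC ux vx; exists [:: x] => /=; first by rewrite ux edge_sym vx.
  by move=> w; rewrite inE => /eqP->.
move=> /andP[/and3P[_ zC xz] pz] E xC ux vy.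
have [q qe qC] := IH x z pz E zC xz vy.
exists (x :: q) => /=; first by rewrite ux.
by move=> w; rewrite inE => /orP[/eqP->|/qC].
Qed.

(** [L] provides the branch vertices, and each pair of them is joined through a connected set of its
    own. Indexing these sets by ordered pairs takes [h * h] of them, which with [#|L| = h] asks for
    [2 * h ^ 3 <= t]. *)
Lemma topological_complete_of_classes (G : sgraph) (cls : G -> {set G})
    (t h : nat) (O : {set G}) r (L : {set G}) :
  (forall x, x \in cls x) -> (forall x y, y \in cls x -> cls y = cls x) ->
  (forall x, x \in O -> t <= #|cls x|) ->
  (forall x x' y, x' \in cls x ->
    #|[set z in cls y | edge x z]| = #|[set z in cls y | edge x' z]|) ->
  (forall x, x \in O -> cls x \subset O) -> r \in O ->
  #|L| = h -> 0 < h -> [disjoint L & O] ->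
  (forall w x y, w \in L -> edge w x -> y \in cls x -> edge w y) ->
  (forall w, w \in L -> exists z, [/\ z \in O, edge w z & connect (inside O) r z]) ->
  h.*2 * (h * h) <= t ->
  topological_subgraph (complete_graph 'I_h) G.
Proof.
move=> refl eqc big reg clsO rO cL h_gt0 dis full reach le_t.
have [||A' cA' [C [CP Cdis]]] :=
  disjoint_touching_sets (m := h * h) refl eqc big reg (subxx O) clsO rO _ full reach.
- by rewrite -card_gt0 cL.
- by rewrite cL.
have cI : #|{: 'I_h * 'I_h}| = #|A'| by rewrite card_prod card_ord cA'.
pose f (i : 'I_h) : G := enum_val (cast_ord (esym cL) i).
pose tok (p : 'I_h * 'I_h) : G := enum_val (cast_ord cI (enum_rank p)).
have f_inj : injective f by move=> i j /enum_val_inj/cast_ord_inj.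
have tok_inj : injective tok by move=> i j /enum_val_inj/cast_ord_inj/enum_rank_inj.
have fL i : f i \in L by exact: enum_valP.
have tokA p : tok p \in A' by exact: enum_valP.
pose pr (i j : 'I_h) := if i < j then (i, j) else (j, i).
apply: (@topological_of_linked (complete_graph 'I_h) (complete_graph 'I_h) G f
  (fun i j : 'I_h => C (tok (pr i j))) (subdivision_refl _) f_inj) => [i j ij|i j i' j' z ij ij' zC zC'].
  have [aC CO con adj] := CP _ (tokA (pr i j)); split.
  - have [x xC ix] := adj _ (fL i); have [y yC jy] := adj _ (fL j).
    apply: (linked_inside (x := x) (y := y)) => //.
    apply: connect_trans (con _ yC).
    by rewrite (sym_connect_sym (@inside_sym _ _)); exact: con.
  - by rewrite /pr; case: ltngtP => // /val_inj ->.
  - move=> k; apply/negP => /(subsetP CO); have := disjointFr dis (fL k) => -> //.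
have E : pr i j = pr i' j'.
  apply/eqP; apply: contraTT zC' => ne; have := Cdis _ _ (tokA (pr i j)) (tokA (pr i' j')).
  by rewrite (inj_eq tok_inj) => /(_ ne) /disjointFr ->.
move: E; rewrite /pr; case: ifP => _; case: ifP => _ [-> ->]; by rewrite !eqxx ?orbT.
Qed.

(** * Colors of triples *)

Lemma perm_map_transfer (T T' : eqType) (K K2 : eqType) (F : T -> K) (F' : T' -> K)
    (H : T -> K2) (H' : T' -> K2) s s' :
  perm_eq (map F s) (map F' s') ->
  (forall x x', x \in s -> x' \in s' -> F x = F' x' -> H x = H' x') ->
  perm_eq (map H s) (map H' s').
Proof.
elim: s s' => [|x s IH] s' /= pe HH.
  by move: (perm_size pe); rewrite /= size_map; case: s' pe HH.
have : F x \in map F' s' by rewrite -(perm_mem pe) mem_head.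
case/mapP => x' x's' Fx; have ps' := perm_to_rem x's'.
have ps : perm_eq (map H' s') (H' x' :: map H' (rem x' s')) by exact: (perm_map H' ps').
rewrite (perm_trans _ (eqbRL (perm_sym _ _) ps)) //.
rewrite (HH x x') ?mem_head // perm_cons; apply: IH.
  have := perm_trans pe (perm_map F' ps'); by rewrite /= Fx perm_cons.
by move=> y y' ys y's; apply: HH; rewrite ?inE ?ys ?orbT // (mem_rem y's).
Qed.

Section WLColors.
Variable G : sgraph.
Implicit Types a b c d v w : G.

Definition wcol a b c := wl3 G [tuple a; b; c].

(** The pair coloring of the theorem, so that [cl] below is the closure that the theorem speaks
    of. *)
Definition pcol a b := wcol a b b.

Lemma subst_entry0 a b c w : subst_entry [tuple a; b; c] w (inord 0) = [tuple w; b; c].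
Proof.
apply: eq_from_tnth => i; rewrite tnth_mktuple -val_eqE /= inordK //.
by case: i => [[|[|[|]]] i3].
Qed.

Lemma subst_entry1 a b c w : subst_entry [tuple a; b; c] w (inord 1) = [tuple a; w; c].
Proof.
apply: eq_from_tnth => i; rewrite tnth_mktuple -val_eqE /= inordK //.
by case: i => [[|[|[|]]] i3].
Qed.

Lemma subst_entry2 a b c w : subst_entry [tuple a; b; c] w (inord 2) = [tuple a; b; w].
Proof.
apply: eq_from_tnth => i; rewrite tnth_mktuple -val_eqE /= inordK //.
by case: i => [[|[|[|]]] i3].
Qed.

Let r i a b c := wl3_round G i [tuple a; b; c].

Lemma wl3_round_stepP i a b c a' b' c' : r i.+1 a b c = r i.+1 a' b' c' <->
  r i a b c = r i a' b' c' /\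
  perm_eq [seq (r i w b c, r i a w c, r i a b w) | w <- enum G]
          [seq (r i w b' c', r i a' w c', r i a' b' w) | w <- enum G].
Proof.
have E x y z : r i.+1 x y z = (r i x y z,
    seq_mset [seq (r i w y z, r i x w z, r i x y w) | w <- enum G]).
  congr (_, seq_mset _); apply: eq_map => w.
  by rewrite subst_entry0 subst_entry1 subst_entry2.
rewrite !E; split=> [[-> e]|[-> e]].
  by split=> //; apply/eq_seq_msetP.
by congr (_, _); apply/eq_seq_msetP.
Qed.

Definition same_atoms a b c a' b' c' := [/\ (a == b) = (a' == b'),
  (a == c) = (a' == c'), (b == c) = (b' == c') &
  [/\ edge a b = edge a' b', edge a c = edge a' c' & edge b c = edge b' c']].

Lemma wl3_initP a b c a' b' c' :
  r 0 a b c = r 0 a' b' c' <-> same_atoms a b c a' b' c'.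
Proof.
split=> [/ffunP E|[e1 e2 e3 [e4 e5 e6]]].
  have := E (inord 0, inord 1); have := E (inord 0, inord 2); have := E (inord 1, inord 2).
  rewrite !ffunE /= !(tnth_nth a) /= !inordK //=.
  by case=> ? ? [? ?] [? ?].
apply/ffunP => -[i j]; rewrite !ffunE /= !(tnth_nth a) /=.
have s x y : (x == y :> G) = (y == x) by exact: eq_sym.
case: i => [[|[|[|]]] //= _]; case: j => [[|[|[|]]] //= _];
  by rewrite ?eqxx ?edge_irrefl ?e1 ?e2 ?e3 ?e4 ?e5 ?e6 // 1?s 1?[in RHS]s
    1?edge_sym 1?[in RHS]edge_sym ?e1 ?e2 ?e3 ?e4 ?e5 ?e6.
Qed.

Lemma wl3_round_swap12 i a b c a' b' c' :
  r i a b c = r i a' b' c' -> r i b a c = r i b' a' c'.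
Proof.
elim: i a b c a' b' c' => [|i IH] a b c a' b' c'.
  move/wl3_initP => [e1 e2 e3 [e4 e5 e6]]; apply/wl3_initP; split=> //.
  - by rewrite eq_sym e1 eq_sym.
  - by split=> //; rewrite edge_sym e4 edge_sym.
move/wl3_round_stepP => [/IH e p]; apply/wl3_round_stepP; split=> //.
by apply: perm_map_transfer p _ => w w' _ _ [/IH e1 /IH e2 /IH e3]; congr (_, _, _).
Qed.

Lemma wl3_round_swap23 i a b c a' b' c' :
  r i a b c = r i a' b' c' -> r i a c b = r i a' c' b'.
Proof.
elim: i a b c a' b' c' => [|i IH] a b c a' b' c'.
  move/wl3_initP => [e1 e2 e3 [e4 e5 e6]]; apply/wl3_initP; split=> //.
  - by rewrite eq_sym e3 eq_sym.
  - by split=> //; rewrite edge_sym e6 edge_sym.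
move/wl3_round_stepP => [/IH e p]; apply/wl3_round_stepP; split=> //.
by apply: perm_map_transfer p _ => w w' _ _ [/IH e1 /IH e2 /IH e3]; congr (_, _, _).
Qed.

Lemma wcol_swap12 a b c a' b' c' :
  wcol a b c = wcol a' b' c' -> wcol b a c = wcol b' a' c'.
Proof. exact: wl3_round_swap12. Qed.

Lemma wcol_swap23 a b c a' b' c' :
  wcol a b c = wcol a' b' c' -> wcol a c b = wcol a' c' b'.
Proof. exact: wl3_round_swap23. Qed.

Lemma wcol_step a b c a' b' c' : wcol a b c = wcol a' b' c' ->
  perm_eq [seq (wcol w b c, wcol a w c, wcol a b w) | w <- enum G]
          [seq (wcol w b' c', wcol a' w c', wcol a' b' w) | w <- enum G].
Proof.
rewrite /wcol /wl3 /stable_coloring; case: ex_minnP => n /forallP st _ E.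
have /wl3_round_stepP[_] // : r n.+1 a b c = r n.+1 a' b' c'.
have /forallP/(_ [tuple a'; b'; c'])/eqP := st [tuple a; b; c].
by rewrite E eqxx => /esym/eqP.
Qed.

Lemma wcol_atoms a b c a' b' c' :
  wcol a b c = wcol a' b' c' -> same_atoms a b c a' b' c'.
Proof.
rewrite /wcol /wl3 /stable_coloring; move: (ex_minn _) => n E; apply/wl3_initP.
elim: n E => //= n IH /wl3_round_stepP[/IH //].
Qed.

(* Substituting a fourth vertex into any of the three positions: this is where
   three-dimensional refinement amounts to four-variable counting logic. *)
Lemma wcol_sum (F F' : G -> nat) a b c a' b' c' : wcol a b c = wcol a' b' c' ->
  (forall d d', wcol d b c = wcol d' b' c' -> wcol a d c = wcol a' d' c' ->
     wcol a b d = wcol a' b' d' -> F d = F' d') ->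
  \sum_d F d = \sum_d F' d.
Proof.
move=> /wcol_step p FF.
have S H : \sum_d H d = sumn [seq H w | w <- enum G] by rewrite sumnE big_map big_enum.
rewrite !S; apply: perm_sumn; apply: perm_map_transfer p _ => w w' _ _ [e1 e2 e3].
exact: FF.
Qed.

Lemma wcol_card (F F' : pred G) a b c a' b' c' : wcol a b c = wcol a' b' c' ->
  (forall d d', wcol d b c = wcol d' b' c' -> wcol a d c = wcol a' d' c' ->
     wcol a b d = wcol a' b' d' -> F d = F' d') ->
  #|[set d | F d]| = #|[set d | F' d]|.
Proof.
move=> E FF; rewrite -!sum1dep_card !(big_mkcond F) !(big_mkcond F').
by apply: (wcol_sum E) => d d' *; rewrite (FF d d').
Qed.

Lemma wcol_exists (F F' : pred G) a b c a' b' c' : wcol a b c = wcol a' b' c' ->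
  (forall d d', wcol d b c = wcol d' b' c' -> wcol a d c = wcol a' d' c' ->
     wcol a b d = wcol a' b' d' -> F d = F' d') ->
  [exists d, F d] = [exists d, F' d].
Proof.
move=> E FF; have := wcol_card E FF => eqc.
have ex (P : pred G) : [exists d, P d] = (0 < #|[set d | P d]|).
  by apply/existsP/card_gt0P => -[x Px]; exists x; rewrite ?inE // -?inE in Px *.
by rewrite !ex eqc.
Qed.

Lemma wcol_forall (F F' : pred G) a b c a' b' c' : wcol a b c = wcol a' b' c' ->
  (forall d d', wcol d b c = wcol d' b' c' -> wcol a d c = wcol a' d' c' ->
     wcol a b d = wcol a' b' d' -> F d = F' d') ->
  [forall d, F d] = [forall d, F' d].
Proof.
move=> E FF; rewrite -[LHS]negbK -[RHS]negbK !negb_forall; congr (~~ _).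
by apply: (wcol_exists E) => d d' *; rewrite (FF d d').
Qed.

(** Substituting [b] for the third entry produces the triple [(a, b, b)]; in the other multiset only
    the substitution of [b'] can match it, since atoms record equalities. *)
Lemma wcol_ab a b c a' b' c' : wcol a b c = wcol a' b' c' -> pcol a b = pcol a' b'.
Proof.
move=> E; have /perm_mem/(_ (wcol b b c, wcol a b c, wcol a b b)) := wcol_step E.
rewrite (map_f (fun w => (wcol w b c, wcol a w c, wcol a b w))) ?mem_enum //.
case/esym/mapP => w _ [_ _ e].
by have [_ _ + _] := wcol_atoms e; rewrite /pcol e eqxx => /esym/eqP <-.
Qed.

Lemma wcol_ac a b c a' b' c' : wcol a b c = wcol a' b' c' -> pcol a c = pcol a' c'.
Proof. by move/wcol_swap23/wcol_ab. Qed.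

Lemma wcol_bc a b c a' b' c' : wcol a b c = wcol a' b' c' -> pcol b c = pcol b' c'.
Proof. by move/wcol_swap12/wcol_ac. Qed.

Lemma wcol_ba a b c a' b' c' : wcol a b c = wcol a' b' c' -> pcol b a = pcol b' a'.
Proof. by move/wcol_swap12/wcol_ab. Qed.

Lemma wcol_ca a b c a' b' c' : wcol a b c = wcol a' b' c' -> pcol c a = pcol c' a'.
Proof. by move/wcol_ac/wcol_ba. Qed.

Lemma wcol_cb a b c a' b' c' : wcol a b c = wcol a' b' c' -> pcol c b = pcol c' b'.
Proof. by move/wcol_bc/wcol_ba. Qed.

Lemma wcol_a a b c a' b' c' : wcol a b c = wcol a' b' c' -> pcol a a = pcol a' a'.
Proof.
move=> /wcol_ba/wcol_swap12/wcol_swap23 E.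
have /perm_mem/(_ (wcol a a b, wcol a a b, wcol a a a)) := wcol_step E.
rewrite (map_f (fun w => (wcol w a b, wcol a w b, wcol a a w))) ?mem_enum //.
case/esym/mapP => w _ [_ _ e].
by have [_ + _ _] := wcol_atoms e; rewrite /pcol e eqxx => /esym/eqP <-.
Qed.

Lemma wcol_b a b c a' b' c' : wcol a b c = wcol a' b' c' -> pcol b b = pcol b' b'.
Proof. by move/wcol_swap12/wcol_a. Qed.

Lemma wcol_c a b c a' b' c' : wcol a b c = wcol a' b' c' -> pcol c c = pcol c' c'.
Proof. by move/wcol_swap23/wcol_b. Qed.

Lemma wcol_edge a b c a' b' c' : wcol a b c = wcol a' b' c' -> edge a b = edge a' b'.
Proof. by move/wcol_atoms => [_ _ _ []]. Qed.

Lemma wcol_eq a b c a' b' c' : wcol a b c = wcol a' b' c' -> (a == b) = (a' == b').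
Proof. by move/wcol_atoms => []. Qed.

End WLColors.

(** * Coarsest stable refinements *)

Section StableColoring.
Variables (H : sgraph) (D : choiceType) (chiE : H -> H -> D) (t : nat).
Implicit Types c d : coloring H.

Definition equitable c := forall x y, c x = c y ->
  perm_eq [seq (c w, chiE x w, chiE w x) | w <- enum (edge x)]
          [seq (c w, chiE y w, chiE w y) | w <- enum (edge y)].

Definition small_classes_split c := forall x y,
  #|color_class c x| <= t -> c x = c y -> x = y.

Lemma same_partition_eq c d : same_partition c d -> forall x y, (c x == c y) = (d x == d y).
Proof. by move=> /forallP E x y; have /forallP/(_ y)/eqP := E x. Qed.

Lemma same_partition_trans c d e :
  same_partition c d -> same_partition d e -> same_partition c e.
Proof.
move=> cd de; apply/forallP => x; apply/forallP => y; apply/eqP.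
by rewrite (same_partition_eq cd) (same_partition_eq de).
Qed.

Lemma same_partition_sym c d : same_partition c d -> same_partition d c.
Proof.
by move=> cd; apply/forallP => x; apply/forallP => y; apply/eqP; rewrite (same_partition_eq cd).
Qed.

Lemma color_class_same c d x : same_partition c d -> color_class c x = color_class d x.
Proof. by move=> cd; apply/setP => y; rewrite !inE (same_partition_eq cd). Qed.

Lemma cr_step_eq c x y : cr_step chiE c x = cr_step chiE c y <-> c x = c y /\
  perm_eq [seq (c w, chiE x w, chiE w x) | w <- enum (edge x)]
          [seq (c w, chiE y w, chiE w y) | w <- enum (edge y)].
Proof.
split=> [[-> e]|[e p]]; first by split=> //; apply/eq_seq_msetP.
by congr (_, _) => //; apply/eq_seq_msetP.
Qed.

Lemma equitable_same c d : same_partition c d -> equitable c -> equitable d.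
Proof.
move=> cd ec x y /eqP; rewrite -(same_partition_eq cd) => /eqP/ec p.
apply: perm_map_transfer p _ => w w' _ _ [/eqP e -> ->].
by move: e; rewrite (same_partition_eq cd) => /eqP->.
Qed.

Lemma equitable_cr c : equitable (cr chiE c).
Proof.
move=> x y; rewrite /cr /stable_coloring; case: ex_minnP => n st _ /eqP E.
by move: E; rewrite (same_partition_eq st) => /eqP/cr_step_eq[].
Qed.

Lemma refines_cr c d : equitable d -> refines d c -> refines d (cr chiE c).
Proof.
move=> ed dc; rewrite /cr /stable_coloring; move: (ex_minn _) => n.
elim: n => //= n IH x y Exy; apply/cr_step_eq; split; first exact: IH.
by apply: perm_map_transfer (ed _ _ Exy) _ => w w' _ _ [/IH -> -> ->].
Qed.

Lemma refines_split_small c d : small_classes_split d -> refines d c ->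
  refines d (split_small t c).
Proof.
move=> sd dc x y Exy; have Ecl : color_class c x = color_class c y.
  by apply/setP => z; rewrite !inE (dc _ _ Exy).
rewrite /= -Ecl (dc _ _ Exy); case: ifP => // le_t; congr (inl _).
apply: sd Exy; apply: leq_trans le_t; apply: subset_leq_card.
by apply/subsetP => z; rewrite !inE => /eqP/dc->.
Qed.

(** Neither kind of round can leave the colorings coarser than [d]. Together with [tcr_stable] and
    [tcr_refines] this characterizes the [t]-CR-stable coloring as the coarsest equitable refinement
    of [c] whose classes of size at most [t] are singletons. *)
Lemma refines_tcr c d : equitable d -> small_classes_split d -> refines d c ->
  refines d (tcr chiE t c).
Proof.
move=> ed sd dc; rewrite /tcr; move: (ex_minn _) => n; elim: n => //= n IH.
by case: odd; [exact: refines_split_small | exact: refines_cr].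
Qed.

Lemma tcr_refines c : refines (tcr chiE t c) c.
Proof.
rewrite /tcr; move: (ex_minn _) => n; elim: n => // n IH.
exact: refines_trans (@tcr_round_refines _ _ _ _ _ _) IH.
Qed.

Lemma split_same_small c : same_partition c (split_small t c) -> small_classes_split c.
Proof.
move=> st x y le_t Exy; have Ecl : color_class c y = color_class c x.
  by apply/setP => z; rewrite !inE Exy.
have /eqP : split_small t c x == split_small t c y by rewrite -(same_partition_eq st) Exy.
by rewrite /= Ecl le_t => -[].
Qed.

Lemma small_same c d : same_partition c d -> small_classes_split c -> small_classes_split d.
Proof.
move=> cd sc x y; rewrite -(color_class_same x cd) => le_t /eqP.
by rewrite -(same_partition_eq cd) => /eqP; exact: sc.
Qed.

Lemma tcr_stable c :
  equitable (tcr chiE t c) /\ small_classes_split (tcr chiE t c).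
Proof.
rewrite /tcr; case: ex_minnP => n /andP[]; set p := tcr_round chiE t c => s1 s2 _.
have pS j : p j.+1 = if odd j then split_small t (p j) else cr chiE (p j) by [].
have s1' := same_partition_sym s1; have s2' := same_partition_sym s2.
have s12' := same_partition_trans s2' s1'.
have [on|on] := boolP (odd n).
  split; first by apply: equitable_same s12' _; rewrite pS /= on; exact: equitable_cr.
  by apply: split_same_small; rewrite pS on in s1.
split; first by apply: equitable_same s1' _; rewrite pS (negbTE on); exact: equitable_cr.
by apply: small_same s1' _; apply: split_same_small; rewrite (pS n.+1) /= on in s2.
Qed.

End StableColoring.

(** * Closures *)

Lemma decreasing_sets_stabilize (T : finType) (A : nat -> {set T}) :
  (forall i, A i.+1 \subset A i) -> exists i, A i \subset A i.+1.
Proof.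
move=> dec; have [n] := ubnP #|A 0|; move: {1}0 => i; elim: n i => // n IH i lt.
have [le|gt] := leqP #|A i| #|A i.+1|.
  by exists i; have /eqP-> : A i.+1 == A i by rewrite eqEcard dec.
by apply: (IH i.+1); apply: leq_trans gt _.
Qed.

Section Closure.
Variables (G : sgraph) (t : nat).
Implicit Types a b c u v w x y z : G.

Local Notation pcol := (@pcol G).

Definition cl v : {set G} := pair_closure pcol t [set v].

Let K := complete_graph G.
Let chiE : K -> K -> bool * color (wl3 G) := fun v w => (@edge G v w, pcol v w).
Let chiV : coloring K := @Coloring K _ (fun v : G => pcol v v).
Let lam v : coloring K := tcr chiE t (individualize ([set v] : {set K}) chiV).

Definition cls v x : {set G} := color_class (lam v) x.

Lemma mem_cls v x y : (y \in cls v x) = (lam v y == lam v x).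
Proof. by rewrite inE. Qed.

Lemma cls_refl v x : x \in cls v x.
Proof. by rewrite mem_cls. Qed.

Lemma cls_eq v x y : y \in cls v x -> cls v y = cls v x.
Proof. by rewrite mem_cls => /eqP E; apply/setP => z; rewrite !mem_cls E. Qed.

Lemma mem_cl v x : (x \in cl v) = (#|cls v x| == 1).
Proof. by rewrite inE. Qed.

Lemma cls_cl v x : x \in cl v -> cls v x = [set x].
Proof.
rewrite mem_cl => /cards1P[y E]; have := cls_refl v x.
by rewrite E inE => /eqP->.
Qed.

Lemma lam_small v : small_classes_split t (lam v).
Proof. by have [] := tcr_stable chiE t (individualize ([set v] : {set K}) chiV). Qed.

Lemma lam_equitable v : equitable chiE (lam v).
Proof. by have [] := tcr_stable chiE t (individualize ([set v] : {set K}) chiV). Qed.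

Lemma lam_refines v a b : lam v a = lam v b ->
  (a == b) || [&& a != v, b != v & pcol a a == pcol b b].
Proof.
move/(tcr_refines (c := individualize ([set v] : {set K}) chiV)) => /=.
rewrite !inE; case: (a =P v); case: (b =P v) => // _ _ [->]; by rewrite eqxx ?orbT.
Qed.

Lemma cls_big v x : x \notin cl v -> t < #|cls v x|.
Proof.
apply: contraR; rewrite -leqNgt => le_t; rewrite mem_cl.
suff -> : cls v x = [set x] by rewrite cards1.
apply/setP => y; rewrite mem_cls inE; apply/eqP/eqP => [E|->//].
by apply: esym; apply: (lam_small le_t).
Qed.

Lemma cl_refl v : v \in cl v.
Proof.
rewrite mem_cl; suff -> : cls v v = [set v] by rewrite cards1.
apply/setP => y; rewrite mem_cls inE; apply/eqP/eqP => [/lam_refines|->//].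
by rewrite eqxx andbF orbF => /eqP.
Qed.

(** [lam v] is stable and already isolates [w], so it refines [lam w], the coarsest such coloring;
    singletons of the coarser one remain singletons. *)
Lemma cl_trans v w : w \in cl v -> cl w \subset cl v.
Proof.
move=> wv; have ref : refines (lam v) (lam w).
  apply: refines_tcr; [exact: lam_equitable | exact: lam_small |].
  move=> a b E; rewrite /= !inE.
  have clw : cls v w = [set w] by exact: cls_cl.
  have Ew z : (lam v z == lam v w) = (z == w).
    by have := mem_cls v w z; rewrite clw inE.
  have Eab : (a == w) = (b == w) by rewrite -!Ew E.
  rewrite Eab; case: (b =P w) Eab => [-> /eqP->//|_ _]; congr (inr _).
  by have := lam_refines E; case/orP => [/eqP->//|/and3P[_ _ /eqP]].
apply/subsetP => x xw; rewrite mem_cl eqn_leq; apply/andP; split; last first.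
  by apply/card_gt0P; exists x; exact: cls_refl.
have := cls_cl xw => E; rewrite -(cards1 x) -E; apply: subset_leq_card.
by apply/subsetP => y; rewrite !mem_cls => /eqP/ref->.
Qed.

(* The greatest fixpoint description of the partition [cls v], as a ternary
   relation to which the counting properties of [wcol] apply. *)
Fixpoint equiv_round i v a b : bool :=
  if i is j.+1 then
    [&& equiv_round j v a b,
      [forall u, forall p, forall q,
        #|[set w | equiv_round j v u w && (pcol a w == pcol p q)]| ==
        #|[set w | equiv_round j v u w && (pcol b w == pcol p q)]|]
      & (#|[set w | equiv_round j v a w]| <= t) ==> (a == b)]
  else (a == b) || [&& a != v, b != v & pcol a a == pcol b b].

Lemma equiv_round_inv i v a b v' a' b' : wcol v a b = wcol v' a' b' ->
  equiv_round i v a b = equiv_round i v' a' b'.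
Proof.
elim: i v a b v' a' b' => [|j IH] v a b v' a' b' E /=.
  have [e1 e2 e3 _] := wcol_atoms E.
  rewrite e3 ![_ == v]eq_sym ![_ == v']eq_sym e1 e2; congr (_ || [&& _, _ & _]).
  by rewrite (wcol_b E) (wcol_c E).
congr [&& _, _ & _]; first exact: IH.
- apply: (wcol_forall E) => u u' E1 E2 E3.
  apply: eq_forallb => p; apply: eq_forallb => q; congr (_ == _).
  + apply: (wcol_card E3) => w w' F1 F2 F3; congr (_ && _).
      by apply: IH; exact: wcol_swap23.
    by rewrite (wcol_ba F1).
  + apply: (wcol_card E2) => w w' F1 F2 F3; congr (_ && _); first exact: IH.
    by rewrite (wcol_ca F1).
- congr (_ ==> _); last by have [_ _ -> _] := wcol_atoms E.
  by congr (_ <= _); apply: (wcol_card E) => w w' _ _ F; exact: IH.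
Qed.

Lemma equiv_round_refl i v a : equiv_round i v a a.
Proof.
elim: i => [|i IH] /=; first by rewrite eqxx.
rewrite IH eqxx implybT andbT; apply/forallP => u; apply/forallP => p.
by apply/forallP.
Qed.

Lemma equiv_round_equiv i v a b : equiv_round i v a b ->
  equiv_round i v a =1 equiv_round i v b.
Proof.
elim: i a b => [|i IH] a b /=.
  case/orP => [/eqP->//|/and3P[av bv /eqP E]] z; rewrite av bv E /=.
  case: (z =P v) => [->|_] /=; first by rewrite (negPf av) (negPf bv).
  case: (a =P z) => [<-|_] /=; first by rewrite E eqxx orbT.
  by case: (b =P z) => [<-|_] //=; rewrite eqxx.
case/and3P => Eab /forallP cnt sm z; have Ez := IH _ _ Eab.
have cntE u p q : #|[set w | equiv_round i v u w && (pcol a w == pcol p q)]| =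
    #|[set w | equiv_round i v u w && (pcol b w == pcol p q)]|.
  by have /forallP/(_ p)/forallP/(_ q)/eqP := cnt u.
congr [&& _, _ & _]; first exact: Ez.
  apply: eq_forallb => u; apply: eq_forallb => p; apply: eq_forallb => q.
  by rewrite cntE.
have -> : [set w | equiv_round i v a w] = [set w | equiv_round i v b w].
  by apply/setP => w; rewrite !inE Ez.
move: sm; have -> : [set w | equiv_round i v a w] = [set w | equiv_round i v b w].
  by apply/setP => w; rewrite !inE Ez.
by case: (_ <= t) => //= /eqP->.
Qed.

Lemma equiv_round_sym i v a b : equiv_round i v a b = equiv_round i v b a.
Proof. by apply/idP/idP => /equiv_round_equiv E; rewrite -E equiv_round_refl. Qed.

Lemma equiv_roundS i v a b : equiv_round i.+1 v a b -> equiv_round i v a b.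
Proof. by case/and3P. Qed.

(* The arcs at [a] in the complete graph, together with the loop [a a]. *)
Lemma card_arcs (c : coloring K) (F : color c -> bool) a p q :
  #|[set w : G | F (c w) && (pcol a w == pcol p q)]| =
  (F (c a) && (pcol a a == pcol p q)) +
  count (fun k : color c * (bool * color (wl3 G)) * (bool * color (wl3 G)) =>
      F k.1.1 && (k.1.2.2 == pcol p q))
    [seq (c w, chiE a w, chiE w a) | w <- enum (@edge K a)].
Proof.
rewrite count_map (cardsD1 a) inE; congr (_ + _).
rewrite -size_filter cardE; apply: perm_size; apply: uniq_perm.
- exact: enum_uniq.
- by apply: filter_uniq; exact: enum_uniq.
- by move=> w; rewrite [RHS]mem_filter !mem_enum !inE /= eq_sym [RHS]andbC.
Qed.

Lemma lam_equiv_round i v a b : lam v a = lam v b -> equiv_round i v a b.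
Proof.
elim: i a b => [|i IH] a b E; first exact: lam_refines.
rewrite /= IH //=; apply/andP; split.
  apply/forallP => u; apply/forallP => p; apply/forallP => q; apply/eqP.
  (* By induction an [equiv_round] class is a union of [lam v] classes; [F] selects their colors,
     which turns the count into one that equitability controls. *)
  pose F k := [exists w, (lam v w == k) && equiv_round i v u w].
  have FE w : F (lam v w) = equiv_round i v u w.
    apply/existsP/idP => [[z /andP[/eqP /IH/equiv_round_equiv Ezw uz]]|uw].
      by rewrite equiv_round_sym -Ezw equiv_round_sym.
    by exists w; rewrite eqxx.
  have C x : #|[set w | equiv_round i v u w && (pcol x w == pcol p q)]| =
      #|[set w : G | F (lam v w) && (pcol x w == pcol p q)]|.
    by apply: eq_card => w; rewrite !inE FE.
  rewrite !C !card_arcs E; congr (_ && _ + _); first last.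
    exact/permP/(lam_equitable E).
  by have := lam_refines E; case/orP => [/eqP->//|/and3P[_ _ /eqP->]].
apply/implyP => le_t; apply/eqP; apply: lam_small E; apply: leq_trans le_t.
apply: subset_leq_card; apply/subsetP => w; rewrite !inE => /eqP Ew.
by apply: IH; rewrite Ew.
Qed.

(** The rounds decrease in a finite set and stop. The limit is equitable and splits small classes,
    so it refines [lam v], while [lam v] refines every round. The number of rounds is the same for
    all [v], as comparing closures of different vertices requires. *)
Lemma cls_equiv_round : exists n, forall v a b, (b \in cls v a) = equiv_round n v a b.
Proof.
pose A i := [set x : G * G * G | equiv_round i x.1.1 x.1.2 x.2].
have [|n /subsetP sub] := @decreasing_sets_stabilize _ A.
  by move=> i; apply/subsetP => -[[v a] b]; rewrite !inE; exact: equiv_roundS.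
have st v a b : equiv_round n v a b -> equiv_round n.+1 v a b.
  by move=> E; have := sub (v, a, b); rewrite !inE => /(_ E).
exists n => v a b; rewrite mem_cls; apply/eqP/idP => [/esym/lam_equiv_round//|Eab].
pose c : coloring K := Coloring (fun a : K => [set b | equiv_round n v a b]).
have cP x y : c x = c y <-> equiv_round n v x y.
  split=> [/setP/(_ y)|/equiv_round_equiv E]; first by rewrite !inE equiv_round_refl.
  by apply/setP => z; rewrite !inE E.
suff : refines c (lam v) by move/(_ b a); apply; apply/cP; rewrite equiv_round_sym.
apply: refines_tcr.
- move=> x y /cP Exy; have /and3P[_ /forallP cnt _] := st _ _ _ Exy.
  have cxy : c x = c y by apply/cP.
  have pxy : pcol x x = pcol y y.
    have : equiv_round 0 v x y.
      by elim: n {sub st c cP Eab cnt cxy} Exy => // m IH /equiv_roundS.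
    by case/orP => [/eqP->//|/and3P[_ _ /eqP]].
  have pw : perm_eq [seq (c w, pcol x w) | w <- enum (@edge K x)]
      [seq (c w, pcol y w) | w <- enum (@edge K y)].
    (* The loop at [z] enters the count of [equiv_round] but is no arc of the complete graph, hence
       the subtraction. *)
    have key z u p q : count_mem (c u, pcol p q) [seq (c w, pcol z w) | w <- enum (@edge K z)] =
        #|[set w | equiv_round n v u w && (pcol z w == pcol p q)]| -
        ((c z == c u) && (pcol z z == pcol p q)).
      have -> : #|[set w | equiv_round n v u w && (pcol z w == pcol p q)]| =
          #|[set w : G | (c w == c u) && (pcol z w == pcol p q)]|.
        apply: eq_card => w; rewrite !inE; congr (_ && _).
        by apply/idP/eqP => [uw|/esym/cP //]; apply/esym/cP.
      by rewrite (card_arcs (c := c) (fun k => k == c u)) addKn !count_map.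
    apply/allP => -[k1 k2]; rewrite mem_cat => H.
    have [u [p [q ->]]] : exists u p q, (k1, k2) = (c u, pcol p q).
      by case/orP: H => /mapP[w _ ->]; [exists w, x, w | exists w, y, w].
    rewrite inE !key cxy pxy; apply/eqP; congr (_ - _).
    by have /forallP/(_ p)/forallP/(_ q)/eqP := cnt u.
  apply: perm_map_transfer pw _ => w w' _ _ Ep; have Ec : c w = c w' := congr1 fst Ep.
  have E : pcol x w = pcol y w' := congr1 snd Ep.
  congr (_, _, _) => //; rewrite /chiE.
    by rewrite E (wcol_edge E).
  by rewrite (edge_sym w) (edge_sym w') (wcol_edge E) (wcol_ba E).
- move=> x y + /cP Exy; have /and3P[_ _ /implyP sm] := st _ _ _ Exy.
  move=> le_t; apply/eqP/sm; apply: leq_trans le_t; apply: subset_leq_card.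
  by apply/subsetP => w; rewrite !inE => Exw; apply/eqP/cP; rewrite equiv_round_sym.
- move=> x y /cP Exy; have : equiv_round 0 v x y.
    by elim: n {sub st c cP Eab} Exy => // m IH /equiv_roundS.
  rewrite /= !inE; case/orP => [/eqP->//|/and3P[/negPf-> /negPf-> /eqP E]].
  by congr (inr _).
Qed.

Lemma cls_inv v a b v' a' b' : wcol v a b = wcol v' a' b' ->
  (b \in cls v a) = (b' \in cls v' a').
Proof. by have [n E] := cls_equiv_round; rewrite !E; exact: equiv_round_inv. Qed.

Lemma cls_regular v x y z p q : y \in cls v x ->
  #|[set w in cls v z | pcol x w == pcol p q]| =
  #|[set w in cls v z | pcol y w == pcol p q]|.
Proof.
rewrite mem_cls => /eqP/esym E.
have C u : #|[set w in cls v z | pcol u w == pcol p q]| =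
    #|[set w : G | (lam v w == lam v z) && (pcol u w == pcol p q)]|.
  by apply: eq_card => w; rewrite !inE.
rewrite !C !(card_arcs (c := lam v) (fun k => k == lam v z)) E; congr (_ && _ + _).
  by have := lam_refines E; case/orP => [/eqP->//|/and3P[_ _ /eqP->]].
exact/permP/(lam_equitable E).
Qed.

Lemma cl_inv v w v' w' : pcol v w = pcol v' w' -> (w \in cl v) = (w' \in cl v').
Proof.
move=> E; have E' := wcol_swap23 (wcol_ba E); rewrite !mem_cl.
have C u x : #|cls u x| = #|[set y | y \in cls u x]| by apply: eq_card => y; rewrite inE.
by rewrite !C; congr (_ == 1); apply: (wcol_card E) => d d' _ _ F; exact: cls_inv.
Qed.

(** Adjacency is a union of pair colors, so the regularity for single colors adds up. *)
Lemma cls_regular_edge v x y z : y \in cls v x ->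
  #|[set w in cls v z | edge x w]| = #|[set w in cls v z | edge y w]|.
Proof.
move=> yx; pose colors := undup [seq pcol p.1 p.2 | p <- enum {: G * G} & edge p.1 p.2].
have C u : #|[set w in cls v z | edge u w]| =
    \sum_(k <- colors) #|[set w in cls v z | pcol u w == k]|.
  pose F k := [set w in cls v z | pcol u w == k].
  transitivity (\sum_(k <- colors) \sum_(w in F k) 1); last first.
    by apply: eq_bigr => k _; rewrite sum1_card.
  rewrite -sum1_card (eq_bigl (fun w => (w \in cls v z) && edge u w)); last by move=> w; rewrite inE.
  rewrite (eq_bigr (fun w => \sum_(k <- colors | pcol u w == k) 1)); last first.
    move=> w /andP[_ uw]; rewrite sum1_count -/(count_mem _ _).
    rewrite (eq_count (a2 := pred1 (pcol u w))); last by move=> k /=; rewrite eq_sym.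
    rewrite count_uniq_mem ?undup_uniq // mem_undup.
    apply/esym/eqP; rewrite eqb1; apply/mapP; exists (u, w) => //.
    by rewrite mem_filter /= uw mem_enum.
  rewrite (exchange_big_dep predT) //=; apply: eq_big_seq => k.
  rewrite mem_undup => /mapP[[p q]]; rewrite mem_filter /= => /andP[pq _] ->.
  apply: eq_bigl => w; rewrite -andbA [RHS]inE; congr (_ && _).
  by case: eqP => [E|]; rewrite ?andbF // (wcol_edge E) pq.
rewrite !C; apply: eq_big_seq => k; rewrite mem_undup => /mapP[[p q] _ ->].
exact: cls_regular.
Qed.

(** The class of [w] in the partition for [v] has more than [t] elements, and regularity against the
    singleton class of [v] forces all of them to have the color of [w] relative to [v]. *)
Lemma cl_valency v w : w \notin cl v -> t < #|[set w' | pcol v w' == pcol v w]|.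
Proof.
move/cls_big/leq_trans; apply; apply: subset_leq_card; apply/subsetP => y yw.
have := cls_regular v w v yw; rewrite (cls_cl (cl_refl v)).
have C u : [set x in [set v] | pcol u x == pcol w v] =
  if pcol u v == pcol w v then [set v] else set0.
  apply/setP => x; rewrite !inE; case: (x =P v) => [->|ne] /=.
    by case: ifP => _; rewrite ?inE ?eqxx.
  by case: ifP => _; rewrite ?inE //; move/eqP/negPf: ne => ->.
rewrite !C eqxx cards1; case: ifP => [/eqP E _|_]; last by rewrite cards0.
by rewrite inE (wcol_ba E).
Qed.

End Closure.

(** * Attachments of a component to a closure *)

Section Attachments.
Variables (G : sgraph) (t h : nat).
Hypothesis h_gt0 : 0 < h.
Hypothesis G_excl : ~ topological_subgraph (complete_graph 'I_h) G.
Hypothesis t_big : h.*2 * (h * h) <= t.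

Definition attachments (s z : G) : {set G} :=
  [set w in cl t s | [exists y, edge w y && connect (inside (~: cl t s)) z y]].

(** Outside the closure all classes have more than [t] elements, and a vertex of the closure, being
    a singleton class, sees all or nothing of each of them. So [h] attachments could serve as branch
    vertices. *)
Lemma cl_attachments s z : z \notin cl t s -> #|attachments s z| < h.
Proof.
move=> zD; rewrite ltnNge; apply/negP => le_h; apply: G_excl.
pose L := [set w in take h (enum (attachments s z))].
have LA : {subset L <= attachments s z}.
  by move=> w; rewrite inE => /mem_take; rewrite mem_enum.
have LD w : w \in L -> w \in cl t s by move/LA; rewrite inE => /andP[].
have cL : #|L| = h.
  rewrite cardsE; have /card_uniqP -> : uniq (take h (enum (attachments s z))).
    by apply: take_uniq; exact: enum_uniq.
  by rewrite size_takel // -cardE.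
apply: (topological_complete_of_classes (cls := cls t s) (t := t)
  (O := ~: cl t s) (r := z) (L := L)) => //.
- exact: cls_refl.
- exact: cls_eq.
- by move=> x; rewrite inE => /cls_big/ltnW.
- by move=> x x' y; exact: cls_regular_edge.
- move=> x; rewrite inE => xD; apply/subsetP => y yx; rewrite inE.
  by rewrite mem_cl (cls_eq yx) -mem_cl.
- by rewrite inE.
- by rewrite disjoints_subset; apply/subsetP => w /LD; rewrite !in_setC negbK.
- move=> w x y /LD wD wx yx; have := cls_regular_edge w yx.
  have C u : [set v in cls t s w | edge u v] = if edge u w then [set w] else set0.
    rewrite (cls_cl wD); apply/setP => v; rewrite !inE; case: (v =P w) => [->|ne] /=.
      by case: ifP; rewrite ?inE ?eqxx.
    by case: ifP => _; rewrite inE //; move/eqP/negPf: ne.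
  rewrite !C edge_sym wx cards1 edge_sym; case: ifP => // _.
  by rewrite cards0.
- move=> w /LA; rewrite inE => /andP[wD /existsP[y /andP[wy zy]]]; exists y; split=> //.
  apply: (connect_invariant (P := fun y => y \in ~: cl t s) _ _ zy); first by rewrite inE.
  by move=> u v _ /and3P[].
Qed.

End Attachments.

(** * Counting and linking tools *)

Lemma card_pairs (G : finType) (P : G -> G -> bool) :
  #|[set p : G * G | P p.1 p.2]| = \sum_a #|[set b | P a b]|.
Proof.
rewrite -sum1dep_card -(pair_big_dep predT P (fun _ _ => 1)) /=.
by apply: eq_bigr => a _; rewrite sum1dep_card.
Qed.

Lemma card_fibers (P Q : finType) (E : {set P}) (f : P -> Q) (B : {set Q}) m :
  (forall e, e \in E -> f e \in B) ->
  (forall w, w \in B -> #|[set e in E | f e == w]| = m) ->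
  forall X : {set Q}, #|[set e in E | f e \in X]| = #|X :&: B| * m.
Proof.
move=> EB fib X; rewrite -sum_nat_const.
rewrite (eq_bigr (fun w => #|[set e in E | f e == w]|)); last first.
  by move=> w; rewrite inE => /andP[_ /fib].
rewrite -sum_card_rel -sum1_card.
rewrite (eq_bigl (fun e => (e \in E) && (f e \in X))); last by move=> e; rewrite inE.
rewrite [LHS]big_mkcondr; apply: eq_bigr => e eE.
have -> : [set w in X :&: B | f e == w] = if f e \in X then [set f e] else set0.
  apply/setP => w; rewrite !inE; case: (f e =P w) => [<-|ne].
    by rewrite EB // !andbT; case: ifP => ?; rewrite !inE ?eqxx.
  rewrite andbF; case: ifP => _; rewrite !inE //; apply/esym/eqP => E'; exact: ne.
by case: ifP; rewrite ?cards1 ?cards0.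
Qed.

Lemma card_triples (G : finType) (P : G -> G -> G -> bool) :
  #|[set e : G * G * G | P e.1.1 e.1.2 e.2]| = \sum_a \sum_x #|[set b | P a x b]|.
Proof.
rewrite pair_big -sum1dep_card /=.
rewrite (eq_bigr (fun p => \sum_(b | P p.1 p.2 b) 1)); last by move=> p _; rewrite sum1dep_card.
by rewrite (pair_big_dep predT (fun p b => P p.1 p.2 b) (fun _ _ => 1)).
Qed.

Lemma card_triples_mid (G : finType) (P : G -> G -> G -> bool) :
  #|[set e : G * G * G | P e.1.1 e.1.2 e.2]| = \sum_a \sum_b #|[set x | P a x b]|.
Proof.
rewrite card_triples; apply: eq_bigr => a _.
have := sum_card_rel setT setT (fun x b => P a x b).
under eq_bigl do rewrite inE.
under [in RHS]eq_bigl do rewrite inE.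
move=> E; transitivity (\sum_i #|[set y in setT | P a i y]|).
  by apply: eq_bigr => x _; apply: eq_card => b; rewrite !inE.
by rewrite E; apply: eq_bigr => b _; apply: eq_card => x; rewrite !inE.
Qed.

Lemma linkedS (G : sgraph) (B C : {set G}) x y : B \subset C -> linked B x y -> linked C x y.
Proof. by move=> /subsetP BC [p pe pB]; exists p => // z /pB/BC. Qed.

Lemma linked_trans (G : sgraph) (C : {set G}) x y z :
  x \in C -> linked C x y -> linked C x z -> linked C y z.
Proof.
move=> xC /linked_sym[p pe pC] [q qe qC]; exists (p ++ x :: q).
  by rewrite rcons_cat rcons_cons cat_path; move: pe; rewrite rcons_path /= => /andP[-> ->].
by move=> w; rewrite mem_cat inE => /or3P[/pC//|/eqP->//|/qC].
Qed.

Lemma linked_cons (G : sgraph) (C : {set G}) x y z :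
  x \in C -> edge y x -> linked C x z -> linked C y z.
Proof.
move=> xC yx; apply: linked_trans xC _; exists [::] => //=.
by rewrite edge_sym yx.
Qed.

(** The shape of both final contradictions: the density bound keeps every good family small, and
    smallness is exactly what leaves room for one more member. *)
Lemma unbounded_family (R : realType) (P : finType) (good : {set P} -> Prop) (B : R) :
  good set0 ->
  (forall F : {set P}, good F -> (#|F|%:R <= B)%R -> exists2 e, e \notin F & good (e |: F)) ->
  ~ (forall F : {set P}, good F -> (#|F|%:R <= B)%R).
Proof.
move=> g0 step bound.
suff H k : exists2 F : {set P}, good F & #|F| = k.
  by have [F _ cF] := H #|P|.+1; have := max_card F; rewrite cF ltnn.
elim: k => [|k [F gF cF]]; first by exists set0; rewrite ?cards0.
have [e eF ge] := step F gF (bound F gF); exists (e |: F) => //.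
by rewrite cardsU1 eF cF.
Qed.

Lemma card_bigcup_leq (P Q : finType) (F : {set P}) (f : P -> {set Q}) :
  #|\bigcup_(e in F) f e| <= \sum_(e in F) #|f e|.
Proof.
elim/big_rec2: _ => [|e c X _ le]; first by rewrite cards0.
by apply: leq_trans (leq_card_setU _ _) _; rewrite leq_add2l.
Qed.

(** * Breadth-first search and routing *)

(* Tokens: a vertex [y] at positive level stands for itself, and a vertex
   [s] of [S] seen from a neighbour [x] for the arc [(s, x)], as the capacity
   of the vertices of [S] is not bounded. *)
Definition token (G : sgraph) : finType := (G + G * G)%type.

Section Levels.
Variables (G : sgraph) (t h : nat).
Hypothesis h_gt0 : 0 < h.
Hypothesis G_excl : ~ topological_subgraph (complete_graph 'I_h) G.
Hypothesis t_big : h.*2 * (h * h) <= t.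
Variable T : {set G}.
Hypothesis T_cl : forall u v, u \in T -> v \in cl t u -> v \in T /\ cl t v = cl t u.
Hypothesis T_inv : forall u u', pcol u u = pcol u' u' -> (u \in T) = (u' \in T).
Variable s0 : G.
Hypothesis s0T : s0 \in T.
Implicit Types (a b s u v x y z : G) (w : token G) (i j k : nat).

Definition vclass x : {set G} := [set y | pcol y y == pcol x x].
Let S := vclass s0.
Let n := #|S|.

Lemma label_T s : s \in S -> s \in T.
Proof. by rewrite inE => /eqP/T_inv->. Qed.

Lemma notin_cl s y : s \in T -> y \notin T -> y \notin cl t s.
Proof. by move=> sT; apply: contra => /(T_cl sT)[]. Qed.

Lemma cl_sym u v : u \in T -> v \in cl t u -> u \in cl t v.
Proof. by move=> uT /(T_cl uT)[_ ->]; exact: cl_refl. Qed.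

(** The search starts from a whole color class, so that reached sets, levels and labels are all
    determined by colors. *)
Fixpoint reach j : {set G} := if j is i.+1
  then reach i :|: [set y | (y \notin T) && [exists x, (x \in reach i) && edge x y]]
  else S.

Definition level j := if j is i.+1 then reach j :\: reach i else S.

Fixpoint labels j y : {set G} := if j is i.+1
  then [set s | [exists x, [&& x \in level i, edge x y & s \in labels i x]]]
  else [set y].

Lemma reachS j : reach j \subset reach j.+1.
Proof. exact: subsetUl. Qed.

Lemma reach_leq i j : i <= j -> reach i \subset reach j.
Proof.
move=> /subnK <-; elim: (j - i) => // k IH; rewrite addSn.
exact: subset_trans IH (reachS _).
Qed.

Lemma level_reach j y : y \in level j -> y \in reach j.
Proof. by case: j => // j; rewrite inE => /andP[]. Qed.

Lemma levelS_notT j y : y \in level j.+1 -> y \notin T.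
Proof. by rewrite !inE => /andP[/negPf-> /= /andP[]]. Qed.

Lemma levelS_ex j y : y \in level j.+1 -> exists2 x, x \in level j & edge x y.
Proof.
rewrite in_setD => /andP[yj]; rewrite inE (negPf yj) inE => /andP[yT /existsP[x /andP[xj xy]]].
exists x => //; case: j yj xj => // j yj xj; rewrite in_setD xj andbT.
apply: contra yj => xj'; rewrite inE; apply/orP; right.
by rewrite inE yT; apply/existsP; exists x; rewrite xj'.
Qed.

Lemma reach_inv j y y' : pcol y y = pcol y' y' -> (y \in reach j) = (y' \in reach j).
Proof.
elim: j y y' => [|j IH] y y' E; first by rewrite !inE E.
rewrite !in_setU (IH _ _ E) !inE (T_inv E); congr (_ || (_ && _)).
apply: (wcol_exists E) => d d' E1 E2 E3; rewrite (wcol_edge E1); congr (_ && _).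
exact: IH (wcol_a E1).
Qed.

Lemma level_inv j y y' : pcol y y = pcol y' y' -> (y \in level j) = (y' \in level j).
Proof.
move=> E; case: j => [|j]; first exact: (reach_inv 0 E).
by rewrite !in_setD !(reach_inv _ E).
Qed.

Lemma labels_inv j y s y' s' : pcol y s = pcol y' s' ->
  (s \in labels j y) = (s' \in labels j y').
Proof.
elim: j y s y' s' => [|j IH] y s y' s' E.
  by rewrite !inE eq_sym (wcol_eq E) eq_sym.
rewrite !inE; apply: (wcol_exists E) => d d' E1 E2 E3.
rewrite (level_inv j (wcol_a E1)) (edge_sym d) (edge_sym d') (wcol_edge E2).
by congr [&& _, _ & _]; exact: IH.
Qed.

Lemma labels_S j y s : y \in level j -> s \in labels j y -> s \in S.
Proof.
elim: j y => [|j IH] y; first by move=> yS; rewrite inE => /eqP->.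
by move=> _; rewrite inE => /existsP[x /and3P[xj _]]; exact: IH.
Qed.

Lemma labels_ex j y : y \in level j -> exists s, s \in labels j y.
Proof.
elim: j y => [|j IH] y; first by exists y; rewrite inE.
move=> /levelS_ex[x xj xy]; have [s sx] := IH _ xj; exists s; rewrite inE.
by apply/existsP; exists x; rewrite xj xy.
Qed.

Lemma labels_sub j x y : x \in level j -> edge x y -> labels j x \subset labels j.+1 y.
Proof.
move=> xj xy; apply/subsetP => s sx; rewrite inE.
by apply/existsP; exists x; rewrite xj xy.
Qed.

Lemma labels_connect j y s : y \in level j.+1 -> s \in labels j.+1 y ->
  exists2 y', edge s y' & connect (inside (~: T)) y y'.
Proof.
elim: j y => [|j IH] y yj; rewrite inE => /existsP[x /and3P[xj xy sx]].
  by exists y; [move: sx; rewrite inE => /eqP->|exact: connect0].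
have [y' sy' xy'] := IH _ xj sx; exists y' => //.
apply: connect_trans (connect1 _) xy'; rewrite /= edge_sym xy andbT.
by rewrite !in_setC (levelS_notT yj) (levelS_notT xj).
Qed.

Lemma connect_notT s y z : s \in T -> connect (inside (~: T)) y z ->
  connect (inside (~: cl t s)) y z.
Proof.
move=> sT; apply: connect_sub => u v /and3P[]; rewrite !in_setC => uT vT uv.
by apply: connect1; rewrite /= !in_setC uv !notin_cl.
Qed.

Lemma labels_attachments j x y s s' : s \in T -> y \in level j -> s' \in labels j y ->
  s' \in cl t s -> x \notin cl t s -> edge y x -> s' \in attachments t s x.
Proof.
move=> sT yj s'y s's xs yx; rewrite inE s's; apply/existsP; case: j yj s'y => [|j] yj s'y.
  by exists x; move: s'y; rewrite inE => /eqP->; rewrite yx connect0.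
have [y' sy' yy'] := labels_connect yj s'y; exists y'; rewrite sy' /=.
apply: connect_trans (connect1 _) (connect_notT sT yy').
by rewrite /= !in_setC xs edge_sym yx notin_cl ?(levelS_notT yj).
Qed.

Definition mono j y := [forall s in labels j y, forall s' in labels j y, s' \in cl t s].

Lemma monoP j y : reflect (forall s s', s \in labels j y -> s' \in labels j y -> s' \in cl t s)
  (mono j y).
Proof.
apply: (iffP idP) => [/forallP m s s' sy s'y|m].
  by have := m s; rewrite sy => /forallP/(_ s'); rewrite s'y.
by apply/forallP => s; apply/implyP => sy; apply/forallP => s'; apply/implyP; exact: m.
Qed.

Lemma mono_card j y : y \in level j.+1 -> mono j.+1 y -> #|labels j.+1 y| < h.
Proof.
move=> yj /monoP my; have [s sy] := labels_ex yj.
have sT : s \in T by apply: label_T; exact: labels_S sy.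
have yT := levelS_notT yj.
apply: leq_ltn_trans (cl_attachments h_gt0 G_excl t_big (notin_cl sT yT)).
apply: subset_leq_card; apply/subsetP => s' s'y; rewrite inE my //=.
have [y' sy' yy'] := labels_connect yj s'y; apply/existsP; exists y'.
by rewrite sy' connect_notT.
Qed.

Definition tok j x y : token G := if j is 0 then inr (y, x) else inl y.

Definition is_token j (w : token G) := match w, j with
  | inr (s, x), 0 => (s \in S) && (x \notin cl t s)
  | inl y, _.+1 => y \in level j
  | _, _ => false end.

Definition tok_labels j (w : token G) := match w with
  | inr (s, _) => [set s] | inl y => labels j y end.

Definition children j (w : token G) : {set token G} := if w is inl y
  then [set tok j y x | x in [set x in level j | edge x y]] else set0.

(* The largest number of tokens of [X] from which disjoint descending paths
   can start. *)
Fixpoint link_rank j : {set token G} -> nat :=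
  if j is i.+1 then induced (link_rank i) (children i) else fun X => #|X|.

Lemma link_rankP j : rank_function (link_rank j).
Proof. by elim: j => [|j IH]; [exact: card_rank | exact: induced_rank]. Qed.

Lemma tok_labelsE j x y : tok_labels j (tok j x y) = labels j y.
Proof. by case: j. Qed.

Lemma is_token_tok j x y : y \in level j -> (j = 0 -> x \notin cl t y) -> is_token j (tok j x y).
Proof. by case: j => //= yS /(_ erefl) ->; rewrite yS. Qed.

Lemma childrenP j y w : y \in level j.+1 -> w \in children j (inl y) ->
  exists x, [/\ x \in level j, edge x y, w = tok j y x & is_token j w].
Proof.
move=> yj /imsetP[x]; rewrite inE => /andP[xj xy] ->; exists x; split=> //.
apply: is_token_tok => // j0; subst j; apply: notin_cl; first exact: label_T.
exact: levelS_notT yj.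
Qed.

Lemma tok_labels_ex j w : is_token j w -> exists s, s \in tok_labels j w.
Proof.
case: w j => [y|[s x]] [|j] // H; first exact: (labels_ex (j := j.+1) H).
by exists s; rewrite inE.
Qed.

Lemma children_labels j y w : y \in level j.+1 -> w \in children j (inl y) ->
  tok_labels j w \subset labels j.+1 y.
Proof. by move=> yj /(childrenP yj)[x [xj xy -> _]]; rewrite tok_labelsE labels_sub. Qed.

(* A child of a token only has labels of that token, so the two families are
   routed through disjoint sets. *)
Lemma link_rank_split j (D : {set G}) (X1 X2 : {set token G}) :
  (forall w, w \in X1 -> is_token j w /\ tok_labels j w \subset D) ->
  (forall w, w \in X2 -> is_token j w /\ [disjoint tok_labels j w & D]) ->
  link_rank j X1 + link_rank j X2 <= link_rank j (X1 :|: X2).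
Proof.
elim: j X1 X2 => [|j IH] X1 X2 H1 H2.
all: have X12 : X1 :&: X2 = set0 by apply/setP => w; rewrite !inE;
  apply/negP => /andP[/H1[tw sD] /H2[_ /disjointFr dis]];
  have [s sw] := tok_labels_ex tw; have := dis _ sw; rewrite (subsetP sD).
  by rewrite /= -cardsUI X12 cards0 addn0.
rewrite /=; have [Y YX ->] := induced_ex (link_rank j) (children j) (X1 :|: X2).
have le1 := induced_le (link_rank j) (children j) (subsetIr Y X1).
have le2 := induced_le (link_rank j) (children j) (subsetIr Y X2).
have le : link_rank j (nbrs (children j) (Y :&: X1)) +
    link_rank j (nbrs (children j) (Y :&: X2)) <= link_rank j (nbrs (children j) Y).
  rewrite -{3}(setIidPl YX) setIUr nbrsU; apply: IH.
  - move=> w' /nbrsP[w]; rewrite inE => /andP[_ /H1[]].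
    case: w => [y yj sD wy|[]//]; have [x [_ _ _ tw]] := childrenP yj wy; split=> //.
    exact: subset_trans (children_labels yj wy) sD.
  - move=> w' /nbrsP[w]; rewrite inE => /andP[_ /H2[]].
    case: w => [y yj sD wy|[]//]; have [x [_ _ _ tw]] := childrenP yj wy; split=> //.
    exact: disjointWl (children_labels yj wy) sD.
have : #|X1 :\: (Y :&: X1)| + #|X2 :\: (Y :&: X2)| <= #|(X1 :|: X2) :\: Y|.
  rewrite -cardsUI (_ : (X1 :\: _) :&: (X2 :\: _) = set0) ?cards0 ?addn0; last first.
    apply/setP => w; have /setP/(_ w) := X12; rewrite !inE.
    by case: (w \in X1); case: (w \in X2); rewrite ?andbF.
  apply: subset_leq_card; apply/subsetP => w; rewrite !inE.
  by case: (w \in Y); case: (w \in X1); case: (w \in X2).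
by move: le le1 le2; clear; lia.
Qed.

(* By unwinding the ranks with Rado's theorem, one level at a time. *)
Lemma linked_legs j (X : {set token G}) : (forall w, w \in X -> is_token j w) ->
  link_rank j X = #|X| ->
  exists (leg : token G -> {set G}) (stop : token G -> G),
  [/\ forall w, w \in X -> stop w \in tok_labels j w,
    forall w, w \in X -> leg w \subset reach j :\: T,
    forall w w', w \in X -> w' \in X -> w != w' -> [disjoint leg w & leg w'] &
    forall y, inl y \in X -> y \in leg (inl y) /\ linked (leg (inl y)) y (stop (inl y))].
Proof.
elim: j X => [|j IH] X tX.
  (* Legs are empty at level 0, which lets many of them stop at the same vertex of [S]. The value
     [s0] is a default: no [inl] is a token of level 0. *)
  move=> _; exists (fun=> set0), (fun w => if w is inr (s, _) then s else s0).
  split=> [w /tX|w _|w w' _ _ _|y /tX//]; rewrite ?sub0set //.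
  - by case: w => // -[s x] _; rewrite inE.
  - by rewrite disjoints_subset sub0set.
move=> rX; have [f [fI fC rf]] := induced_transversal (link_rankP j) rX.
have cf := card_in_imset fI.
have tXy w : w \in X -> exists2 y, w = inl y & y \in level j.+1.
  by move/tX; case: w => [y yj|[]//]; exists y.
have [|leg [stop [sl ls ld lc]]] := IH (f @: X) _ (etrans rf (esym cf)).
  move=> _ /imsetP[w wX ->]; have [y Ew yj] := tXy _ wX.
  by have := fC _ wX; rewrite Ew => /(childrenP yj)[x []].
have fX w : w \in X -> f w \in f @: X by exact: imset_f.
exists (fun w => if w is inl y then y |: leg (f w) else set0), (fun w => stop (f w)); split.
- move=> w wX; have [y Ew yj] := tXy _ wX; have := fC _ wX; rewrite Ew => fy.
  apply: (subsetP (children_labels yj fy)); rewrite -Ew; apply: sl; exact: fX.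
- move=> w wX; have [y Ew yj] := tXy _ wX; rewrite {1}Ew subUset sub1set inE.
  rewrite (levelS_notT yj) level_reach //=; apply: subset_trans (ls _ (fX _ wX)) _.
  by apply: setSD; exact: reachS.
- move=> w w' wX w'X ww'; have [y Ew yj] := tXy _ wX; have [y' Ew' yj'] := tXy _ w'X.
  subst w w'; have fww' : f (inl y) != f (inl y') by apply: contraNneq ww' => /fI ->.
  have dis := ld _ _ (fX _ wX) (fX _ w'X) fww'.
  have out w v : v \in level j.+1 -> w \in X -> v \notin leg (f w).
    rewrite in_setD => /andP[vj _] /fX/ls/subsetP sub; apply/negP => /sub.
    by rewrite inE (negPf vj) andbF.
  have yy' : y != y' by apply: contraNneq ww' => ->.
  rewrite -setI_eq0; apply/eqP/setP => z; rewrite !inE.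
  apply/negP => /andP[/orP[/eqP->|zl] /orP[/eqP E|zl']].
  + by rewrite E eqxx in yy'.
  + by move: zl'; apply/negP; exact: out.
  + by move: zl; rewrite E; apply/negP; exact: out.
  + by have := disjointFr dis zl; rewrite zl'.
- move=> y yX; have [y1 [<-] yj] := tXy _ yX; rewrite !inE eqxx; split=> //.
  have [x [xj xy fw _]] := childrenP yj (fC _ yX).
  have fwX := fX _ yX; case: j {IH rX tX rf fC tXy} xj fw sl ls ld lc yj => [|j] xj fw sl ls ld lc yj.
    exists [::] => //=; rewrite andbT; have := sl _ fwX; rewrite fw inE => /eqP->.
    by rewrite edge_sym.
  rewrite fw in fwX *; have [xl [p xp pl]] := lc _ fwX.
  exists (x :: p); first by rewrite /= edge_sym xy.
  by move=> z; rewrite !inE => /orP[/eqP->|/pl ->]; rewrite ?xl orbT.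
Qed.

(** * Size and expansion of the color classes of tokens *)

Lemma mem_vclass x y : (y \in vclass x) = (pcol y y == pcol x x).
Proof. by rewrite inE. Qed.

Definition tclass (w : token G) : {set token G} := match w with
  | inl y => [set inl y' | y' in vclass y]
  | inr (s, x) => [set inr p | p in [set p | pcol p.1 p.2 == pcol s x]] end.

Lemma mem_tclass_inl x y : (inl x \in tclass (inl y)) = (pcol x x == pcol y y).
Proof. by rewrite mem_imset ?inE // => u v []. Qed.

Lemma mem_tclass_inr (p q : G * G) :
  (inr p \in tclass (inr q)) = (pcol p.1 p.2 == pcol q.1 q.2).
Proof. by case: q => s x; rewrite mem_imset ?inE // => u v []. Qed.

Variable J : nat.
Hypothesis monos : forall j y, j <= J -> y \in level j -> mono j y.

(** Count label incidences between [S] and the class of [y]: each vertex of [S] labels more than [t]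
    vertices, by the valency of a pair outside a closure, and each vertex carries fewer than [h]
    labels. At level 0 the valency alone gives [n * t] arcs. *)
Lemma tclass_size j w : j <= J -> is_token j w -> n * t <= h * #|tclass w|.
Proof.
move=> jJ; case: w j jJ => [y|[s x]] [|j] jJ //.
  move=> yj; have [s sy] := labels_ex (j := j.+1) yj.
  rewrite /tclass card_imset; last by move=> ? ? [].
  have sS := labels_S yj sy; have sT := label_T sS.
  have yN := notin_cl sT (levelS_notT yj).
  apply: (@leq_trans (\sum_(s' in S) #|[set y' in vclass y | s' \in labels j.+1 y']|)).
    rewrite -sum_nat_const; apply: leq_sum => s'; rewrite inE => s's.
    have E : pcol s' s' = pcol s s by move: sS s's; rewrite inE => /eqP-> /eqP.
    have -> : #|[set y' in vclass y | s' \in labels j.+1 y']| =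
        #|[set y' in vclass y | s \in labels j.+1 y']|.
      apply: (wcol_card E) => d d' E1 E2 E3; rewrite !mem_vclass (wcol_a E1).
      by congr (_ && _); exact: (labels_inv _ E1).
    apply: ltnW; apply: leq_trans (cl_valency yN) _.
    apply: subset_leq_card; apply/subsetP => y'; rewrite in_set => /eqP E1.
    by rewrite in_set mem_vclass (wcol_b E1) eqxx (labels_inv _ (wcol_ba E1)).
  rewrite -(sum_card_rel _ _ (fun y' s' => s' \in labels j.+1 y')) mulnC -sum_nat_const.
  apply: leq_sum => y'; rewrite mem_vclass => /eqP E.
  have y'j : y' \in level j.+1 by rewrite (level_inv _ E).
  apply: leq_trans (ltnW (mono_card y'j (monos jJ y'j))).
  by apply: subset_leq_card; apply/subsetP => s'; rewrite in_set => /andP[].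
move=> /andP[sS xs]; rewrite /tclass card_imset; last by move=> ? ? [].
apply: leq_trans (leq_pmull _ h_gt0); rewrite (card_pairs (fun a b => pcol a b == pcol s x)).
rewrite (bigID (mem S)) /= -[leqLHS]addn0; apply: leq_add => //.
rewrite -sum_nat_const; apply: leq_sum => s' s'S.
have E : pcol s' s' = pcol s s by move: sS s'S; rewrite !inE => /eqP-> /eqP.
apply: ltnW; apply: leq_trans (cl_valency xs) _; rewrite leq_eqVlt; apply/orP; left.
by apply/eqP/esym; apply: (wcol_card E) => d d' E1 E2 E3; rewrite (wcol_ba E1).
Qed.

(** Colors make the relation between parents and children biregular on a pair of token classes. *)
Lemma children_expansion j y w' : y \in level j.+1 -> w' \in children j (inl y) ->
  forall X : {set token G}, X \subset tclass (inl y) ->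
  #|X| * #|tclass w'| <= #|nbrs (children j) X :&: tclass w'| * #|tclass (inl y)|.
Proof.
move=> yj /(childrenP yj)[x [xj xy -> _]] X XA.
have tok_inj y1 : injective (tok j y1) by move=> u v; case: (j) => [|i] [].
have chE y1 x1 : (tok j y1 x1 \in children j (inl y1)) = (x1 \in level j) && edge x1 y1.
  by rewrite /children mem_imset // inE.
pose D1 y1 := [set x1 | [&& x1 \in level j, edge x1 y1 & tok j y1 x1 \in tclass (tok j y x)]].
have -> : nbrs (children j) X :&: tclass (tok j y x) =
    [set w2 in tclass (tok j y x) | [exists w1 in X, w2 \in children j w1]].
  apply/setP => w2; rewrite !inE andbC; congr (_ && _).
  by apply/nbrsP/existsP => -[w1]; [move=> ? ?; exists w1; apply/andP|case/andP; exists w1].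
apply: (biregular_expansion (d := #|D1 y|)
  (d' := #|[set w1 in tclass (inl y) | tok j y x \in children j w1]|)) XA.
- move=> _ /imsetP[y1 y1y ->].
  have -> : [set w2 in tclass (tok j y x) | w2 \in children j (inl y1)] = tok j y1 @: D1 y1.
    apply/setP => w2; apply/idP/imsetP => [|[x1]].
      rewrite inE => /andP[w2t w2c]; have /imsetP[x1] := w2c; rewrite inE => /andP[x1j x1y] E.
      by exists x1; rewrite // inE x1j x1y -E.
    by rewrite !inE => /and3P[x1j x1y tx] ->; rewrite tx chE x1j.
  rewrite card_imset //; move: y1y; rewrite inE => /eqP E.
  apply: (wcol_card E) => d d' E1 E2 E3; rewrite (level_inv j (wcol_a E1)) (wcol_edge E1).
  congr [&& _, _ & _]; case: (j) => [|i]; first by rewrite !mem_tclass_inr /= (wcol_ab E1).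
  by rewrite !mem_tclass_inl (wcol_a E1).
- case: j @D1 xj yj tok_inj chE {X} => [|j] D1 xj yj tok_inj chE.
    move=> w2 /imsetP[[x2 y2]]; rewrite inE => /= /eqP E2 ->.
    (* An arc is a child of its own outer end alone, so at level 0 the second degree is 1. *)
    have F x1 y1 : pcol x1 y1 = pcol x y ->
        [set w1 in tclass (inl y) | inr (x1, y1) \in children 0 w1] = [set inl y1].
      move=> E; apply/setP => w1; rewrite !inE; apply/andP/eqP => [[+ +]|->].
        case/imsetP => y3 _ ->; case/imsetP => x3 _ [_ ->] //.
      rewrite mem_tclass_inl (wcol_b E); split=> //; apply/imsetP; exists x1 => //.
      rewrite inE (wcol_edge E) xy andbT; exact: etrans (level_inv 0 (wcol_a E)) xj.
    by rewrite (F _ _ E2) (F x y) // !cards1.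
  move=> w2 /imsetP[x2]; rewrite inE => /eqP E ->.
  have F x1 : [set w1 in tclass (inl y) | inl x1 \in children j.+1 w1] =
      inl @: [set y1 in vclass y | (x1 \in level j.+1) && edge x1 y1].
    apply/setP => w1; apply/idP/imsetP => [|[y1]].
      rewrite inE => /andP[/imsetP[y1 y1y ->] /imsetP[x3]]; rewrite inE => /andP[x3j x3y] [->].
      by exists y1; rewrite // inE y1y x3j.
    rewrite in_set => /and3P[y1y x1j x1y] ->; rewrite in_set; apply/andP; split.
      exact: imset_f.
    by rewrite -[inl x1]/(tok j.+1 y1 x1) chE x1j.
  rewrite !F !card_imset; [|by move=> ? ? []..].
  apply: (wcol_card E) => d d' E1 E2 E3; rewrite !mem_vclass (wcol_a E1) (wcol_edge E2).
  by rewrite (level_inv j.+1 E).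
- by apply/card_gt0P; exists x; rewrite inE xj xy; case: (j) => [|i];
    rewrite ?mem_tclass_inr ?mem_tclass_inl eqxx.
Qed.

(** At level 0 the size of the class suffices. Above, the minimizing set [Y] is traded for its
    children, whose share is no smaller by expansion, and [X :\: Y] is paid for by the size of the
    class. So an already routed family exhausts only a small share of each token class. *)
Lemma token_mass j w (X : {set token G}) : j <= J -> is_token j w ->
  n * t * #|X :&: tclass w| <= h * link_rank j X * #|tclass w|.
Proof.
elim: j w X => [|j IH] w X jJ tw; have szw := tclass_size jJ tw.
  have le : #|X :&: tclass w| <= #|X| by apply: subset_leq_card; exact: subsetIl.
  by rewrite [leqRHS]mulnAC; exact: leq_mul.
have [y Ew] : exists y, w = inl y by case: w tw {szw} => [y|[s x]] //; exists y.
subst w; have yj : y \in level j.+1 by [].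
rewrite [link_rank _ _]/=; have [Y YX ->] := induced_ex (link_rank j) (children j) X.
have [x xj xy] := levelS_ex yj; pose w' := tok j y x.
have w'c : w' \in children j (inl y) by apply: imset_f; rewrite inE xj.
have [_ [_ _ _ tw']] := childrenP yj w'c.
have ex := children_expansion yj w'c (subsetIr Y _).
have := IH w' (nbrs (children j) Y) (ltnW jJ) tw'.
set A := tclass (inl y) in szw ex *; set B := tclass w' in ex * => mass.
have B_gt0 : 0 < #|B|.
  by apply/card_gt0P; exists w'; rewrite /B /w'; case: (j) => [|i];
    rewrite ?mem_tclass_inr ?mem_tclass_inl eqxx.
have nb : #|nbrs (children j) (Y :&: A) :&: B| <= #|nbrs (children j) Y :&: B|.
  by apply: subset_leq_card; apply: setSI; apply: nbrsS; exact: subsetIl.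
have cX : #|X :&: A| <= #|Y :&: A| + #|X :\: Y|.
  rewrite -[leqLHS](cardsID Y) setIAC (setIidPr YX) leq_add2l; apply: subset_leq_card.
  by rewrite setDE setIAC -setDE subsetIl.
have mY : n * t * #|Y :&: A| <= h * link_rank j (nbrs (children j) Y) * #|A|.
  rewrite -(leq_pmul2r B_gt0) -mulnA; apply: leq_trans (leq_mul (leqnn _) ex) _.
  rewrite mulnA [leqRHS]mulnAC leq_mul2r; apply/orP; right.
  by apply: leq_trans mass; rewrite leq_mul2l nb orbT.
have mXY : n * t * #|X :\: Y| <= h * #|X :\: Y| * #|A|.
  by rewrite [leqRHS]mulnAC leq_mul2r szw orbT.
apply: leq_trans (leq_mul (leqnn _) cX) _.
by rewrite mulnDr mulnDr mulnDl leq_add.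
Qed.

(** * Counting triples of one color *)

(** The stock of candidate routes: [(a, x, x)] stands for a descent from [x] by way of [a], and
    [(a, x, b)] for two descents joined at [x]. Taking all triples of one color makes the counts
    uniform. *)
Definition pieces a x b : {set G * G * G} :=
  [set e | wcol e.1.1 e.1.2 e.2 == wcol a x b].

Lemma mem_pieces a x b a' x' b' :
  ((a', x', b') \in pieces a x b) = (wcol a' x' b' == wcol a x b).
Proof. by rewrite inE. Qed.

Section Counting.
Variables (j : nat) (a0 x0 b0 : G).
Hypotheses (jJ : j <= J) (a0j : a0 \in level j) (x0a0 : j = 0 -> x0 \notin cl t a0).
Let E := pieces a0 x0 b0.

(** Every token of the class starts the same number of triples, so shares of tokens and shares of
    triples agree. *)
Lemma pieces_token_mass (X : {set token G}) :
  n * t * #|[set e in E | tok j e.1.2 e.1.1 \in X]| <= h * link_rank j X * #|E|.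
Proof.
pose w0 := tok j x0 a0; have tw0 : is_token j w0 by exact: is_token_tok.
pose fib w := #|[set e in E | tok j e.1.2 e.1.1 == w]|.
have EB e : e \in E -> tok j e.1.2 e.1.1 \in tclass w0.
  case: e => -[a x] b; rewrite mem_pieces /= /w0 => /eqP Eab; case: (j) => [|i].
    by rewrite mem_tclass_inr (wcol_ab Eab).
  by rewrite mem_tclass_inl (wcol_a Eab).
have fibE w : w \in tclass w0 -> fib w = fib w0.
  rewrite /w0 /fib; case: (j) => [|i].
    have F a x : #|[set e in E | tok 0 e.1.2 e.1.1 == inr (a, x)]| =
        #|[set b | wcol a x b == wcol a0 x0 b0]|.
      rewrite -(card_imset _ (_ : injective (fun b => (a, x, b)))); last by move=> ? ? [].
      apply: eq_card => -[[a' x'] b']; rewrite in_set mem_pieces /=.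
      apply/andP/imsetP => [[Eb /eqP[<- <-]]|[b'']].
        by exists b'; rewrite // inE.
      by rewrite inE => Eb [-> -> ->].
    case/imsetP => -[a x]; rewrite inE /= => /eqP Eax ->; rewrite !F.
    by apply: (wcol_card Eax) => d d' _ _ ->.
  have F a : #|[set e in E | tok i.+1 e.1.2 e.1.1 == inl a]| =
      \sum_x #|[set b | wcol a x b == wcol a0 x0 b0]|.
    rewrite -(card_pairs (fun x b => wcol a x b == wcol a0 x0 b0)).
    rewrite -(card_imset _ (_ : injective (fun p => (a, p.1, p.2)))); last by move=> [? ?] [? ?] [-> ->].
    apply: eq_card => -[[a' x'] b']; rewrite in_set mem_pieces /=.
    apply/andP/imsetP => [[Eb /eqP[<-]]|[[x'' b'']]].
      by exists (x', b'); rewrite // inE.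
    by rewrite inE => Eb [-> -> ->].
  case/imsetP => a; rewrite inE => /eqP Ea ->; rewrite !F.
  apply: (wcol_sum Ea) => d d' _ E2 _.
  by apply: (wcol_card (wcol_ab E2)) => f f' _ _ ->.
have cE := card_fibers EB fibE X.
have cE' : #|E| = #|tclass w0| * fib w0.
  have := card_fibers EB fibE setT; rewrite setTI => <-; apply: eq_card => e.
  by rewrite !inE andbT.
rewrite cE cE' mulnA [leqRHS]mulnA leq_mul2r token_mass ?orbT //.
Qed.

Lemma pieces_middle x : x \in vclass x0 ->
  #|[set e in E | e.1.2 == x]| * #|vclass x0| = #|E|.
Proof.
move=> xx0; pose fib x := #|[set e in E | e.1.2 == x]|.
have EB (e : G * G * G) : e \in E -> e.1.2 \in vclass x0.
  by case: e => -[a y] b; rewrite mem_pieces mem_vclass => /eqP/wcol_b->.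
have F y : fib y = \sum_a #|[set b | wcol a y b == wcol a0 x0 b0]|.
  rewrite -(card_pairs (fun a b => wcol a y b == wcol a0 x0 b0)).
  rewrite -(card_imset _ (_ : injective (fun p => (p.1, y, p.2)))); last by move=> [? ?] [? ?] [-> ->].
  apply: eq_card => -[[a' x'] b']; rewrite in_set mem_pieces /=.
  apply/andP/imsetP => [[Eb /eqP <-]|[[a'' b'']]].
    by exists (a', b'); rewrite // inE.
  by rewrite inE => Eb [-> -> ->].
have fibE y : y \in vclass x0 -> fib y = fib x.
  rewrite mem_vclass => /eqP Ey; rewrite !F; apply: (@wcol_sum _ _ _ y y y x x x).
    by move: xx0; rewrite mem_vclass => /eqP; rewrite -Ey.
  by move=> d d' E1 E2 E3; apply: (wcol_card E1) => f f' F1 F2 F3; rewrite F3.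
rewrite mulnC; have := card_fibers EB fibE setT; rewrite setTI => <-.
by apply: eq_card => e; rewrite !inE andbT.
Qed.

Definition label_count s := #|[set e in E | s \in labels j e.1.1]|.

Lemma labels_card_inv a a' : pcol a a = pcol a' a' -> #|labels j a| = #|labels j a'|.
Proof.
move=> Ea; have F c : #|labels j c| = #|[set s | s \in labels j c]|.
  by apply: eq_card => s; rewrite inE.
by rewrite !F; apply: (wcol_card Ea) => d d' _ E2 _; exact: (labels_inv _ (wcol_ab E2)).
Qed.

Lemma piece_first e : e \in E -> pcol e.1.1 e.1.1 = pcol a0 a0.
Proof. by case: e => -[a x] b; rewrite mem_pieces => /eqP/wcol_a. Qed.

(** All [n] vertices of [S] have one color and hence label equally many triples, while each triple
    has [#|labels j a0|] labels at its first entry. *)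
Lemma label_countE s : s \in S -> n * label_count s = #|E| * #|labels j a0|.
Proof.
move=> sS; transitivity (\sum_(s' in S) #|[set e in E | s' \in labels j e.1.1]|).
  rewrite -sum_nat_const; apply: eq_bigr => s' s'S.
  have Es : pcol s s = pcol s' s'.
    by move: sS s'S; rewrite !mem_vclass => /eqP-> /eqP.
  have F c : label_count c =
      \sum_a \sum_x #|[set b | (wcol a x b == wcol a0 x0 b0) && (c \in labels j a)]|.
    rewrite -(card_triples (fun a x b => (wcol a x b == wcol a0 x0 b0) && (c \in labels j a))).
    by apply: eq_card => e; rewrite !in_set.
  rewrite -/(label_count _) !F; apply: (wcol_sum Es) => d d' E1 _ _.
  rewrite (labels_inv j E1); apply: (wcol_sum (wcol_a E1)) => x x' _ E2 _.
  by apply: (wcol_card (wcol_ab E2)) => b b' _ _ ->.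
rewrite -(sum_card_rel _ _ (fun e s' => s' \in labels j e.1.1)) -sum_nat_const.
apply: eq_bigr => e eE; have Ee := piece_first eE.
rewrite -(labels_card_inv Ee); apply: eq_card => s'; rewrite in_set.
case: (boolP (s' \in labels j e.1.1)) => s'e; rewrite ?andbF // andbT.
by apply: labels_S s'e; rewrite (level_inv _ Ee).
Qed.

Lemma label_in_S s e : e \in E -> s \in labels j e.1.1 -> s \in S.
Proof. by move=> /piece_first Ee; apply: labels_S; rewrite (level_inv _ Ee). Qed.

(** More than [t] vertices have the color of [x] relative to [s], and the triples labelled by [s]
    are spread evenly over them as middle vertices. *)
Lemma label_middle_count s x : x0 = b0 -> x \notin cl t s ->
  n * t * #|[set e in E | (s \in labels j e.1.1) && (e.1.2 == x)]| <= #|E| * #|labels j a0|.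
Proof.
move=> xb xs; have [sS|sNS] := boolP (s \in S); last first.
  suff -> : [set e in E | (s \in labels j e.1.1) && (e.1.2 == x)] = set0 by rewrite cards0 muln0.
  apply/setP => e; rewrite in_set0; apply/negP; rewrite in_set => /and3P[eE sa _].
  by rewrite (label_in_S eE sa) in sNS.
rewrite -(label_countE sS) -mulnA leq_mul2l; apply/orP; right.
pose A := [set x' | pcol s x' == pcol s x].
pose M x' := #|[set e in E | (s \in labels j e.1.1) && (e.1.2 == x')]|.
have M_A x' : x' \in A -> M x' = M x.
  have F y : M y = #|[set a | (wcol a y y == wcol a0 x0 b0) && (s \in labels j a)]|.
    rewrite -(card_imset _ (_ : injective (fun a => (a, y, y)))); last by move=> ? ? [].
    apply: eq_card => -[[a y'] b]; rewrite in_set mem_pieces /=.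
    apply/idP/imsetP => [/and3P[Eab sa /eqP Ey]|[a']].
      have yb : y' = b by have [_ _ + _] := wcol_atoms (eqP Eab); rewrite xb eqxx => /eqP.
      by subst b y'; exists a => //; rewrite in_set Eab.
    by rewrite inE => /andP[Eb sa] [-> -> ->]; rewrite Eb sa eqxx.
  rewrite inE => /eqP Ex; rewrite !F; apply: (wcol_card Ex) => d d' E1 E2 _.
  by rewrite E1 (labels_inv _ (wcol_ba E2)).
have le_t : t <= #|A| by exact: ltnW (cl_valency xs).
apply: leq_trans (leq_mul le_t (leqnn _)) _; rewrite -/(M x) -sum_nat_const.
rewrite -(eq_bigr _ M_A) /M.
have -> : \sum_(x' in A) #|[set e in E | (s \in labels j e.1.1) && (e.1.2 == x')]| =
  \sum_(x' in A) #|[set e in [set e in E | s \in labels j e.1.1] | e.1.2 == x']|.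
  by apply: eq_bigr => x' _; apply: eq_card => e; rewrite !in_set andbA.
rewrite -sum_card_rel /label_count -[leqRHS]sum1_card; apply: leq_sum => e _.
by rewrite -(cards1 e.1.2); apply: subset_leq_card; apply/subsetP => y;
  rewrite !inE => /andP[_ /eqP->].
Qed.

(** The same spreading, over the more than [t] vertices that have the color of [s2] relative to
    [s1]. *)
Lemma label_pair_count s1 s2 : s2 \notin cl t s1 ->
  n * t * #|[set e in E | (s1 \in labels j e.1.1) && (s2 \in labels j e.2)]| <=
  #|E| * (#|labels j a0| * #|labels j b0|).
Proof.
move=> s12; have [sS|sNS] := boolP (s1 \in S); last first.
  suff -> : [set e in E | (s1 \in labels j e.1.1) && (s2 \in labels j e.2)] = set0.
    by rewrite cards0 muln0.
  apply/setP => e; rewrite in_set0; apply/negP; rewrite in_set => /and3P[eE sa _].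
  by rewrite (label_in_S eE sa) in sNS.
rewrite mulnA -(label_countE sS) -!mulnA leq_mul2l; apply/orP; right.
pose A := [set s' | pcol s1 s' == pcol s1 s2].
pose M s' := #|[set e in E | (s1 \in labels j e.1.1) && (s' \in labels j e.2)]|.
have M_A s' : s' \in A -> M s' = M s2.
  have F c : M c = \sum_a \sum_b #|[set x | [&& wcol a x b == wcol a0 x0 b0,
      s1 \in labels j a & c \in labels j b]]|.
    rewrite -(card_triples_mid (fun a x b => [&& wcol a x b == wcol a0 x0 b0,
      s1 \in labels j a & c \in labels j b])).
    by apply: eq_card => e; rewrite !in_set.
  rewrite inE => /eqP Es; rewrite !F; apply: (wcol_sum Es) => a a' E1 E2 _.
  rewrite (labels_inv j (wcol_ba E2)).
  apply: (wcol_sum E2) => b b' F1 _ F3; rewrite (labels_inv j (wcol_ac F1)).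
  by apply: (wcol_card (wcol_bc F3)) => y y' _ -> _.
have le_t : t <= #|A| by exact: ltnW (cl_valency s12).
apply: leq_trans (leq_mul le_t (leqnn _)) _; rewrite -/(M s2) -sum_nat_const.
rewrite -(eq_bigr _ M_A) /M.
have -> : \sum_(s' in A) #|[set e in E | (s1 \in labels j e.1.1) && (s' \in labels j e.2)]| =
  \sum_(s' in A) #|[set e in [set e in E | s1 \in labels j e.1.1] | s' \in labels j e.2]|.
  by apply: eq_bigr => x' _; apply: eq_card => e; rewrite !in_set andbA.
rewrite -(sum_card_rel _ _ (fun e s' => s' \in labels j e.2)) /label_count -sum_nat_const.
apply: leq_sum => e; rewrite in_set => /andP[eE _].
have Eb : pcol e.2 e.2 = pcol b0 b0.
  by move: eE; case: e => -[a x] b; rewrite mem_pieces => /eqP/wcol_c.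
rewrite -(labels_card_inv Eb); apply: subset_leq_card; apply/subsetP => s'.
by rewrite in_set => /andP[].
Qed.

(** Above level 0 the middle vertex may itself be the start of a descent; this serves an edge inside
    one level. *)
Definition near x a := edge a x || (0 < j) && (x == a).

Lemma near_attachments x a s s' : x \notin T -> a \in level j -> near x a ->
  s \in T -> s' \in labels j a -> s' \in cl t s -> s' \in attachments t s x.
Proof.
move=> xT aj xa sT s'a s's; case/orP: xa => [ax|/andP[j_gt0 /eqP E']].
  exact: (labels_attachments sT aj s'a s's (notin_cl sT xT) ax).
subst a; case: (j) j_gt0 aj s'a => // i _ aj s'a.
have [y' sy' yy'] := labels_connect aj s'a; rewrite inE s's.
by apply/existsP; exists y'; rewrite sy' connect_notT.
Qed.

Lemma near_connect x a s s' : x \notin T -> a \in level j -> near x a ->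
  s \in T -> s' \in labels j a -> s' \notin cl t s -> connect (inside (~: cl t s)) x s'.
Proof.
move=> xT aj xa sT s'a s's; have xs := notin_cl sT xT.
have main i : a \in level i.+1 -> s' \in labels i.+1 a -> connect (inside (~: cl t s)) a s'.
  move=> ai s'i; have [y' sy' yy'] := labels_connect ai s'i.
  apply: connect_trans (connect_notT sT yy') (connect1 _).
  rewrite /= !in_setC s's edge_sym sy' andbT notin_cl //.
  have := connect_invariant (P := fun z => z \notin T) _ _ yy'; apply.
    exact: levelS_notT ai.
  by move=> u v _ /and3P[_]; rewrite in_setC.
case/orP: xa => [ax|/andP[j_gt0 /eqP E']]; last first.
  by subst a; case: (j) j_gt0 aj s'a => // i _; exact: main.
case: (j) aj s'a main => [|i] aj s'a main.
  move: s'a; rewrite inE => /eqP E'; subst s'; apply: connect1.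
  by rewrite /= !in_setC xs s's edge_sym.
apply: connect_trans (connect1 _) (main i aj s'a).
by rewrite /= !in_setC xs edge_sym ax notin_cl ?(levelS_notT aj).
Qed.

Lemma attachments_connect s x x' : connect (inside (~: cl t s)) x x' ->
  attachments t s x = attachments t s x'.
Proof.
move=> xx'; apply/setP => w; rewrite !in_set; congr (_ && _).
apply: eq_existsb => y; congr (_ && _).
exact: (same_connect (sym_connect_sym (@inside_sym _ _)) xx').
Qed.

Lemma piece_level e : e \in E -> e.1.1 \in level j.
Proof. by move/piece_first/level_inv->. Qed.

Lemma same_block a s s' : a \in level j -> s \in labels j a -> s' \in labels j a ->
  s' \in cl t s.
Proof. by move=> aj sa s'a; have /monoP := monos jJ aj; apply. Qed.

Lemma block_shared a a' s s1 s' : a \in level j -> a' \in level j ->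
  s \in labels j a -> s1 \in labels j a -> s1 \in labels j a' -> s' \in labels j a' ->
  s' \in cl t s.
Proof.
move=> aj a'j sa s1a s1a' s'a'; have sT := label_T (labels_S aj sa).
have [s1T <-] := T_cl sT (same_block aj sa s1a); exact: same_block s1a' s'a'.
Qed.

(** Triples that might be routed to the same pair of ends as [e], a pair that the auxiliary graph
    counts only once. *)
Definition branch_conflicts (e : G * G * G) := [set e' in E | (e'.1.2 == e.1.2) &&
  ~~ [disjoint labels j e.1.1 & labels j e'.1.1]].

(** All labels of a conflicting triple lie in the block of those of [e] and attach to it at [x], so
    fewer than [h] labels occur; each is charged by [label_middle_count]. Every conflict is charged
    once per label, which cancels [#|labels j a0|]. *)
Lemma card_branch_conflicts e : x0 = b0 ->
  (forall e', e' \in E -> edge e'.1.1 e'.1.2 /\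
    forall s, s \in labels j e'.1.1 -> e'.1.2 \notin cl t s) ->
  e \in E -> n * t * #|branch_conflicts e| <= h * #|E|.
Proof.
move=> xb HE eE; have [_ xN] := HE _ eE; have aj := piece_level eE.
have [s sa] := labels_ex aj; set x := e.1.2 in xN *.
have sT := label_T (labels_S aj sa); have xs := xN _ sa.
pose A := attachments t s x; have cA := cl_attachments h_gt0 G_excl t_big xs.
set f := #|labels j a0|.
have f_gt0 : 0 < f by have [s' s'a] := labels_ex a0j; apply/card_gt0P; exists s'.
rewrite -(leq_pmul2r f_gt0) -!mulnA [_ * f]mulnC.
have -> : f * #|branch_conflicts e| = \sum_(e' in branch_conflicts e) #|[set s' in A | s' \in labels j e'.1.1]|.
  rewrite mulnC -sum_nat_const; apply: eq_bigr => e'; rewrite in_set => /and3P[e'E /eqP xe' sh].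
  have a'j := piece_level e'E; rewrite /f -(labels_card_inv (piece_first e'E)).
  apply: eq_card => s'; rewrite in_set; case: (boolP (s' \in labels j e'.1.1)) => s'a'; rewrite ?andbF // andbT.
  have /pred0Pn[s1 /andP[s1a s1a']] := sh.
  have s's : s' \in cl t s by exact: (block_shared aj a'j sa s1a s1a' s'a').
  have [e'x _] := HE _ e'E; rewrite xe' in e'x.
  by apply/esym; exact: (labels_attachments sT a'j s'a' s's xs e'x).
rewrite sum_card_rel.
apply: (@leq_trans (\sum_(s' in A) #|E| * f)); last first.
  by rewrite sum_nat_const leq_mul2r (ltnW cA) orbT.
rewrite mulnA big_distrr /=; apply: leq_sum => s'; rewrite in_set => /andP[s's _].
apply: (leq_trans _ (label_middle_count (s := s') (x := x) xb _)); last first.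
  by have [_ ->] := T_cl sT s's.
rewrite leq_mul2l; apply/orP; right; apply: subset_leq_card.
apply/subsetP => e'; rewrite !in_set => /andP[/and3P[-> -> _] ->]; done.
Qed.

Definition conflicts (e : G * G * G) := [set e' in E |
  ~~ [disjoint labels j e.1.1 & labels j e'.1.1] &&
  ~~ [disjoint labels j e.2 & labels j e'.2]].

(** As for branches, with pairs of labels, hence [h * h]. The middle vertices may now differ; but a
    label shared on one side lies outside the closure on the other side and connects both middle
    vertices there, so their attachments coincide. *)
Lemma card_conflicts e : b0 \in level j ->
  (forall e', e' \in E -> [/\ e'.1.2 \notin T, near e'.1.2 e'.1.1, near e'.1.2 e'.2 &
    forall s1 s2, s1 \in labels j e'.1.1 -> s2 \in labels j e'.2 -> s2 \notin cl t s1]) ->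
  e \in E -> n * t * #|conflicts e| <= h * h * #|E|.
Proof.
move=> b0j HE eE; have [xT xa xb ineq] := HE _ eE; have aj := piece_level eE.
have second e' : e' \in E -> pcol e'.2 e'.2 = pcol b0 b0.
  by case: e' => -[a x] b; rewrite mem_pieces => /eqP/wcol_c.
have blev e' : e' \in E -> e'.2 \in level j by move/second/level_inv->.
have bj := blev _ eE.
have [s1 s1a] := labels_ex aj; have [s2 s2b] := labels_ex bj.
have s1T := label_T (labels_S aj s1a); have s2T := label_T (labels_S bj s2b).
set x := e.1.2 in xT xa xb.
pose A1 := attachments t s1 x; pose A2 := attachments t s2 x.
have cA1 := cl_attachments h_gt0 G_excl t_big (notin_cl s1T xT).
have cA2 := cl_attachments h_gt0 G_excl t_big (notin_cl s2T xT).
set f := #|labels j a0| * #|labels j b0|.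
have f_gt0 : 0 < f.
  have [s' s'a] := labels_ex a0j; have [s'' s''b] := labels_ex b0j.
  by rewrite muln_gt0; apply/andP; split; apply/card_gt0P; [exists s'|exists s''].
rewrite -(leq_pmul2r f_gt0) -!mulnA [_ * f]mulnC.
have s2s1 : s2 \notin cl t s1 by exact: ineq.
have s1s2 : s1 \notin cl t s2 by apply: contra s2s1 => /(cl_sym s2T).
have -> : f * #|conflicts e| = \sum_(e' in conflicts e)
    #|[set p in setX A1 A2 | (p.1 \in labels j e'.1.1) && (p.2 \in labels j e'.2)]|.
  rewrite mulnC -sum_nat_const; apply: eq_bigr => e'; rewrite in_set => /and3P[e'E sha shb].
  have a'j := piece_level e'E; have b'j := blev _ e'E.
  have [x'T x'a' x'b' ineq'] := HE _ e'E.
  have /pred0Pn[u /andP[/= ua ua']] := sha; have /pred0Pn[v /andP[/= vb vb']] := shb.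
  have us1 : u \in cl t s1 by exact: same_block aj s1a ua.
  have vs2 : v \in cl t s2 by exact: same_block bj s2b vb.
  have E1 : attachments t s1 x = attachments t s1 e'.1.2.
    apply: attachments_connect; apply: (connect_trans (y := v)).
      exact: (near_connect xT bj xb s1T vb (ineq _ _ s1a vb)).
    rewrite (sym_connect_sym (@inside_sym _ _)).
    exact: (near_connect x'T b'j x'b' s1T vb' (ineq _ _ s1a vb)).
  have E2 : attachments t s2 x = attachments t s2 e'.1.2.
    have us2 : u \notin cl t s2.
      apply: contra s2s1 => us2; have [_ <-] := T_cl s1T us1.
      exact: cl_sym us2.
    apply: attachments_connect; apply: (connect_trans (y := u)).
      exact: (near_connect xT aj xa s2T ua us2).
    rewrite (sym_connect_sym (@inside_sym _ _)).
    exact: (near_connect x'T a'j x'a' s2T ua' us2).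
  rewrite /f -(labels_card_inv (piece_first e'E)) -(labels_card_inv (second _ e'E)) -cardsX.
  apply: eq_card => -[p q]; rewrite in_set !in_setX /=.
  case: (boolP (p \in labels j e'.1.1)) => pa'; rewrite ?andbF //.
  case: (boolP (q \in labels j e'.2)) => qb'; rewrite ?andbF //= andbT.
  have ps1 : p \in cl t s1 by exact: (block_shared aj a'j s1a ua ua' pa').
  have qs2 : q \in cl t s2 by exact: (block_shared bj b'j s2b vb vb' qb').
  apply/esym/andP; split.
    by rewrite /A1 E1; exact: (near_attachments x'T a'j x'a' s1T pa' ps1).
  by rewrite /A2 E2; exact: (near_attachments x'T b'j x'b' s2T qb' qs2).
rewrite sum_card_rel.
apply: (@leq_trans (\sum_(p in setX A1 A2) #|E| * f)); last first.
  by rewrite sum_nat_const cardsX [leqRHS]mulnA leq_mul2r leq_mul ?orbT // ltnW.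
rewrite mulnA big_distrr /=; apply: leq_sum => -[p q]; rewrite in_setX => /andP[] /=.
rewrite in_set => /andP[ps1 _]; rewrite in_set => /andP[qs2 _].
apply: (leq_trans _ (label_pair_count (s1 := p) (s2 := q) _)); last first.
  have [_ ->] := T_cl s1T ps1; apply: contra s2s1 => qs1.
  have [_ <-] := T_cl s1T qs1; exact: cl_sym qs2.
rewrite leq_mul2l; apply/orP; right; apply: subset_leq_card.
by apply/subsetP => e'; rewrite !in_set => /andP[/andP[-> _] ->].
Qed.

End Counting.

Variables (R : realType) (al : R).
Hypotheses (al_adeg : is_adeg al) (t_ge : (144%:R * al ^+ 2 * h%:R ^+ 5 <= t%:R :> R)%R).

Let A := (al * h%:R ^+ 2)%R.

Lemma A_ge2 : (2 <= A)%R.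
Proof.
have [al2 _] := al_adeg; rewrite /A -[leLHS]mulr1; apply: ler_pM => //.
by rewrite -natrX ler1n expn_gt0 h_gt0.
Qed.

Lemma t_geA : (144%:R * A ^+ 2 * h%:R <= t%:R :> R)%R.
Proof.
apply: le_trans _ t_ge; rewrite /A le_eqVlt; apply/orP; left; apply/eqP; ring.
Qed.

Lemma token_linked j (leg : token G -> {set G}) (stop : token G -> G) x a :
  stop (tok j x a) \in tok_labels j (tok j x a) ->
  (forall y, inl y = tok j x a -> y \in leg (inl y) /\ linked (leg (inl y)) y (stop (inl y))) ->
  near j x a -> linked (leg (tok j x a)) x (stop (tok j x a)).
Proof.
case: j => [|j] /=.
  rewrite inE => /eqP-> _; rewrite /near /= orbF => ax; exists [::] => //=.
  by rewrite edge_sym ax.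
move=> _ /(_ a erefl)[al' la]; rewrite /near /= => /orP[ax|/eqP-> //].
by apply: linked_cons la; rewrite // edge_sym.
Qed.

Lemma n_gt0 : 0 < n.
Proof. by apply/card_gt0P; exists s0; rewrite mem_vclass. Qed.

Lemma token_block j1 w s : j1 <= J -> is_token j1 w -> s \in tok_labels j1 w ->
  forall s', s' \in tok_labels j1 w -> s' \in cl t s.
Proof.
case: w j1 => [y|[u x]] [|j1] // j1J tw sw s' s'w.
  exact: (same_block (j := j1.+1) j1J tw sw s'w).
by move: sw s'w; rewrite !in_set1 => /eqP-> /eqP->; exact: cl_refl.
Qed.

Lemma token_label_T j1 w s : is_token j1 w -> s \in tok_labels j1 w -> s \in T.
Proof.
case: w j1 => [y|[u x]] [|j1] // tw sw; apply: label_T.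
  exact: (labels_S (j := j1.+1) tw sw).
by move: sw tw; rewrite inE => /eqP-> /andP[].
Qed.

(** In a general matroid two tokens may each extend [X] without doing so jointly. Here their labels
    lie in different blocks, every token of [X] has its labels inside [D] or disjoint from it, and
    the two sides are routed independently. *)
Lemma link_rank_add2 j (X : {set token G}) w1 w2 : j <= J ->
  (forall w, w \in X -> is_token j w) -> is_token j w1 -> is_token j w2 ->
  (forall s1 s2, s1 \in tok_labels j w1 -> s2 \in tok_labels j w2 -> s2 \notin cl t s1) ->
  link_rank j X = #|X| -> link_rank j (w1 |: X) = #|X|.+1 -> link_rank j (w2 |: X) = #|X|.+1 ->
  link_rank j (w1 |: (w2 |: X)) = #|X|.+2.
Proof.
move=> jJ tX t1 t2 sep rX r1 r2; have [s s1] := tok_labels_ex t1.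
have sT := token_label_T t1 s1; pose D := cl t s.
have rP := link_rankP j.
have ind w : link_rank j (w |: X) = #|X|.+1 -> w \notin X /\ link_rank j (w |: X) = #|w |: X|.
  move=> rw; have wX : w \notin X.
    apply/negP => wX; move: rw; rewrite (setUidPr _) ?sub1set // rX; lia.
  by rewrite rw cardsU1 wX.
have [w1X i1] := ind _ r1; have [w2X i2] := ind _ r2.
pose X1 := w1 |: [set w in X | tok_labels j w \subset D].
pose X2 := w2 |: [set w in X | [disjoint tok_labels j w & D]].
have dich w : w \in X -> (tok_labels j w \subset D) || [disjoint tok_labels j w & D].
  move=> wX; case: (boolP [disjoint _ & _]) => [|/pred0Pn[u /andP[/= uw uD]]]; rewrite ?orbT //.
  rewrite orbF; apply/subsetP => v vw; have [_ Ecl] := T_cl sT uD; rewrite /D -Ecl.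
  exact: (token_block jJ (tX _ wX) uw).
have D1 : tok_labels j w1 \subset D by apply/subsetP => u; exact: (token_block jJ t1 s1).
have D2 : [disjoint tok_labels j w2 & D].
  by rewrite disjoints_subset; apply/subsetP => u uw; rewrite inE; exact: sep.
have w12 : w1 != w2.
  by apply: contraTneq (cl_refl t s) => E12; apply: sep; rewrite -?E12.
have EX : X1 :|: X2 = w1 |: (w2 |: X).
  apply/setP => w; rewrite !in_setU !in_set1 !in_set; case: (boolP (w \in X)) => wX.
    by have /orP[->|->] := dich _ wX; rewrite ?andbT /= ?orbT.
  by rewrite !andFb !orbF.
apply/eqP; rewrite eqn_leq; apply/andP; split.
  by apply: leq_trans (rank_le_card rP _) _; rewrite 2!cardsU1 -[leqRHS]/(1 + (1 + #|X|)) !leq_add ?leq_b1.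
have rX1 : link_rank j X1 = #|X1|.
  by apply: rank_independentS i1 _ => //; apply: setUS; apply/subsetP => w; rewrite inE => /andP[].
have rX2 : link_rank j X2 = #|X2|.
  by apply: rank_independentS i2 _ => //; apply: setUS; apply/subsetP => w; rewrite inE => /andP[].
have <- : #|w1 |: (w2 |: X)| = #|X|.+2.
  by rewrite cardsU1 cardsU1 w2X in_setU1 negb_or w12 w1X.
rewrite -EX; apply: leq_trans (leq_card_setU _ _) _; rewrite -rX1 -rX2.
apply: (@link_rank_split j D).
  move=> w; rewrite in_setU1 => /orP[/eqP-> //|]; rewrite inE => /andP[/tX //].
move=> w; rewrite in_setU1 => /orP[/eqP-> //|]; rewrite inE => /andP[/tX //].
Qed.

(** * Too many disjoint paths *)

(* Paths from the class of [x0] down to [S], when this class is not much larger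
   than [S]: the auxiliary graph lives on the union of both classes. *)
Section Branch.
Variables (j : nat) (a0 x0 : G).
Hypotheses (jJ : j <= J) (a0j : a0 \in level j) (a0x0 : edge a0 x0).
Hypothesis x0N : forall s, s \in labels j a0 -> x0 \notin cl t s.
Hypothesis x0R : x0 \notin reach j :\: T.
Hypothesis x0_small : (#|vclass x0|%:R <= 2 * A * n%:R :> R)%R.

Let E := pieces a0 x0 x0.
Let tk (e : G * G * G) := tok j e.1.2 e.1.1.

Let x0a0 : j = 0 -> x0 \notin cl t a0.
Proof. by move=> j0; apply: x0N; rewrite j0 inE. Qed.

Let E_facts e : e \in E -> [/\ e.1.1 \in level j, edge e.1.1 e.1.2,
  forall s, s \in labels j e.1.1 -> e.1.2 \notin cl t s & e.1.2 \in vclass x0].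
Proof.
case: e => -[a x] b; rewrite mem_pieces => /eqP Ee /=; split.
- by rewrite (level_inv _ (wcol_a Ee)).
- by rewrite (wcol_edge Ee).
- have : [forall s, (s \in labels j a) ==> (x \notin cl t s)].
    rewrite (_ : [forall s, _] = [forall s, (s \in labels j a0) ==> (x0 \notin cl t s)]).
      by apply/forallP => s; apply/implyP; exact: x0N.
    apply: (wcol_forall (wcol_ab Ee)) => s s' E1 E2 E3.
    by rewrite (labels_inv j (wcol_ab E2)) (cl_inv t (wcol_ab E1)).
  by move/forallP => H s sa; have := H s; rewrite sa.
- by rewrite mem_vclass (wcol_b Ee).
Qed.

Let tk_token e : e \in E -> is_token j (tk e).
Proof.
move/E_facts=> [ej _ eN _]; apply: is_token_tok => // j0; apply: eN.
by rewrite j0 inE.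
Qed.

(** Full rank makes the descents disjoint; freedom from conflicts makes the pairs of ends
    distinct. *)
Let good (F : {set G * G * G}) := [/\ F \subset E, link_rank j (tk @: F) = #|F| &
  forall e e', e \in F -> e' \in F -> e != e' -> e' \notin branch_conflicts j a0 x0 x0 e].

Let good_inj F : good F -> {in F &, injective tk}.
Proof.
case=> _ rF _; apply/imset_injP; rewrite eqn_leq leq_imset_card -{1}rF.
exact: rank_le_card (link_rankP j) _.
Qed.

(** Blocked are the triples whose token is spanned by the chosen ones and the conflicting triples,
    each a share of at most [h * #|F| / (n * t)]. As [#|F| <= A * (1 + 2 * A) * n], blocking
    everything would force [t <= 2 * h * A * (1 + 2 * A)]. *)
Lemma branch_step F : good F -> (#|F|%:R <= A * #|S :|: vclass x0|%:R)%R ->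
  exists2 e, e \notin F & good (e |: F).
Proof.
case=> FE rF ncF le_k.
pose X := tk @: F :|: [set w | link_rank j (w |: tk @: F) <= #|F|].
have rX : link_rank j X = #|F|.
  by apply: (rank_span (link_rankP j)) => // w; rewrite inE.
pose bad := [set e in E | tk e \in X] :|: \bigcup_(e in F) branch_conflicts j a0 x0 x0 e.
have [/subset_leq_card Ebad|] := boolP (E \subset bad).
  have b1 := pieces_token_mass x0 jJ a0j x0a0 X.
  have b2 : n * t * #|\bigcup_(e in F) branch_conflicts j a0 x0 x0 e| <= #|F| * (h * #|E|).
    apply: (@leq_trans (n * t * \sum_(e in F) #|branch_conflicts j a0 x0 x0 e|)).
      by rewrite leq_mul2l card_bigcup_leq orbT.
    rewrite big_distrr -sum_nat_const /=; apply: leq_sum => e eF.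
    apply: card_branch_conflicts => //; last exact: (subsetP FE).
    by move=> e' /E_facts[].
  exfalso; move: b1; rewrite rX => b1.
  have E_gt0 : 0 < #|E| by apply/card_gt0P; exists (a0, x0, x0); rewrite mem_pieces.
  have : n * t <= 2 * h * #|F|.
    rewrite -(leq_pmul2r E_gt0).
    apply: leq_trans (leq_mul (leqnn _) (leq_trans Ebad (leq_card_setU _ _))) _.
    by rewrite mulnDr; apply: leq_trans (leq_add b1 b2) _; rewrite -/E; nia.
  have LS : (#|S :|: vclass x0|%:R <= n%:R + 2 * A * n%:R :> R)%R.
    apply: le_trans (lerD (lexx _) x0_small); rewrite -natrD ler_nat; exact: leq_card_setU.
  rewrite -(ler_nat R) !natrM; have A2 := A_ge2; have tA := t_geA.
  have n0 : (0 < n%:R :> R)%R by rewrite ltr0n n_gt0.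
  have h0 : (0 < h%:R :> R)%R by rewrite ltr0n.
  apply/negP; rewrite -ltNge.
  have kF : (#|F|%:R <= A * (1 + 2 * A) * n%:R :> R)%R.
    by apply: le_trans le_k _; rewrite -mulrA ler_wpM2l ?mulrDl ?mul1r //; lra.
  apply: le_lt_trans (_ : 2 * h%:R * (A * (1 + 2 * A) * n%:R) < _)%R.
    by rewrite ler_wpM2l // mulr_ge0 // ler0n.
  rewrite [ltRHS]mulrC [ltLHS](_ : _ = (2 * h%:R * (A * (1 + 2 * A))) * n%:R)%R; last by ring.
  rewrite ltr_pM2r //; apply: lt_le_trans tA.
  rewrite [ltLHS](_ : _ = (2 * (A * (1 + 2 * A))) * h%:R)%R; last by ring.
  by rewrite ltr_pM2r //; nra.
case/subsetPn => e eE; rewrite in_setU negb_or => /andP[].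
rewrite in_set eE /= in_setU negb_or in_set -ltnNge => /andP[tkF rk] /bigcupP enc.
have eF : e \notin F by apply: contra tkF; exact: imset_f.
exists e => //; split.
- by rewrite subUset sub1set eE.
- apply/eqP; rewrite imsetU1 cardsU1 eF eqn_leq add1n rk andbT.
  by apply: leq_trans (rank_le_card (link_rankP j) _) _; rewrite cardsU1 -add1n leq_add ?leq_b1 ?leq_imset_card.
have nce e' : e' \in F -> e \notin branch_conflicts j a0 x0 x0 e'.
  by move=> e'F; apply/negP => ?; apply: enc; exists e'.
move=> e1 e2; rewrite !in_setU1 => /orP[/eqP->|e1F] /orP[/eqP->|e2F] ne.
- by rewrite eqxx in ne.
- have := nce _ e2F; rewrite in_set eE in_set (subsetP FE _ e2F) /=.
  by rewrite eq_sym disjoint_sym.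
- exact: nce.
- exact: ncF.
Qed.

Lemma branch_bound F : good F -> (#|F|%:R <= A * #|S :|: vclass x0|%:R)%R.
Proof.
move=> gF; have [FE rF ncF] := gF; have tkI := good_inj gF.
have tX w : w \in tk @: F -> is_token j w by case/imsetP => e eF ->; exact/tk_token/(subsetP FE).
have [|leg [stop [sl ls ld lc]]] := linked_legs tX; first by rewrite rF card_in_imset.
have stopl e : e \in F -> stop (tk e) \in labels j e.1.1.
  by move=> eF; have := sl _ (imset_f tk eF); rewrite tok_labelsE.
pose pr e := (e.1.2, stop (tk e)).
have prI : {in F &, injective pr}.
  move=> e e' eF e'F [Ex Es]; apply/eqP/negPn/negP => ne; have /negP := ncF _ _ eF e'F ne; apply.
  rewrite in_set (subsetP FE _ e'F) -Ex eqxx /=; apply/pred0Pn; exists (stop (tk e)).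
  by rewrite /= stopl //= Es stopl.
pose B x s := \bigcup_(e in F | pr e == (x, s)) leg (tk e).
have BE e : e \in F -> B e.1.2 (stop (tk e)) = leg (tk e).
  move=> eF; rewrite /B (big_pred1 e) // => e'; apply/andP/eqP => [[e'F /eqP/prI->//]|->//].
have [al2 _] := al_adeg.
have := linked_pairs_le al_adeg h_gt0 G_excl (L := S :|: vclass x0) (Q := pr @: F) (B := B).
rewrite card_in_imset // => ->//.
- by apply/set0Pn; exists s0; apply/setUP; left; rewrite inE.
- move=> _ _ /imsetP[e eF [-> ->]]; have eE := subsetP FE _ eF.
  have [ej ee eN ex] := E_facts eE; have aj := ej.
  split.
  + by rewrite in_setU ex orbT.
  + by rewrite in_setU (labels_S ej (stopl _ eF)).
  + by apply: contra (eN _ (stopl _ eF)) => /eqP<-; exact: cl_refl.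
  + rewrite BE //; apply: token_linked; first exact: sl (imset_f tk eF).
      by move=> y Ey; apply: lc; rewrite Ey; exact: (imset_f tk eF).
    by rewrite /near ee.
  (* Legs lie in [reach j :\: T]. This set is determined by colors: it misses [S], which is part of
     [T], and with [x0] it misses the whole class of [x0]. *)
  + rewrite BE // disjoint_sym disjoints_subset; apply/subsetP => z.
    rewrite in_setC => zL; apply/negP => /(subsetP (ls _ (imset_f tk eF))) => zR.
    move: zL; rewrite in_setU => /orP[/label_T zT|].
      by move: zR; rewrite in_setD zT.
    rewrite mem_vclass => /eqP Ez; move: zR.
    by rewrite in_setD (T_inv Ez) (reach_inv j Ez) -in_setD (negPf x0R).
- move=> x s x' s' z /imsetP[e eF [-> ->]] /imsetP[e' e'F [-> ->]].
  rewrite !BE // => ze ze'; suff -> : e' = e by [].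
  apply: tkI => //; apply/eqP/negPn/negP => ne.
  by have := disjointFr (ld _ _ (imset_f tk e'F) (imset_f tk eF) ne) ze'; rewrite ze.
Qed.

Lemma branch_absurd : False.
Proof.
apply: (unbounded_family (good := good) (B := (A * #|S :|: vclass x0|%:R)%R)).
- by split; rewrite ?sub0set ?imset0 ?(rank0 (link_rankP j)) ?cards0 // => e e'; rewrite inE.
- exact: branch_step.
- exact: branch_bound.
Qed.

End Branch.

(* When the class of [x0] is large compared to [S], paths from [S] to [S]
   through distinct vertices of this class. *)
Section Through.
Variables (j : nat) (a0 x0 b0 : G).
Hypotheses (jJ : j <= J) (a0j : a0 \in level j) (b0j : b0 \in level j).
Hypotheses (x0T : x0 \notin T) (xa0 : near j x0 a0) (xb0 : near j x0 b0).
Hypothesis ab0 : forall s1 s2, s1 \in labels j a0 -> s2 \in labels j b0 -> s2 \notin cl t s1.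
Hypothesis x0R : x0 \notin reach j \/ 0 < j /\ x0 = a0.
Hypothesis x0_big : (2 * A * n%:R <= #|vclass x0|%:R :> R)%R.

Let E := pieces a0 x0 b0.
Let tk1 (e : G * G * G) := tok j e.1.2 e.1.1.
Let tk2 (e : G * G * G) := tok j e.1.2 e.2.

Let E_facts e : e \in E -> [/\ e.1.1 \in level j, e.2 \in level j,
  near j e.1.2 e.1.1, near j e.1.2 e.2 &
  forall s1 s2, s1 \in labels j e.1.1 -> s2 \in labels j e.2 -> s2 \notin cl t s1].
Proof.
case: e => -[a x] b; rewrite mem_pieces => /eqP Ee /=.
have near_inv y c y' c' : pcol y c = pcol y' c' -> near j y' c' -> near j y c.
  by move=> Eyc; rewrite /near (edge_sym c) (edge_sym c') (wcol_edge Eyc) (wcol_eq Eyc).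
split.
- by rewrite (level_inv _ (wcol_a Ee)).
- by rewrite (level_inv _ (wcol_c Ee)).
- exact: near_inv (wcol_ba Ee) xa0.
- exact: near_inv (wcol_bc Ee) xb0.
pose sep c d := [forall s1, forall s2,
  (s1 \in labels j c) && (s2 \in labels j d) ==> (s2 \notin cl t s1)].
have : sep a b.
  suff -> : sep a b = sep a0 b0.
    by do 2![apply/forallP => ?]; apply/implyP => /andP[]; exact: ab0.
  apply: (wcol_forall (wcol_ac Ee)) => s s' _ E2 _.
  apply: (wcol_forall E2) => u u' F1 F2 _.
  by rewrite (labels_inv j (wcol_ab E2)) (labels_inv j (wcol_cb F2)) (cl_inv t (wcol_ba F1)).
move=> /forallP ab s1 s2 s1a s2b; have /forallP/(_ s2) := ab s1.
by rewrite s1a s2b.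
Qed.

Let E_mid e : e \in E -> [/\ e.1.2 \notin T, e.1.2 \in vclass x0 &
  e.1.2 \notin reach j \/ 0 < j /\ e.1.2 = e.1.1].
Proof.
case: e => -[a x] b; rewrite mem_pieces => /eqP Ee /=; split.
- by rewrite (T_inv (wcol_b Ee)).
- by rewrite mem_vclass (wcol_b Ee).
case: x0R => [xR|[j_gt0 xa]]; [left|right; split=> //].
  by rewrite (reach_inv j (wcol_b Ee)).
by apply/eqP; rewrite eq_sym (wcol_eq Ee) xa.
Qed.

Let tok_ok c x : c \in level j -> x \notin T -> is_token j (tok j x c).
Proof.
move=> cj xT; apply: is_token_tok => // j0; apply: notin_cl xT; apply: label_T.
by move: cj; rewrite j0.
Qed.

Let tk1_token e : e \in E -> is_token j (tk1 e).
Proof. by move=> eE; have [? _ _ _ _] := E_facts eE; have [] := E_mid eE => *; exact: tok_ok. Qed.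

Let tk2_token e : e \in E -> is_token j (tk2 e).
Proof. by move=> eE; have [_ ? _ _ _] := E_facts eE; have [] := E_mid eE => *; exact: tok_ok. Qed.

Lemma pieces_token_mass_last (X : {set token G}) :
  n * t * #|[set e in E | tk2 e \in X]| <= h * link_rank j X * #|E|.
Proof.
have x0b : j = 0 -> x0 \notin cl t b0.
  by move=> j0; apply: notin_cl x0T; apply: label_T; move: b0j; rewrite j0.
pose rv (e : G * G * G) := (e.2, e.1.2, e.1.1).
have rvI : injective rv by case=> -[? ?] ? [[? ?] ?] [-> -> ->].
have rvE e : (rv e \in pieces b0 x0 a0) = (e \in E).
  case: e => -[a x] b; rewrite !mem_pieces /=.
  have sw a1 x1 b1 a2 x2 b2 : wcol a1 x1 b1 = wcol a2 x2 b2 -> wcol b1 x1 a1 = wcol b2 x2 a2.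
    by move/wcol_swap12/wcol_swap23/wcol_swap12.
  by apply/eqP/eqP => /sw.
have rvK e : rv (rv e) = e by case: e => -[].
have cE : #|pieces b0 x0 a0| = #|E|.
  rewrite -[RHS](card_imset _ rvI) (_ : pieces b0 x0 a0 = rv @: E) //; apply/setP => e.
  by apply/idP/imsetP => [eE|[e' e'E ->]]; [exists (rv e); rewrite ?rvK // -rvE rvK|rewrite rvE].
have := pieces_token_mass a0 jJ b0j x0b X; rewrite cE; apply: leq_trans.
rewrite leq_mul2l -(card_imset _ rvI) subset_leq_card ?orbT //.
by apply/subsetP => _ /imsetP[e + ->]; rewrite in_set => /andP[eE eX]; rewrite in_set rvE eE.
Qed.

Let ends (F : {set G * G * G}) := tk1 @: F :|: tk2 @: F.

(** The rank [2 * #|F|] makes all descents disjoint, including the two of one triple; the middle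
    vertices are inner vertices of the paths and must be distinct as well. *)
Let good (F : {set G * G * G}) := [/\ F \subset E, link_rank j (ends F) = 2 * #|F|,
  {in F &, injective (fun e => e.1.2)} &
  forall e e', e \in F -> e' \in F -> e != e' -> e' \notin conflicts j a0 x0 b0 e].

Let card_ends F : good F -> #|ends F| = 2 * #|F|.
Proof.
case=> _ rF _ _; apply/eqP; rewrite eqn_leq -{2}rF (rank_le_card (link_rankP j)) andbT.
apply: leq_trans (leq_card_setU _ _) _.
by rewrite mul2n -addnn leq_add ?leq_imset_card.
Qed.

Let ends_inj F e e' w : good F -> e \in F -> e' \in F ->
  w = tk1 e \/ w = tk2 e -> w = tk1 e' \/ w = tk2 e' -> e = e'.
Proof.
move=> gF eF e'F; have cU : #|tk1 @: F :|: tk2 @: F| = 2 * #|F| := card_ends gF.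
have cUI := cardsUI (tk1 @: F) (tk2 @: F).
have le1 := leq_imset_card tk1 F; have le2 := leq_imset_card tk2 F.
rewrite cU in cUI.
have arith (p q i f : nat) : 2 * f + i = p + q -> p <= f -> q <= f -> p = f /\ q = f /\ i = 0 by clear; lia.
have [c1 [c2 c3]] := arith _ _ _ _ cUI le1 le2.
have I1 : {in F &, injective tk1} by apply/imset_injP/eqP.
have I2 : {in F &, injective tk2} by apply/imset_injP/eqP.
have dis := cards0_eq c3.
have no (u v : G * G * G) : u \in F -> v \in F -> tk1 u = tk2 v -> e = e'.
  move=> uF vF uv; have /setP/(_ (tk1 u)) := dis.
  by rewrite in_set0 inE imset_f //= uv imset_f.
case=> -> [] Ew; [exact: I1|exact: no Ew|apply: no (esym Ew) => //|exact: I2].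
Qed.

(** Repeated middle vertices block at most half of the triples, since [#|F| <= A * n] and the class
    of [x0] has at least [2 * A * n] elements: this fixes the threshold between the two cases. The
    tokens block [2 * h * #|F|] on either side and the conflicts [h * h * #|F|], in units of
    [1 / (n * t)]; doubling the sum yields the factor [8 * h + 2 * (h * h)]. *)
Lemma through_step F : good F -> (#|F|%:R <= A * #|S|%:R)%R ->
  exists2 e, e \notin F & good (e |: F).
Proof.
move=> gF le_k; have [FE rF midI ncF] := gF; have cF := card_ends gF.
pose X := ends F :|: [set w | link_rank j (w |: ends F) <= 2 * #|F|].
have rX : link_rank j X = 2 * #|F|.
  by apply: (rank_span (link_rankP j)) => // w; rewrite inE.
pose P4 := \bigcup_(e in F) [set e' in E | e'.1.2 == e.1.2].
pose bad := [set e in E | tk1 e \in X] :|: [set e in E | tk2 e \in X] :|: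
  (\bigcup_(e in F) conflicts j a0 x0 b0 e :|: P4).
have x0a (jz : j = 0) : x0 \notin cl t a0.
  by apply: notin_cl x0T; apply: label_T; move: a0j; rewrite jz.
have [/subset_leq_card Ebad|] := boolP (E \subset bad).
  exfalso; have E_gt0 : 0 < #|E| by apply/card_gt0P; exists (a0, x0, b0); rewrite mem_pieces.
  have b1 : n * t * #|[set e in E | tk1 e \in X]| <= h * link_rank j X * #|E| :=
    pieces_token_mass b0 jJ a0j x0a X.
  have b2 := pieces_token_mass_last X; rewrite rX in b1 b2.
  have b3 : n * t * #|\bigcup_(e in F) conflicts j a0 x0 b0 e| <= #|F| * (h * h * #|E|).
    apply: leq_trans (leq_mul (leqnn _) (card_bigcup_leq _ _)) _.
    rewrite big_distrr -sum_nat_const /=; apply: leq_sum => e eF.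
    apply: card_conflicts => //; last exact: (subsetP FE).
    by move=> e' e'E; have [? ? ? ? ?] := E_facts e'E; have [? _ _] := E_mid e'E.
  have b4 : #|P4| * #|vclass x0| <= #|F| * #|E|.
    apply: leq_trans (leq_mul (card_bigcup_leq _ _) (leqnn _)) _.
    rewrite big_distrl -sum_nat_const /=; apply: leq_sum => e eF.
    by have [_ ex _] := E_mid (subsetP FE _ eF); apply: (eq_leq (pieces_middle a0 b0 ex)).
  have A2 := A_ge2; have tA := t_geA.
  have n0 : (0 < n%:R :> R)%R by rewrite ltr0n n_gt0.
  have h0 : (1 <= h%:R :> R)%R by rewrite ler1n.
  have E0 : (0 < #|E|%:R :> R)%R by rewrite ltr0n.
  have b4' : 2 * #|P4| <= #|E|.
    rewrite -(ler_nat R) natrM; move: b4; rewrite -(ler_nat R) !natrM => b4.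
    have An0 : (0 < A * n%:R)%R by rewrite mulr_gt0 //; lra.
    rewrite -(ler_pM2r An0).
    have : (#|P4|%:R * (2 * A * n%:R) <= A * n%:R * #|E|%:R :> R)%R.
      apply: le_trans (ler_wpM2l _ x0_big) _ => //; apply: le_trans b4 _.
      by rewrite ler_wpM2r.
    by lra.
  have : n * t <= (8 * h + 2 * (h * h)) * #|F|.
    rewrite -(leq_pmul2r E_gt0).
    have : #|E| <= #|[set e in E | tk1 e \in X]| + #|[set e in E | tk2 e \in X]| +
        (#|\bigcup_(e in F) conflicts j a0 x0 b0 e| + #|P4|).
      apply: leq_trans Ebad _; do 2!apply: leq_trans (leq_card_setU _ _) (leq_add _ _) => //;
      exact: leq_card_setU.
    move/(leq_mul (leqnn (n * t))); move/(leq_mul (leqnn (n * t))): b4' => b4'.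
    rewrite !mulnDr; move: b1 b2 b3 b4'; clear; move: (n * t) => N.
    by move: #|E| => c; lia.
  rewrite -(ler_nat R) natrM (natrM _ (_ + _)) natrD !natrM; apply/negP; rewrite -ltNge.
  (* The bound [2 <= al] lets [A] absorb the [h * h] coming from the conflicts. *)
  have A2h : (2 * h%:R ^+ 2 <= A)%R.
    by have [al2 _] := al_adeg; rewrite /A ler_wpM2r // exprn_ge0 //; lra.
  apply: (@le_lt_trans _ _ ((8 * h%:R + 2 * (h%:R * h%:R)) * (A * n%:R)))%R.
    by rewrite ler_wpM2l //; nra.
  rewrite mulrA [ltRHS]mulrC ltr_pM2r //; apply: lt_le_trans tA.
  have h2 : (8 * h%:R + 2 * (h%:R * h%:R) < 144 * A * h%:R :> R)%R by nra.
  rewrite [ltRHS](_ : _ = 144 * A * h%:R * A)%R; last by ring.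
  by rewrite ltr_pM2r //; lra.
case/subsetPn => e eE; rewrite !in_setU !negb_or => /andP[/andP[e1X e2X] /andP[/bigcupP enc /bigcupP emid]].
have [ne1 r1] : tk1 e \notin ends F /\ 2 * #|F| < link_rank j (tk1 e |: ends F).
  by move: e1X; rewrite in_set eE in_setU negb_or in_set -ltnNge => /andP[].
have [ne2 r2] : tk2 e \notin ends F /\ 2 * #|F| < link_rank j (tk2 e |: ends F).
  by move: e2X; rewrite in_set eE in_setU negb_or in_set -ltnNge => /andP[].
have eF : e \notin F by apply: contra ne1 => eF; rewrite inE imset_f.
have rS w : 2 * #|F| < link_rank j (w |: ends F) -> link_rank j (w |: ends F) = #|ends F|.+1.
  move=> rw; apply/eqP; rewrite eqn_leq cF rw andbT.
  apply: leq_trans (rank_le_card (link_rankP j) _) _.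
  by rewrite cardsU1 cF -[leqRHS]add1n leq_add2r leq_b1.
exists e => //; split.
- by rewrite subUset sub1set eE.
- have -> : ends (e |: F) = tk1 e |: (tk2 e |: ends F).
    by rewrite /ends !imsetU1 setUACA -setUA.
  have [_ _ _ _ sep] := E_facts eE.
  have tX w : w \in ends F -> is_token j w.
    by case/setUP => /imsetP[e' /(subsetP FE) e'E ->]; [exact: tk1_token|exact: tk2_token].
  have sep' s1 s2 : s1 \in tok_labels j (tk1 e) -> s2 \in tok_labels j (tk2 e) -> s2 \notin cl t s1.
    by rewrite !tok_labelsE; exact: sep.
  have rX' : link_rank j (ends F) = #|ends F| by rewrite rF cF.
  have -> := link_rank_add2 jJ tX (tk1_token eE) (tk2_token eE) sep' rX' (rS _ r1) (rS _ r2).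
  by rewrite cF cardsU1 eF mulnDr.
- have nm e' : e' \in F -> e.1.2 != e'.1.2.
    by move=> e'F; apply/negP => ee'; apply: emid; exists e' => //; rewrite in_set eE.
  move=> e1 e2; rewrite !in_setU1 => /orP[/eqP->|e1F] /orP[/eqP->|e2F] //= E12.
  + by have := nm _ e2F; rewrite E12 eqxx.
  + by have := nm _ e1F; rewrite E12 eqxx.
  + exact: midI.
have nce e' : e' \in F -> e \notin conflicts j a0 x0 b0 e'.
  by move=> e'F; apply/negP => ?; apply: enc; exists e'.
move=> e1 e2; rewrite !in_setU1 => /orP[/eqP->|e1F] /orP[/eqP->|e2F] ne.
- by rewrite eqxx in ne.
- have := nce _ e2F; rewrite in_set eE in_set (subsetP FE _ e2F) /=.
  by rewrite disjoint_sym [X in ~~ (_ && ~~ X)]disjoint_sym.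
- exact: nce.
- exact: ncF.
Qed.

Lemma through_bound F : good F -> (#|F|%:R <= A * #|S|%:R)%R.
Proof.
move=> gF; have [FE rF midI ncF] := gF; have cF := card_ends gF.
have tX w : w \in ends F -> is_token j w.
  by case/setUP => /imsetP[e' /(subsetP FE) e'E ->]; [exact: tk1_token|exact: tk2_token].
have [|leg [stop [sl ls ld lc]]] := linked_legs tX; first by rewrite rF cF.
have m1 e : e \in F -> tk1 e \in ends F by move=> eF; rewrite inE imset_f.
have m2 e : e \in F -> tk2 e \in ends F by move=> eF; rewrite inE imset_f ?orbT.
have stop1 e : e \in F -> stop (tk1 e) \in labels j e.1.1.
  by move=> eF; have := sl _ (m1 _ eF); rewrite tok_labelsE.
have stop2 e : e \in F -> stop (tk2 e) \in labels j e.2.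
  by move=> eF; have := sl _ (m2 _ eF); rewrite tok_labelsE.
pose pr e := (stop (tk1 e), stop (tk2 e)).
have prI : {in F &, injective pr}.
  move=> e e' eF e'F [E1 E2]; apply/eqP/negPn/negP => ne; have /negP := ncF _ _ eF e'F ne; apply.
  rewrite in_set (subsetP FE _ e'F) /=; apply/andP; split; apply/pred0Pn.
    by exists (stop (tk1 e)); rewrite /= stop1 //= E1 stop1.
  by exists (stop (tk2 e)); rewrite /= stop2 //= E2 stop2.
pose way e := e.1.2 |: (leg (tk1 e) :|: leg (tk2 e)).
have legs_disjoint e e' z : e \in F -> e' \in F -> z \in leg (tk1 e) :|: leg (tk2 e) ->
    z \in leg (tk1 e') :|: leg (tk2 e') -> e = e'.
  move=> eF e'F.
  have H (u : G * G * G) : u \in F -> z \in leg (tk1 u) :|: leg (tk2 u) ->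
      exists w, [/\ w \in ends F, w = tk1 u \/ w = tk2 u & z \in leg w].
    move=> uF; rewrite inE => /orP[zu|zu]; [exists (tk1 u)|exists (tk2 u)].
      by split=> //; [exact: m1|left].
    by split=> //; [exact: m2|right].
  move=> /(H _ eF)[w [wX we zw]] /(H _ e'F)[w' [w'X we' zw']].
  have Ew : w = w'.
    apply/eqP/negPn/negP => ne; have := disjointFr (ld _ _ wX w'X ne) zw.
    by rewrite zw'.
  by apply: (ends_inj gF eF e'F we); rewrite Ew.
(* A middle vertex that was reached by the search starts a leg of its own triple, so disjointness of
   legs applies to it. *)
have mid_leg e e' : e \in F -> e' \in F -> e.1.2 \in leg (tk1 e') :|: leg (tk2 e') -> e = e'.
  move=> eF e'F xe'; have [xT _ [xR|[j_gt0 xa]]] := E_mid (subsetP FE _ eF).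
    move: xe'; rewrite inE => /orP[/(subsetP (ls _ (m1 _ e'F)))|/(subsetP (ls _ (m2 _ e'F)))];
      by rewrite inE (negPf xR) andbF.
  apply: legs_disjoint xe' => //; rewrite inE; apply/orP; left.
  have := m1 _ eF; rewrite /tk1 /tok; case: (j) j_gt0 lc => // i _ lc' xX.
  have [xl _] := lc' _ xX.
  by rewrite {1}xa.
have way_disjoint e e' z : e \in F -> e' \in F -> z \in way e -> z \in way e' -> e = e'.
  move=> eF e'F /setU1P[->|ze] /setU1P[|ze'].
  - exact: midI.
  - exact: mid_leg ze'.
  - by move=> Ez; apply/esym/mid_leg => //; rewrite -Ez.
  - exact: legs_disjoint ze ze'.
pose B p q := \bigcup_(e in F | pr e == (p, q)) way e.
have BE e : e \in F -> B (stop (tk1 e)) (stop (tk2 e)) = way e.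
  move=> eF; rewrite /B (big_pred1 e) // => e'; apply/andP/eqP => [[e'F /eqP/prI->//]|->//].
have tl e c : e \in F -> tok j e.1.2 c \in ends F -> near j e.1.2 c ->
    leg (tok j e.1.2 c) \subset way e -> linked (way e) e.1.2 (stop (tok j e.1.2 c)).
  move=> eF cX ec lw; apply: linkedS lw _; apply: token_linked ec; first exact: sl.
  by move=> y Ey; apply: lc; rewrite Ey.
have := linked_pairs_le al_adeg h_gt0 G_excl (L := S) (Q := pr @: F) (B := B).
rewrite card_in_imset // => ->//.
- by apply/set0Pn; exists s0; rewrite inE.
- move=> _ _ /imsetP[e eF [-> ->]]; have eE := subsetP FE _ eF.
  have [aj bj xa xb sep] := E_facts eE; have [xT _ _] := E_mid eE.
  split.
  + exact: labels_S aj (stop1 _ eF).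
  + exact: labels_S bj (stop2 _ eF).
  + apply: contraNneq (sep _ _ (stop1 _ eF) (stop2 _ eF)) => ->; exact: cl_refl.
  + rewrite BE //; apply: (linked_trans (x := e.1.2)); first by rewrite !inE eqxx.
      by apply: tl => //; [exact: m1|exact: subset_trans (subsetUl _ _) (subsetUr _ _)].
    by apply: tl => //; [exact: m2|exact: subset_trans (subsetUr _ _) (subsetUr _ _)].
  + rewrite BE // disjoints_subset !subUset sub1set in_setC.
    have legS w : w \in ends F -> leg w \subset ~: S.
      move=> wX; apply/subsetP => z /(subsetP (ls _ wX)); rewrite in_setD in_setC => /andP[zT _].
      by apply: contra zT; exact: label_T.
    by rewrite !legS ?m1 ?m2 // !andbT; apply: contra xT; exact: label_T.
- move=> p q p' q' z /imsetP[e eF [-> ->]] /imsetP[e' e'F [-> ->]].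
  by rewrite !BE // => ze ze'; rewrite (way_disjoint _ _ _ eF e'F ze ze').
Qed.

Lemma through_absurd : False.
Proof.
apply: (unbounded_family (good := good) (B := (A * #|S|%:R)%R)).
- split; rewrite ?sub0set ?cards0 /ends ?imset0 ?setU0 ?(rank0 (link_rankP j)) //.
  + by move=> e e'; rewrite inE.
  + by move=> e e'; rewrite inE.
- exact: through_step.
- exact: through_bound.
Qed.

End Through.

End Levels.

(** * The vertices of smallest closure *)

Section OneBlock.
Variables (G : sgraph) (t h : nat).
Hypothesis h_gt0 : 0 < h.
Hypothesis G_excl : ~ topological_subgraph (complete_graph 'I_h) G.
Hypothesis t_big : h.*2 * (h * h) <= t.
Variable T : {set G}.
Hypothesis T_cl : forall u v, u \in T -> v \in cl t u -> v \in T /\ cl t v = cl t u.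
Hypothesis T_inv : forall u u', pcol u u = pcol u' u' -> (u \in T) = (u' \in T).
Variables (R : realType) (al : R).
Hypotheses (al_adeg : is_adeg al) (t_ge : (144%:R * al ^+ 2 * h%:R ^+ 5 <= t%:R :> R)%R).

Let A := (al * h%:R ^+ 2)%R.

Section Source.
Variable v : G.
Hypothesis vT : v \in T.
Let lvl j := level T v j.
Let lab j := labels T v j.

Let lab_T i y s : y \in lvl i -> s \in lab i y -> s \in T.
Proof. by move=> yi sy; apply: (label_T T_inv vT); exact: labels_S sy. Qed.

(** Strong induction supplies the lower levels on which all counts rest. Where labels of two blocks
    meet first, the size of the class of [x] decides between the two contradictions. *)
Lemma all_mono j y : y \in lvl j -> mono t T v j y.
Proof.
move: y; elim/ltn_ind: j => -[_ y _|J IH x xJ].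
  by apply/monoP => s s'; rewrite !in_set1 => /eqP-> /eqP->; exact: cl_refl.
have monos i y : i <= J -> y \in lvl i -> mono t T v i y by move=> iJ; exact: IH.
have xT := levelS_notT xJ.
have xR : x \notin reach T v J by move: xJ; rewrite /lvl in_setD => /andP[].
have below s : s \in labels T v J.+1 x -> exists a, [/\ a \in lvl J, edge a x & s \in lab J a].
  by rewrite in_set => /existsP[a /and3P[]]; exists a.
apply/monoP => s1 s2 /below[a [aJ ax s1a]] /below[b [bJ bx s2b]].
apply/negPn/negP => s21.
have s1T := lab_T aJ s1a.
have [le|/ltW le] := leP (#|vclass x|%:R : R)%R (2 * A * #|vclass v|%:R)%R.
  apply: (branch_absurd h_gt0 G_excl t_big T_cl T_inv vT monos al_adeg t_ge (leqnn J) aJ ax) => //.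
    by move=> s sa; apply: (notin_cl T_cl) xT; exact: lab_T sa.
  by rewrite in_setD negb_and xR orbT.
apply: (through_absurd h_gt0 G_excl t_big T_cl T_inv vT monos al_adeg t_ge (leqnn J) aJ bJ xT) => //.
- by rewrite /near ax.
- by rewrite /near bx.
- move=> s s' sa s'b; apply: contra s21 => s's.
  have sT := lab_T aJ sa.
  have /monoP/(_ _ _ s'b s2b) s2s' := monos _ _ (leqnn J) bJ.
  have /monoP/(_ _ _ s1a sa) ss1 := monos _ _ (leqnn J) aJ.
  have [_ <-] := T_cl s1T ss1; have [_ <-] := T_cl sT s's; exact: s2s'.
by left.
Qed.

(** The levels of [y] and [y'] differ by at most one. If they differ, one end inherits all labels of
    the other and [all_mono] keeps them in one block. If they agree, labels in another block would
    make the edge a meeting of two blocks, with [y] both the middle vertex and the start of one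
    descent. *)
Lemma labels_step y y' j : y \in lvl j -> lab j y \subset cl t v -> edge y y' -> y' \notin T ->
  exists2 k, y' \in lvl k & lab k y' \subset cl t v.
Proof.
move=> yj labv yy' y'T.
have reach_next i x x' : x \in reach T v i -> edge x x' -> x' \notin T -> x' \in reach T v i.+1.
  by move=> xi xx' x'T; rewrite in_setU in_set x'T orbC; apply/orP; left; apply/existsP; exists x; rewrite xi.
have y'j : y' \in reach T v j.+1 by apply: reach_next yy' y'T; exact: level_reach.
have [k y'k kmin] := ex_minnP (ex_intro (fun k => y' \in reach T v k) _ y'j).
case: k y'k kmin => [/(label_T T_inv vT)|k y'k kmin]; first by rewrite (negPf y'T).
have y'l : y' \in lvl k.+1.
  by rewrite /lvl in_setD y'k andbT; apply/negP => /kmin; rewrite ltnn.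
have subk m x x' : x \in lvl m -> x' \in lvl m.+1 -> edge x x' -> lab m x \subset lab m.+1 x'.
  by move=> xm x'm xx'; exact: labels_sub.
exists k.+1 => //; have := kmin _ y'j; rewrite ltnS leq_eqVlt => /orP[/eqP Ekj|kj].
  subst k; apply/subsetP => s sy'; have [s1 s1y] := labels_ex yj.
  have s1v := subsetP labv _ s1y; have [_ <-] := T_cl vT s1v.
  have /monoP := all_mono y'l; apply=> //.
  by apply: (subsetP (subk _ _ _ yj y'l yy')).
have [j' Ej] : exists j', j = j'.+1 by case: (j) kj => // j' _; exists j'.
subst j; have yT := levelS_notT yj.
have [Ekj'|kj'] := eqVneq k j'; last first.
  have Ek : k.+1 = j'.
    apply/eqP; rewrite eqn_leq; move: kj; rewrite ltnS leq_eqVlt (negPf kj') /= => ->.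
    move: yj; rewrite /lvl in_setD => /andP[yj' _]; rewrite leqNgt; apply: contra yj' => lt.
    apply: (subsetP (reach_leq T v lt)); apply: (reach_next _ y') => //.
    by rewrite edge_sym.
  rewrite -Ek in yj labv; apply: subset_trans labv; apply: subk => //.
  by rewrite edge_sym.
subst k; apply/negPn/negP => /subsetPn[s' s'y' s'v].
have [s sy] := labels_ex yj; have sv := subsetP labv _ sy.
have monos i x : i <= j'.+1 -> x \in lvl i -> mono t T v i x by move=> _; exact: all_mono.
apply: (through_absurd (x0 := y) h_gt0 G_excl t_big T_cl T_inv vT monos al_adeg t_ge (leqnn _) yj y'l yT).
- by rewrite /near eqxx orbT.
- by rewrite /near edge_sym yy'.
- move=> s1 s2 s1y s2y'; have [s1T E1] := T_cl vT (subsetP labv _ s1y).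
  rewrite E1; apply: contra s'v => s2v; have [_ <-] := T_cl vT s2v.
  by have /monoP := all_mono y'l; apply.
- by right.
(* The class of [y] has at least [n * t / h] elements, hence at least [2 * A * n], as the case of a
   large class requires. *)
have := @tclass_size G t h h_gt0 G_excl t_big T T_cl T_inv v vT _ monos j'.+1 (inl y) (leqnn _) yj.
rewrite card_imset; last by move=> ? ? [].
rewrite -(ler_nat R) !natrM => le; have tA := t_geA t_ge.
have A2 : (2 <= A)%R := A_ge2 h_gt0 al_adeg; have h0 : (0 < h%:R :> R)%R by rewrite ltr0n.
rewrite -(ler_pM2l h0); apply: le_trans le.
have : (2 * A * h%:R * #|vclass v|%:R <= t%:R * #|vclass v|%:R)%R.
  by rewrite ler_wpM2r //; apply: le_trans tA; rewrite ler_pM2r // -/A; move: (A) A2 => c c2; nra.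
by rewrite /A; lra.
Qed.

(** The block of [v] is carried along the path to the last vertex [y] before [u]. Descents from the
    class of [u] by way of [y] fit the case of a small class: this class is no larger than that of
    [v], and it avoids all legs because [u] lies in [T]. *)
Lemma separated_absurd u : u \in T -> u \notin cl t v -> #|vclass u| <= #|vclass v| ->
  ~ linked (~: T) v u.
Proof.
move=> uT uv le_uv [p pe pT].
pose labelled x := exists2 j, x \in lvl j & lab j x \subset cl t v.
have trace q x : {subset q <= ~: T} -> path (@edge G) x (rcons q u) -> labelled x -> labelled (last x q).
  elim: q x => //= y q IH x qT /andP[xy pq] [j xj xv].
  apply: IH pq _; first by move=> z zq; apply: qT; rewrite inE zq orbT.
  by apply: labels_step xj xv xy _; have := qT y; rewrite inE eqxx in_setC; apply.
have [|j] := trace p v pT pe.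
  exists 0; first by rewrite /lvl inE.
  by apply/subsetP => s; rewrite in_set1 => /eqP->; exact: cl_refl.
set y := last v p => yj yv.
have yu : edge y u by move: pe; rewrite rcons_path => /andP[].
have monos i x : i <= j -> x \in lvl i -> mono t T v i x by move=> _; exact: all_mono.
apply: (branch_absurd (x0 := u) h_gt0 G_excl t_big T_cl T_inv vT monos al_adeg t_ge (leqnn _) yj yu).
- by move=> s sy; have [_ ->] := T_cl vT (subsetP yv _ sy).
- by rewrite in_setD uT.
have A2 : (2 <= A)%R := A_ge2 h_gt0 al_adeg; have : (#|vclass u|%:R <= #|vclass v|%:R :> R)%R by rewrite ler_nat.
have : (0 <= #|vclass v|%:R :> R)%R by [].
by move=> n0 le; apply: le_trans le _; rewrite -/A; move: (A) A2 => c c2; nra.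
Qed.

End Source.

Lemma linked_same_block u v : u \in T -> v \in T -> linked (~: T) u v -> v \in cl t u.
Proof.
move=> uT vT uv; apply/negPn/negP => vu.
have uv' : u \notin cl t v by apply: contra vu => /(cl_sym T_cl vT).
have [le|/ltnW le] := leqP #|vclass v| #|vclass u|.
  exact: (separated_absurd uT vT vu le).
exact: (separated_absurd vT uT uv' le (linked_sym uv)).
Qed.

(** A path between two vertices of [T] is cut at its visits to [T]; each segment stays in one
    closure by [linked_same_block], which is the invariant [P]. *)
Lemma one_block : connected G -> {in T &, forall u v, v \in cl t u}.
Proof.
move=> [_ conn] u v uT vT.
pose P x := exists2 w, w \in cl t u & x = w \/ (x \notin T /\ linked (~: T) w x).
have Pedge x y : P x -> edge x y -> P y.
  case=> w wu wx xy; have [wT Ew] := T_cl uT wu.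
  have wy : linked (~: T) w y.
    case: wx xy => [-> wy|[xT [p pe pT]] xy]; first by exists [::] => //=; rewrite wy.
    exists (rcons p x); first by rewrite rcons_path pe last_rcons.
    by move=> z; rewrite mem_rcons inE => /predU1P[->|/pT//]; rewrite in_setC.
  have [yT|yT] := boolP (y \in T); last by exists w => //; right.
  by exists y; [rewrite -Ew; exact: linked_same_block|left].
have [p pe vp] := connectP (conn u v).
have : P v.
  rewrite vp; have : P u by exists u; [exact: cl_refl|left].
  by elim: p (u) pe {vp} => //= y p IH x /andP[xy pe] Px; apply: IH pe (Pedge _ _ Px xy).
by case=> w wu [->//|[]]; rewrite vT.
Qed.

End OneBlock.

(** * From one block to one color class *)

Lemma single_class_closure (R : realType) (al : R) (G : sgraph) (t h : nat) :
  is_adeg al -> 0 < h -> connected G ->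
  ~ topological_subgraph (complete_graph 'I_h) G ->
  (144%:R * al ^+ 2 * h%:R ^+ 5 <= t%:R :> R)%R ->
  exists v0 : G, forall v, v \in vclass v0 -> vclass v0 \subset cl t v.
Proof.
move=> al_adeg h_gt0 conn G_excl t_ge.
have t_big : h.*2 * (h * h) <= t.
  have [al2 _] := al_adeg; rewrite -(ler_nat R); apply: le_trans t_ge.
  have h1 : (1 <= h%:R :> R)%R by rewrite ler1n.
  rewrite -muln2 !natrM (_ : _ ^+ 5 = h%:R ^+ 3 * h%:R ^+ 2)%R; last by ring.
  have h3 : (0 < h%:R ^+ 3 :> R)%R by rewrite exprn_gt0 //; lra.
  rewrite [leLHS](_ : _ = h%:R ^+ 3 * 2)%R; last by ring.
  rewrite mulrCA ler_pM2l //.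
  have al4 : (4 <= al ^+ 2)%R by nra.
  have h2 : (1 <= h%:R ^+ 2 :> R)%R by rewrite expr_ge1 //; lra.
  by move: (al ^+ 2)%R (h%:R ^+ 2)%R al4 h2 => c d c4 d1; nra.
have [/card_gt0P[u0 _] _] := conn.
pose v0 := [arg min_(v < u0) #|cl t v|].
have v0min (v : G) : #|cl t v0| <= #|cl t v| by rewrite /v0; case: arg_minnP => // w _ min_w; exact: min_w.
pose T := [set v : G | #|cl t v| == #|cl t v0|].
(* A closure contained in a closure of minimum size is equal to it; so the closures of vertices of
   [T] are blocks. *)
have T_cl (u v : G) : u \in T -> v \in cl t u -> v \in T /\ cl t v = cl t u.
  rewrite in_set => /eqP cu vu; have Euv : cl t v = cl t u.
    by apply/eqP; rewrite eqEcard cl_trans // cu v0min.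
  by rewrite in_set Euv cu.
have T_inv (u u' : G) : pcol u u = pcol u' u' -> (u \in T) = (u' \in T).
  move=> E; rewrite !in_set; congr (_ == _).
  have F (w : G) : #|cl t w| = #|[set x | x \in cl t w]| by apply: eq_card => x; rewrite [RHS]in_set.
  by rewrite !F; apply: (wcol_card E) => d d' _ E2 _; exact: (cl_inv t (wcol_ab E2)).
have v0T : v0 \in T by rewrite in_set.
have vT (v : G) : v \in vclass v0 -> v \in T by exact: (label_T T_inv v0T).
exists v0 => v /vT vT'; apply/subsetP => w /vT wT.
exact: (one_block h_gt0 G_excl t_big T_cl T_inv al_adeg t_ge conn vT' wT).
Qed.

Theorem theorem4p1 (R : realType) (a_deg : R) (a_degP : is_adeg a_deg)
    (h : nat) (h_ge1 : 1 <= h)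
    (G : sgraph) (G_conn : connected G)
    (G_excl : ~ topological_subgraph (complete_graph 'I_h) G)
    (t : nat) (t_ge : (144%:R * a_deg ^+ 2 * h%:R ^+ 5 <= t%:R :> R)%R) :
  exists2 c0 : color (wl3 G),
    c0 \in codom (fun v : G => wl3 G [tuple v; v; v]) &
    let chi (v w : G) := wl3 G [tuple v; w; w] in
    let X := [set v : G | wl3 G [tuple v; v; v] == c0] in
    forall v : G, v \in X -> X \subset pair_closure chi t [set v].
Proof.
have [v0 v0P] := single_class_closure a_degP h_ge1 G_conn G_excl t_ge.
exists (wl3 G [tuple v0; v0; v0]); first by apply/codomP; exists v0.
exact: v0P.
Qed.
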